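(* Let $n\ge2$ be an integer and let $K,L\subset\mathbb{R}^n$ be origin-symmetric convex bodies. Then $$\widetilde V_{n+2}(K+L)^{\frac1{n+2}}\ge\widetilde V_{n+2}(K)^{\frac1{n+2}}+\widetilde V_{n+2}(L)^{\frac1{n+2}}.$$ Equality holds if and only if $K$ and $L$ are dilates of each other.
   Context: A convex body in $\mathbb{R}^n$ is a compact convex set with nonempty interior; it is origin-symmetric if $K=-K$. For a convex body $K$ with the origin in its interior, its radial function is $\rho_K(u)=\max\{\lambda>0:\lambda u\in K\}$, $u\in\mathbb{S}^{n-1}$, and for real $q$ the $q$-th dual quermassintegral is $$\widetilde V_q(K)=\frac1n\int_{\mathbb{S}^{n-1}}\rho_K(u)^q\,du,$$ where $du$ is spherical Lebesgue measure on the unit sphere. For $q>0$, equivalently $\widetilde V_q(K)=\frac qn\int_K|x|^{q-n}\,dx$. $K+L$ is the Minkowski sum. $K$ and $L$ are dilates of each other if $L=\lambda K$ for some $\lambda>0$. *)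

(* Defs.v *)
From HB Require Import structures.
From mathcomp Require Import all_boot all_order all_algebra.
From mathcomp Require Import all_classical all_reals all_analysis.
From mathcomp Require Import measurable_realfun.

Set Implicit Arguments.
Unset Strict Implicit.
Unset Printing Implicit Defensive.

Import Order.TTheory GRing.Theory Num.Theory.
Import numFieldNormedType.Exports.

Local Open Scope classical_set_scope.
Local Open Scope ring_scope.

Section measurable_rV.
Context (R : realType) (n : nat).

Definition rV_coord (i : 'I_n) (x : 'rV[R]_n) : measurableTypeR R := x ord0 i.

(* The product sigma-algebra on R^n: it is generated by the coordinate maps,
   exactly as the library does for n.-tuple R, and it coincides with the Borel
   sigma-algebra of the topology of 'rV[R]_n. *)
Let rV_set0 : g_sigma_preimage rV_coord set0.
Proof. exact: sigma_algebra0. Qed.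

Let rV_setC A : g_sigma_preimage rV_coord A ->
  g_sigma_preimage rV_coord (~` A).
Proof. exact: sigma_algebraC. Qed.

Let rV_bigcup (F : (set 'rV[R]_n)^nat) :
  (forall i, g_sigma_preimage rV_coord (F i)) ->
  g_sigma_preimage rV_coord (\bigcup_i (F i)).
Proof. exact: sigma_algebra_bigcup. Qed.

HB.instance Definition _ := @isMeasurable.Build default_measure_display
  'rV[R]_n (g_sigma_preimage rV_coord) rV_set0 rV_setC rV_bigcup.

Lemma measurable_rV_coord (i : 'I_n) :
  measurable_fun [set: 'rV[R]_n] (rV_coord i).
Proof.
move=> _ Y mY; rewrite setTI; apply: sub_sigma_algebra => /=.
rewrite -bigcup_seq/=; exists i => /=; first by rewrite mem_index_enum.
by exists Y => //; rewrite setTI.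
Qed.

Lemma measurable_fun_rV d (T : measurableType d) (f : T -> 'rV[R]_n) :
  (forall i, measurable_fun [set: T] (rV_coord i \o f)) ->
  measurable_fun [set: T] f.
Proof.
move=> mf.
have sub : g_sigma_preimage (fun i => rV_coord i \o f) `<=` measurable.
  apply: smallest_sub; first exact: sigma_algebra_measurable.
  by rewrite -bigcup_seq; apply: bigcup_sub => i _ _ [B mB <-]; exact: mf.
by move=> _ A mA; apply: sub; rewrite g_sigma_preimage_comp; exists A.
Qed.
End measurable_rV.

Section lebesgue_rV.
Context {R : realType}.
Local Open Scope ereal_scope.

Definition rV_cons n (p : measurableTypeR R * 'rV[R]_n) : 'rV[R]_n.+1 :=
  row_mx (const_mx p.1 : 'rV_1) p.2.

Lemma rV_cons0 n p : @rV_cons n p ord0 ord0 = p.1.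
Proof.
have := row_mxEl (const_mx p.1 : 'rV_1) p.2 ord0 ord0; rewrite [RHS]mxE => <-.
by congr (row_mx _ _ _ _); apply/ord_inj.
Qed.

Lemma rV_consS n p j : @rV_cons n p ord0 (lift ord0 j) = p.2 ord0 j.
Proof.
have <- := row_mxEr (const_mx p.1 : 'rV_1) p.2 ord0 j.
by congr (row_mx _ _ _ _); apply/ord_inj.
Qed.

Lemma measurable_rV_cons n : measurable_fun setT (@rV_cons n).
Proof.
apply: measurable_fun_rV => i.
case: (unliftP ord0 i) => [j ->|->].
  rewrite (_ : _ \o _ = @rV_coord R n j \o snd); last first.
    by apply/funext => p; exact: rV_consS.
  exact: measurableT_comp (measurable_rV_coord j) measurable_snd.
rewrite (_ : _ \o _ = fst); first exact: measurable_fst.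
by apply/funext => p; exact: rV_cons0.
Qed.

Section lebesgue_cons.
Context (n : nat) (mu : {sigma_finite_measure set 'rV[R]_n -> \bar R}).

Definition lebesgue_cons : set 'rV[R]_n.+1 -> \bar R :=
  pushforward (@lebesgue_measure R \x mu) (@rV_cons n).

Let prod : {measure set (measurableTypeR R * 'rV[R]_n)%type -> \bar R} :=
  @lebesgue_measure R \x mu.

Let cons0 : lebesgue_cons set0 = 0.
Proof.
by rewrite /lebesgue_cons /pushforward preimage_set0 [LHS](measure0 prod).
Qed.

Let cons_ge0 A : 0 <= lebesgue_cons A.
Proof. exact: (measure_ge0 prod). Qed.

Let cons_sigma_additive : semi_sigma_additive lebesgue_cons.
Proof.
exact: (@measure_semi_sigma_additive _ _ _
  (measure_function_pushforward__canonical__measure_function_Measure prod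
     (@measurable_rV_cons n))).
Qed.

HB.instance Definition _ := isMeasure.Build _ _ _ lebesgue_cons
  cons0 cons_ge0 cons_sigma_additive.

Let cons_sigma_finite : sigma_finite setT lebesgue_cons.
Proof.
have /sigma_finiteP[F [FT ndF mF]] := sigma_finiteT (@lebesgue_measure R).
have /sigma_finiteP[G [GT ndG mG]] := sigma_finiteT mu.
pose back (y : 'rV[R]_n.+1) : measurableTypeR R * 'rV[R]_n :=
  (y ord0 ord0, \row_j y ord0 (lift ord0 j)).
have mback : measurable_fun setT back.
  apply/measurable_fun_pairP; split; first exact: (measurable_rV_coord ord0).
  apply: measurable_fun_rV => j.
  rewrite (_ : _ \o _ = @rV_coord R n.+1 (lift ord0 j)).
    exact: measurable_rV_coord.
  by apply/funext => y; rewrite /rV_coord /= mxE.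
have consK : cancel (@rV_cons n) back.
  move=> [x y]; rewrite /back rV_cons0; congr pair.
  by apply/rowP => j; rewrite mxE rV_consS.
exists (fun k => back @^-1` (F k `*` G k)).
  rewrite -preimage_bigcup -[LHS](preimage_setT back); congr (_ @^-1` _).
  rewrite -setXTT FT GT predeqE => -[x y]; split.
    move=> [/= [k _ Fkx] [l _ Gly]]; exists (maxn k l) => //; split.
    - by move: x Fkx; exact/subsetPset/ndF/leq_maxl.
    - by move: y Gly; exact/subsetPset/ndG/leq_maxr.
  by move=> [k _ []/= ? ?]; split; exists k.
move=> k; have [mFk Fkoo] := mF k; have [mGk Gkoo] := mG k; split.
  by rewrite -[X in measurable X]setTI; apply: mback => //; exact: measurableX.
rewrite /lebesgue_cons /pushforward -comp_preimage (_ : back \o _ = id).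
  by rewrite preimage_id product_measure1E// lte_mul_pinfty// ge0_fin_numE.
by apply/funext => p /=; rewrite consK.
Qed.

HB.instance Definition _ := Measure_isSigmaFinite.Build _ _ _ lebesgue_cons
  cons_sigma_finite.

End lebesgue_cons.

Fixpoint lebesgue_rV n : {sigma_finite_measure set 'rV[R]_n -> \bar R} :=
  if n is m.+1 then lebesgue_cons (lebesgue_rV m) else \d_(0%R : 'rV[R]_0).

Lemma lebesgue_rV_box n (A : 'I_n -> set R) : (forall i, measurable (A i)) ->
  lebesgue_rV n [set x : 'rV[R]_n | forall i, A i (x ord0 i)] =
  \prod_(i < n) lebesgue_measure (A i).
Proof.
elim: n A => [A _|n ih A mA].
  by rewrite big_ord0 /= diracE mem_set//= => -[].
have mB : measurable [set y : 'rV[R]_n | forall i, A (lift ord0 i) (y ord0 i)].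
  rewrite (_ : mkset _ = \bigcap_(i in [set: 'I_n])
      (@rV_coord R n i @^-1` A (lift ord0 i))); last first.
    by apply/seteqP; split => [y Ay i _|y Ay i]; [exact: Ay|exact: (Ay i)].
  apply: fin_bigcap_measurable; first exact: finite_finset.
  move=> i _; rewrite -[X in measurable X]setTI.
  by apply: measurable_rV_coord => //; exact: mA.
rewrite big_ord_recl -ih// [LHS]/= /lebesgue_cons /pushforward.
set B := [set _ | _] in mB *.
transitivity ((@lebesgue_measure R \x lebesgue_rV n) (A ord0 `*` B));
  last by rewrite product_measure1E//; exact: mA.
congr (_ _); apply/seteqP; split => -[x y] /=.
  move=> Axy; split; first by have := Axy ord0; rewrite rV_cons0.
  by move=> i; have := Axy (lift ord0 i); rewrite rV_consS.
move=> [Ax Ay] i.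
by case: (unliftP ord0 i) => [j ->|->]; rewrite ?rV_consS ?rV_cons0.
Qed.

End lebesgue_rV.

Section sphere.
Context {R : realType} {n : nat}.

Definition enorm (x : 'rV[R]_n) : R := Num.sqrt (\sum_(i < n) x ord0 i ^+ 2).

Definition sphere : set 'rV[R]_n := [set u | enorm u = 1].

(* The spherical Lebesgue measure of A is n times the volume of the cone
   {r u | 0 < r <= 1, u in A}: this is the normalization for which integration
   in polar coordinates reads dx = r^(n-1) dr du. *)
Definition sphere_cone (A : set 'rV[R]_n) : set 'rV[R]_n :=
  [set r *: u | r in `]0, 1]%classic & u in sphere `&` A].

Definition sphere_measure (A : set 'rV[R]_n) : \bar R :=
  (n%:R%:E * lebesgue_rV n (sphere_cone A))%E.

Lemma enormZ (r : R) (x : 'rV[R]_n) : 0 <= r -> enorm (r *: x) = r * enorm x.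
Proof.
move=> r0; rewrite /enorm.
under eq_bigr do rewrite mxE exprMn.
by rewrite -mulr_sumr sqrtrM ?sqr_ge0// sqrtr_sqr ger0_norm.
Qed.

Let proj (x : 'rV[R]_n) : 'rV[R]_n := (enorm x)^-1 *: x.
Let unit_ball : set 'rV[R]_n := enorm @^-1` `]0, 1]%classic.

Let sphere_coneE A : sphere_cone A = proj @^-1` A `&` unit_ball.
Proof.
apply/seteqP; split => [y [r]|x [Ax]].
  rewrite /= in_itv/= => /andP[r0 r1] [u [u1 Au] <-].
  have ru : enorm (r *: u) = r by rewrite enormZ ?ltW// u1 mulr1.
  split; last by rewrite /unit_ball /= in_itv/= ru r0.
  by rewrite /proj /= ru scalerA mulVf ?gt_eqF// scale1r.
rewrite /unit_ball /= in_itv/= => /andP[x0 x1].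
exists (enorm x); first by rewrite /= in_itv/= x0.
exists (proj x); last by rewrite /proj scalerA divff ?gt_eqF// scale1r.
by split => //; rewrite /sphere /proj /= enormZ ?invr_ge0 ?ltW// mulVf ?gt_eqF.
Qed.

Lemma measurable_enorm : measurable_fun setT enorm.
Proof.
rewrite (_ : enorm = fun x => (\sum_(i < n) rV_coord i x ^+ 2) `^ 2^-1).
  apply: (measurableT_comp (measurable_powR _)).
  apply: measurable_sum => i; apply: measurable_funX.
  exact: measurable_rV_coord.
apply/funext => x; rewrite powR12_sqrt//.
by apply: sumr_ge0 => i _; exact: sqr_ge0.
Qed.

Let measurable_unit_ball : measurable unit_ball.
Proof. by rewrite -[X in measurable X]setTI; exact: measurable_enorm. Qed.

Let measurable_proj : measurable_fun setT proj.
Proof.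
apply: measurable_fun_rV => i.
rewrite (_ : _ \o _ = fun x => enorm x `^ (-1) * rV_coord i x).
  apply: measurable_funM; last exact: measurable_rV_coord.
  exact: (measurableT_comp (measurable_powR _) measurable_enorm).
by apply/funext => x /=; rewrite /rV_coord mxE powR_inv1// sqrtr_ge0.
Qed.

Let mu : {measure set 'rV[R]_n -> \bar R} :=
  measure_function_pushforward__canonical__measure_function_Measure
    (mscale n%:R%:nng (mrestr (lebesgue_rV n) measurable_unit_ball))
    measurable_proj.

Let sphere_measureE : sphere_measure = mu.
Proof. by apply/funext => A; rewrite /sphere_measure sphere_coneE. Qed.

Let sphere_measure0 : sphere_measure set0 = 0%E.
Proof. by rewrite sphere_measureE measure0. Qed.

Let sphere_measure_ge0 A : (0 <= sphere_measure A)%E.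
Proof. by rewrite sphere_measureE measure_ge0. Qed.

Let sphere_measure_sigma_additive : semi_sigma_additive sphere_measure.
Proof. by rewrite sphere_measureE; exact: measure_semi_sigma_additive. Qed.

HB.instance Definition _ := isMeasure.Build _ _ _ sphere_measure
  sphere_measure0 sphere_measure_ge0 sphere_measure_sigma_additive.

End sphere.

Section convex_bodies.
Context {R : realType} {n : nat}.
Implicit Types K L : set 'rV[R]_n.

Definition convex_body K :=
  [/\ compact K, convex_set (K : set (convex_lmodType 'rV[R]_n))
    & K° !=set0].

Definition origin_symmetric K := K = [set - x | x in K].

Definition minkowski_sum K L : set 'rV[R]_n :=
  [set x + y | x in K & y in L].

Definition dilates K L := exists2 l : R, 0 < l & L = [set l *: x | x in K].

(* For a convex body with the origin in its interior the supremum is attained,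
   so this is the maximum of the set. *)
Definition radial K (u : 'rV[R]_n) : R := sup [set l | 0 < l /\ K (l *: u)].

Definition dual_quermass (q : R) K : R :=
  n%:R^-1 * \int[sphere_measure]_(u in sphere) (radial K u `^ q).

End convex_bodies.

(* Main.v *)
(** The dual quermassintegral of order [n + 2] is, up to a constant, the polar
    second moment [int_K |x|^2 dx].  For a fixed direction [a], a weighted
    Brunn-Minkowski theorem with density [(<a, x> + c)^2], applied to the halves
    [<a, x> >= 0] of the bodies, shows that the [1/(n + 2)]-th power of
    [J_a(K) = int_K <a, x>^2 dx] is superadditive.  Since summing over an
    arbitrary frame loses too much, the frame is adapted to the bodies: the
    quadratic form [a |-> J_a(L)/I(L) - J_a(K)/I(K)] has trace zero, so there is
    a frame of isotropic vectors, on which all the ratios [J_a(L)/J_a(K)] agree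
    and the directional inequalities add up without loss.

    The weighted theorem and its equality case go by induction on the
    dimension: slices are compared along the monotone transport between the
    slice profiles.  Equality forces the transport to be affine and matching
    slices to be homothetic; that the translation vector does not depend on
    the slice follows from the concavity of the support functions of the
    slices.  For symmetric bodies the resulting translation of the half bodies
    lies in the hyperplane [<a, x> = 0] and preserves a symmetric bounded
    section, hence vanishes. *)
Require Import Defs.
From HB Require Import structures.
From mathcomp Require Import all_boot all_order all_algebra.
From mathcomp Require Import all_classical all_reals all_analysis.
From mathcomp Require Import measurable_realfun.
From mathcomp Require Import ring lra.

Set Implicit Arguments.
Unset Strict Implicit.
Unset Printing Implicit Defensive.

Import Order.TTheory GRing.Theory Num.Theory.
Import numFieldNormedType.Exports.

Local Open Scope classical_set_scope.
Local Open Scope ring_scope.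

(** * One-dimensional transport *)

(** The exponent [n + 2] is the degree of homogeneity of [J_a]: [n] from the volume and 2 from the
    weight.

    With [p = n + 2], the map [(A, B) |-> (A^(1/p) + B^(1/p))^p] is concave and homogeneous of
    degree 1. Summing it over the pairs [(J_i(K), J_i(L))] of an arbitrary frame therefore gives at
    most its value at the sums, which is the wrong direction. It is additive only along a ray, that
    is, when all the ratios [J_i(L) / J_i(K)] agree. The trace of the quadratic form vanishes
    because [J_a] sums to [I] over every Parseval frame.

    Halves are needed because the square of an affine function is monotone in its values only where
    these are nonnegative. The weighted theorem asks for positive weighted volume, a condition that
    passes to the slices at interior heights, and the induction starts in dimension 0, where the
    weighted volume is the square of the constant term.

    For equality, one direction of positive moment is enough: by symmetry the halves in that
    direction determine the bodies. *)

Lemma subrX_ge0 (R : realDomainType) (x y : R) k : 0 <= x -> 0 <= y ->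
  0 <= (x - y) * (x ^+ k - y ^+ k).
Proof.
move=> x0 y0; case: (leP y x) => xy.
  by rewrite mulr_ge0// subr_ge0// lerXn2r.
by rewrite mulr_le0// subr_le0 ?lerXn2r ?nnegrE// ltW.
Qed.

(* Convexity of [x ^+ k.+1] with the weights [(1 + z)^-1] and [z / (1 + z)] at
   the points [1 + z] and [r * (1 + z) / z], denominators cleared. *)
Lemma transport_ineq (R : realFieldType) (z r : R) k : 0 < z -> 0 < r ->
  z ^+ k * (1 + r) ^+ k.+1 <= (1 + z) ^+ k * (z ^+ k + r ^+ k.+1).
Proof.
move=> z0 r0; elim: k => [|k ih]; first by rewrite !expr0 !mul1r !expr1.
have -> : (1 + z) ^+ k.+1 * (z ^+ k.+1 + r ^+ k.+2) =
    (z * (1 + r)) * ((1 + z) ^+ k * (z ^+ k + r ^+ k.+1)) +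
    (1 + z) ^+ k * ((r - z) * (r ^+ k.+1 - z ^+ k.+1)).
  by rewrite !exprS; ring.
have -> : z ^+ k.+1 * (1 + r) ^+ k.+2 =
    (z * (1 + r)) * (z ^+ k * (1 + r) ^+ k.+1) by rewrite !exprS; ring.
rewrite -[leLHS]addr0 lerD//.
  by rewrite ler_pM2l// mulr_gt0// addr_gt0.
by rewrite mulr_ge0 ?exprn_ge0 ?subrX_ge0// ?addr_ge0 ?ltW.
Qed.

(** The recursion behind [transport_ineq] writes the defect at [k.+1] as a positive multiple of the
    defect at [k] plus [(1 + z) ^+ k * ((r - z) * (r ^+ k.+1 - z ^+ k.+1))]. A zero defect kills the
    second term, which forces [z = r]. The exponents start one higher because [transport_ineq] at
    [k = 0] is an identity. *)
Lemma transport_ineq_eq (R : realFieldType) (z r : R) k : 0 < z -> 0 < r ->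
  z ^+ k.+1 * (1 + r) ^+ k.+2 = (1 + z) ^+ k.+1 * (z ^+ k.+1 + r ^+ k.+2) ->
  z = r.
Proof.
move=> z0 r0 e.
have: z ^+ k.+1 * (1 + r) ^+ k.+2 =
    (z * (1 + r)) * (z ^+ k * (1 + r) ^+ k.+1) by rewrite !exprS; ring.
rewrite e.
have -> : (1 + z) ^+ k.+1 * (z ^+ k.+1 + r ^+ k.+2) =
    (z * (1 + r)) * ((1 + z) ^+ k * (z ^+ k + r ^+ k.+1)) +
    (1 + z) ^+ k * ((r - z) * (r ^+ k.+1 - z ^+ k.+1)).
  by rewrite !exprS; ring.
have h1 : 0 <= z * (1 + r) * ((1 + z) ^+ k * (z ^+ k + r ^+ k.+1)) -
     z * (1 + r) * (z ^+ k * (1 + r) ^+ k.+1).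
  rewrite -mulrBr mulr_ge0 ?subr_ge0 ?transport_ineq//.
  by rewrite ltW// mulr_gt0// addr_gt0.
have h2 : 0 <= (r - z) * (r ^+ k.+1 - z ^+ k.+1).
  by rewrite subrX_ge0// ltW.
have h3 : 0 < (1 + z) ^+ k by rewrite exprn_gt0// addr_gt0.
move=> e1.
have : (1 + z) ^+ k * ((r - z) * (r ^+ k.+1 - z ^+ k.+1)) = 0.
  apply/eqP; rewrite eq_le [X in _ && X]mulr_ge0 ?(ltW h3)// andbT; lra.
move/eqP; rewrite !mulf_eq0 gt_eqF//= !subr_eq0 => /orP[/eqP->//|].
by rewrite eqrXn2 ?ltW// => /eqP.
Qed.

(** With [X = x ^+ k.+1], [Y = y ^+ k.+1], [Z = (x + y) ^+ k.+1], [r = rho ^+ k.+2] and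
    [C = (1 + rho) ^+ k.+2], the left side is the lower bound for the derivative in [dPhi], and the
    right side is a positive factor times the defect of [transport_ineq] at [z = y / x]. *)
Lemma transport_eqn (R : fieldType) (X Y Z r C : R) : X != 0 -> Y != 0 ->
  Z * (1 + Y^-1 * (r * X)) - C * X =
  (Z / X * (Y / X + r) - Y / X * C) * (X * X / Y).
Proof. by move=> X0 Y0; field; apply/andP. Qed.

Lemma root_exists (R : realType) (x : R) k : 0 < x -> exists2 y : R, 0 < y & x = y ^+ k.+1.
Proof.
move=> z0; exists (x `^ k.+1%:R^-1); first exact: powR_gt0.
by rewrite -powR_mulrn ?powR_ge0// -powRrM mulVf ?pnatr_eq0// powRr1// ltW.
Qed.

Section transport.
Context {R : realType}.

Lemma within_itv_IVT (F : R -> R) (l r v : R) : l < r ->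
  {within `[l, r], continuous F} -> F l < v < F r ->
  exists2 t, t \in `]l, r[ & F t = v.
Proof.
move=> lr cF /andP[lv vr].
have [|t tlr Ft] := @IVT R F l r v (ltW lr) cF.
  by rewrite ge_min le_max (ltW lv) (ltW vr) orbT.
exists t => //; move: tlr; rewrite !in_itv/= => /andP[lt tr].
rewrite !lt_neqAle lt tr !andbT; apply/andP; split; apply/eqP => e.
- by move: lv; rewrite e Ft ltxx.
- by move: vr; rewrite -e Ft ltxx.
Qed.

Lemma affine_onto_endpoints (c q l r l' r' : R) : 0 < q -> l < r -> l' < r' ->
  (forall s, s \in `]l, r[ -> q * s + c \in `]l', r'[) ->
  (forall t, t \in `]l', r'[ -> exists2 s, s \in `]l, r[ & q * s + c = t) ->
  l' = q * l + c /\ r' = q * r + c.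
Proof.
move=> q0 lr lr' h1 h2; split; apply/eqP; rewrite eq_le; apply/andP; split.
- apply/ler_addgt0Pr => e e0.
  pose s := l + Num.min (e / q) ((r - l) / 2).
  have m0 : 0 < Num.min (e / q) ((r - l) / 2).
    by rewrite lt_min !divr_gt0 ?subr_gt0.
  have : s \in `]l, r[.
    rewrite in_itv/= /s ltrDl m0/=.
    have : Num.min (e / q) ((r - l) / 2) <= (r - l) / 2 by rewrite ge_min lexx orbT.
    lra.
  move=> /h1; rewrite in_itv/= => /andP[/ltW h _]; apply: (le_trans h).
  rewrite /s mulrDr addrAC lerD2l mulrC -ler_pdivlMr// ge_min lexx//.
- rewrite leNgt; apply/negP => h.
  pose t := Num.min (q * l + c) ((l' + r') / 2).
  have : t \in `]l', r'[.
    by rewrite in_itv/= lt_min gt_min h /=; apply/andP; split; [|apply/orP; right]; lra.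
  move=> /h2[s]; rewrite in_itv/= => /andP[ls _] e.
  have : t <= q * l + c by rewrite ge_min lexx.
  by rewrite -e lerD2r ler_pM2l// leNgt ls.
- rewrite leNgt; apply/negP => h.
  pose t := Num.max (q * r + c) ((l' + r') / 2).
  have : t \in `]l', r'[.
    rewrite in_itv/= gt_max lt_max h /=; apply/andP; split; first (apply/orP; right); lra.
  move=> /h2[s]; rewrite in_itv/= => /andP[_ ls] e.
  have : q * r + c <= t by rewrite le_max lexx.
  by rewrite -e lerD2r ler_pM2l// leNgt ls.
- apply/ler_addgt0Pr => e e0.
  pose s := r - Num.min (e / q) ((r - l) / 2).
  have m0 : 0 < Num.min (e / q) ((r - l) / 2).
    by rewrite lt_min !divr_gt0 ?subr_gt0.
  have : s \in `]l, r[.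
    rewrite in_itv/= /s.
    have : Num.min (e / q) ((r - l) / 2) <= (r - l) / 2 by rewrite ge_min lexx orbT.
    lra.
  move=> /h1; rewrite in_itv/= => /andP[_ /ltW h]; rewrite -lerBlDr; apply: le_trans h.
  have : q * Num.min (e / q) ((r - l) / 2) <= e.
    by rewrite mulrC -ler_pdivlMr// ge_min lexx.
  rewrite /s mulrBr; lra.
Qed.

Lemma is_derive_incr (F f : R -> R) (l r : R) :
  (forall s, s \in `]l, r[ -> is_derive s 1 F (f s)) ->
  (forall s, s \in `]l, r[ -> 0 < f s) ->
  {within `[l, r], continuous F} ->
  {in `[l, r] &, {homo F : x y / x < y}}.
Proof.
move=> dF f0 cF; apply: gtr0_derive1_lt_cc cF => s sI; have [dFs e] := dF _ sI.
  exact: dFs.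
by rewrite derive1E e f0.
Qed.

Context (k : nat) (a b lK rK lL rL : R) (FK fK FL fL FM fM : R -> R).
Hypotheses (a0 : 0 < a) (b0 : 0 < b) (lrK : lK < rK) (lrL : lL < rL)
  (cFK : {within `[lK, rK], continuous FK})
  (cFL : {within `[lL, rL], continuous FL})
  (dFK : forall s, s \in `]lK, rK[ -> is_derive s 1 FK (fK s))
  (dFL : forall s, s \in `]lL, rL[ -> is_derive s 1 FL (fL s))
  (dFM : forall s, s \in `]lK + lL, rK + rL[ -> is_derive s 1 FM (fM s))
  (fK0 : forall s, s \in `]lK, rK[ -> 0 < fK s)
  (fL0 : forall s, s \in `]lL, rL[ -> 0 < fL s)
  (FKl : FK lK = 0) (FKr : FK rK = a ^+ k.+2)
  (FLl : FL lL = 0) (FLr : FL rL = b ^+ k.+2)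
  (FMle : {homo FM : x y / x <= y})
  (fM_ge : forall s t x y, s \in `]lK, rK[ -> t \in `]lL, rL[ ->
    0 < x -> 0 < y -> fK s = x ^+ k.+1 -> fL t = y ^+ k.+1 ->
    (x + y) ^+ k.+1 <= fM (s + t)).

Let rho := b / a.
Let C := (1 + rho) ^+ k.+2.
Let rho0 : 0 < rho. Proof. exact: divr_gt0. Qed.

Let FK_incr := is_derive_incr dFK fK0 cFK.
Let FL_incr := is_derive_incr dFL fL0 cFL.

Let in_oc (l r s : R) : s \in `]l, r[ -> s \in `[l, r].
Proof. by rewrite !in_itv/= => /andP[/ltW -> /ltW ->]. Qed.

(** An inverse of [FL] made total by a choice; it is used only on the image of the open interval,
    where [FLK] identifies it. *)
Let invL (v : R) : R := get [set t | (t \in `]lL, rL[) /\ FL t = v].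

Let FLK t : t \in `]lL, rL[ -> invL (FL t) = t.
Proof.
move=> tI; rewrite /invL.
have [uI e] : [set u | (u \in `]lL, rL[) /\ FL u = FL t] (invL (FL t)).
  by apply: (@getI _ [set u | (u \in `]lL, rL[) /\ FL u = FL t] t); split.
apply/eqP; rewrite -/(invL _); have [h|h|//] := ltgtP (invL (FL t)) t.
  by have := FL_incr (in_oc uI) (in_oc tI) h; rewrite e ltxx.
by have := FL_incr (in_oc tI) (in_oc uI) h; rewrite e ltxx.
Qed.

(* [T] transports the density [fK] to [fL] after normalization of the masses. *)
Let T s := invL (rho ^+ k.+2 * FK s).

Let rhoE : rho ^+ k.+2 * a ^+ k.+2 = b ^+ k.+2.
Proof. by rewrite -exprMn /rho divfK// gt_eqF. Qed.

Let TE s : s \in `]lK, rK[ -> (T s \in `]lL, rL[) /\ FL (T s) = rho ^+ k.+2 * FK s.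
Proof.
move=> sI; have [|t tI te] := @within_itv_IVT FL lL rL (rho ^+ k.+2 * FK s) lrL cFL.
  move: (sI); rewrite in_itv/= => /andP[ls sr].
  have lI : lK \in `[lK, rK] by rewrite in_itv/= lexx ltW.
  have rI : rK \in `[lK, rK] by rewrite in_itv/= lexx ltW.
  have r0 : 0 < rho ^+ k.+2 by rewrite exprn_gt0.
  have h1 := FK_incr lI (in_oc sI) ls; have h2 := FK_incr (in_oc sI) rI sr.
  by rewrite FLl FLr -rhoE -FKr ltr_pM2l// h2 andbT mulr_gt0// -FKl.
by rewrite /T -te FLK.
Qed.

Let dT s : s \in `]lK, rK[ ->
  is_derive s 1 T ((fL (T s))^-1 * (rho ^+ k.+2 * fK s)).
Proof.
move=> sI; have [TI e] := TE sI.
have dI : is_derive (rho ^+ k.+2 * FK s) 1 invL (fL (T s))^-1.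
  rewrite -e; apply: is_derive_inverse.
  - near=> t; apply: FLK; near: t.
    by apply: near_in_itvoo.
  - near=> t; have tI : t \in `]lL, rL[ by near: t; apply: near_in_itvoo.
    by apply: differentiable_continuous; apply/derivable1_diffP; have [] := dFL tI.
  - exact: dFL.
  - by rewrite gt_eqF// fL0.
have dR : is_derive s 1 (fun s => rho ^+ k.+2 * FK s) (rho ^+ k.+2 * fK s).
  have := @is_deriveZ R R R FK (rho ^+ k.+2) s 1 (fK s) (dFK sI).
  by apply.
exact: (@is_derive1_comp R invL (fun s => rho ^+ k.+2 * FK s) s _ _ dI dR).
Unshelve. all: by end_near. Qed.

Let sTI s : s \in `]lK, rK[ -> s + T s \in `]lK + lL, rK + rL[.
Proof.
by move=> /[dup] /TE[]; rewrite !in_itv/= => /andP[? ?] _ /andP[? ?]; rewrite !ltrD.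
Qed.

(** [FM (s + T s) - C * FK s] is the excess of the mass of the sum to the left of [s + T s] over the
    mass predicted by equality: [T] matches equal fractions of the two masses, and
    [C * a ^+ k.+2 = (a + b) ^+ k.+2]. The inequality and its equality case both come from the
    monotonicity of this excess. *)
Let dPhi s : s \in `]lK, rK[ -> is_derive s 1 (fun s => FM (s + T s) - C * FK s)
  (fM (s + T s) * (1 + (fL (T s))^-1 * (rho ^+ k.+2 * fK s)) - C * fK s).
Proof.
move=> sI; have dsT := @is_deriveD R R R id T s 1 _ _ (is_derive_id _ _) (dT sI).
have dFMs := @is_derive1_comp R FM (id + T) s _ _ (dFM (sTI sI)) dsT.
have := @is_deriveB R R R _ _ s 1 _ _ dFMs (@is_deriveZ R R R FK C s 1 (fK s) (dFK sI)).
by apply.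
Qed.

Let fkey s : s \in `]lK, rK[ -> exists x y, [/\ 0 < x, 0 < y,
  fK s = x ^+ k.+1, fL (T s) = y ^+ k.+1 &
  (x + y) ^+ k.+1 <= fM (s + T s)].
Proof.
move=> sI; have [TI e] := TE sI.
have [x x0 xe] := root_exists k (fK0 sI).
have [y y0 ye] := root_exists k (fL0 TI).
by exists x, y; split => //; apply: fM_ge.
Qed.

Let dPhi_ge0 s : s \in `]lK, rK[ ->
  0 <= fM (s + T s) * (1 + (fL (T s))^-1 * (rho ^+ k.+2 * fK s)) - C * fK s.
Proof.
move=> sI; have [x [y [x0 y0 -> -> h]]] := fkey sI.
have z0 : 0 < y / x by rewrite divr_gt0.
rewrite subr_ge0; apply: le_trans (_ : (x + y) ^+ k.+1 *
  (1 + (y ^+ k.+1)^-1 * (rho ^+ k.+2 * x ^+ k.+1)) <= _); last first.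
  rewrite ler_wpM2r// addr_ge0// mulr_ge0 ?invr_ge0 ?exprn_ge0 ?(ltW y0)//.
  by rewrite mulr_ge0 ?exprn_ge0// ltW.
have := transport_ineq k.+1 z0 rho0.
have xn0 : x ^+ k.+1 != 0 by rewrite expf_neq0// gt_eqF.
have yn0 : y ^+ k.+1 != 0 by rewrite expf_neq0// gt_eqF.
have x1 : x != 0 by rewrite gt_eqF.
have -> : 1 + y / x = (x + y) / x by field.
rewrite !expr_div_n -(@ler_pM2r _ (x ^+ k.+1 * x ^+ k.+1 / y ^+ k.+1)); last first.
  by rewrite divr_gt0 ?mulr_gt0 ?exprn_gt0.
rewrite -subr_ge0 => h1; rewrite -subr_ge0 transport_eqn//.
by rewrite mulrBl.
Qed.

(** [T] is controlled only inside the open interval, so increments are taken between points that cut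
    off a mass [v] at each end; the loss [2 * c * v] is at most any given [e]. *)
Let le_approx (c d : R) : (forall x y, x \in `]lK, rK[ -> y \in `]lK, rK[ -> x <= y ->
  c * (FK y - FK x) <= d) -> 0 < c -> c * a ^+ k.+2 <= d.
Proof.
move=> h c0; apply/ler_addgt0Pr => e e0.
have A0 : 0 < a ^+ k.+2 by rewrite exprn_gt0.
pose v := Num.min (a ^+ k.+2 / 2) (e / c / 2).
have v0 : 0 < v by rewrite lt_min !divr_gt0.
have vA : v <= a ^+ k.+2 / 2 by rewrite ge_min lexx.
have ve : v <= e / c / 2 by rewrite ge_min lexx orbT.
have [|x xI xe] := @within_itv_IVT FK lK rK v lrK cFK.
  by rewrite FKl FKr v0; lra.
have [|y yI ye] := @within_itv_IVT FK lK rK (a ^+ k.+2 - v) lrK cFK.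
  by rewrite FKl FKr; lra.
have xy : x <= y.
  rewrite leNgt; apply/negP => /(FK_incr (in_oc yI) (in_oc xI)); rewrite ye xe; lra.
have := h _ _ xI yI xy; rewrite xe ye.
have : c * (v + v) <= e.
  by rewrite mulrC -ler_pdivlMr//; lra.
rewrite !mulrBr mulrDr; lra.
Qed.

Let Phi_homo x y : x \in `]lK, rK[ -> y \in `]lK, rK[ -> x <= y ->
  C * (FK y - FK x) <= FM (y + T y) - FM (x + T x).
Proof.
move=> xI yI xy.
have sub s : s \in `[x, y] -> s \in `]lK, rK[.
  move: xI yI; rewrite !in_itv/= => /andP[? _] /andP[_ ?] /andP[? ?]; lra.
have : FM (x + T x) - C * FK x <= FM (y + T y) - C * FK y.
  apply: (@ger0_derive1_le_cc R (fun s => FM (s + T s) - C * FK s) x y).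
  - by move=> s /in_oc/sub/dPhi[].
  - by move=> s /in_oc/sub/[dup]/dPhi_ge0 ? /dPhi[_]; rewrite derive1E => ->.
  - apply: derivable_within_continuous => s /sub/dPhi[]//.
  - by rewrite in_itv/= lexx.
  - by rewrite in_itv/= lexx andbT.
  - by [].
rewrite mulrBr; lra.
Qed.

Let FM_ends x y : x \in `]lK, rK[ -> y \in `]lK, rK[ ->
  FM (y + T y) - FM (x + T x) <= FM (rK + rL) - FM (lK + lL).
Proof.
move=> /sTI + /sTI; rewrite !in_itv/= => /andP[/ltW/FMle ? _] /andP[_ /ltW/FMle ?].
lra.
Qed.

Let CaE : C * a ^+ k.+2 = (a + b) ^+ k.+2.
Proof.
by rewrite /C -exprMn mulrDl mul1r /rho divfK// gt_eqF.
Qed.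

Let C0 : 0 < C. Proof. by rewrite exprn_gt0// addr_gt0. Qed.

Lemma transport_le : (a + b) ^+ k.+2 <= FM (rK + rL) - FM (lK + lL).
Proof.
rewrite -CaE; apply: le_approx => // x y xI yI xy.
exact: le_trans (Phi_homo xI yI xy) (FM_ends xI yI).
Qed.

Hypothesis eqM : FM (rK + rL) - FM (lK + lL) = (a + b) ^+ k.+2.

(** On both sides of [[x, y]] the increments are at least the predicted ones by [Phi_homo]; when the
    total is exactly the predicted mass, no excess is left for the middle. *)
Let Phi_cst x y : x \in `]lK, rK[ -> y \in `]lK, rK[ -> x <= y ->
  FM (y + T y) - FM (x + T x) <= C * (FK y - FK x).
Proof.
move=> xI yI xy.
suff : C * a ^+ k.+2 <= C * (FK y - FK x) +
    (FM (rK + rL) - FM (lK + lL)) - (FM (y + T y) - FM (x + T x)).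
  rewrite eqM CaE; lra.
apply: le_approx => // u v uI vI uv.
(* The interval [[u, v]] is enlarged so as to contain [[x, y]]; this can only increase the mass of
   [K] that it captures. *)
have mI : Num.min u x \in `]lK, rK[ by rewrite minEle; case: ifP.
have MI : Num.max v y \in `]lK, rK[ by rewrite maxEle; case: ifP.
have mx : Num.min u x <= x by rewrite ge_min lexx orbT.
have mu : Num.min u x <= u by rewrite ge_min lexx.
have My : y <= Num.max v y by rewrite le_max lexx orbT.
have Mv : v <= Num.max v y by rewrite le_max lexx.
have FKle := ltW_homo_in FK_incr.
have h1 := FKle _ _ (in_oc mI) (in_oc uI) mu.
have h2 := FKle _ _ (in_oc vI) (in_oc MI) Mv.
have h3 := Phi_homo mI xI mx; have h4 := Phi_homo yI MI My.
have h5 := FM_ends mI MI.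
have h6 : C * (FK v - FK u) <= C * (FK (Num.max v y) - FK (Num.min u x)).
  by rewrite ler_pM2l//; lra.
move: h3 h4 h6; rewrite !mulrBr; lra.
Qed.

Let dPhi_eq0 s : s \in `]lK, rK[ ->
  fM (s + T s) * (1 + (fL (T s))^-1 * (rho ^+ k.+2 * fK s)) - C * fK s = 0.
Proof.
move=> sI; have [_ <-] := dPhi sI.
have [_ <-] := is_derive_cst (FM (s + T s) - C * FK s) s (1 : R).
apply: near_eq_derive.
near=> x; have xI : x \in `]lK, rK[ by near: x; apply: near_in_itvoo.
rewrite /cst; have [xs|/ltW xs] := leP x s.
  have := Phi_cst xI sI xs; have := Phi_homo xI sI xs; rewrite mulrBr; lra.
have := Phi_cst sI xI xs; have := Phi_homo sI xI xs; rewrite mulrBr; lra.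
Unshelve. all: by end_near. Qed.

(** The vanishing derivative is a sum of two nonnegative defects: the one of [transport_ineq] forces
    [y / x = rho], and the one of [fM_ge] forces [fM (s + T s) = (x + y) ^+ k.+1]. *)
Let feq s : s \in `]lK, rK[ ->
  fL (T s) = rho ^+ k.+1 * fK s /\ fM (s + T s) = (1 + rho) ^+ k.+1 * fK s.
Proof.
move=> sI; have := dPhi_eq0 sI; have [x [y [x0 y0 -> -> h]]] := fkey sI.
have z0 : 0 < y / x by rewrite divr_gt0.
have xn0 : x ^+ k.+1 != 0 by rewrite expf_neq0// gt_eqF.
have yn0 : y ^+ k.+1 != 0 by rewrite expf_neq0// gt_eqF.
have x1 : x != 0 by rewrite gt_eqF.
have w0 : 0 < 1 + (y ^+ k.+1)^-1 * (rho ^+ k.+2 * x ^+ k.+1).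
  rewrite addr_gt0// mulr_gt0 ?invr_gt0 ?exprn_gt0//.
  by rewrite mulr_gt0 ?exprn_gt0.
set m := fM _ in h *; set w := 1 + _ in w0 *; move=> e.
have zE : 1 + y / x = (x + y) / x by field.
have e1 : (x + y) ^+ k.+1 * w - C * x ^+ k.+1 =
    ((1 + y / x) ^+ k.+1 * ((y / x) ^+ k.+1 + rho ^+ k.+2) - (y / x) ^+ k.+1 * C) *
    (x ^+ k.+1 * x ^+ k.+1 / y ^+ k.+1).
  by rewrite zE !(expr_div_n y x) !(expr_div_n (x + y) x); exact: transport_eqn.
have h1 := transport_ineq k.+1 z0 rho0.
have h2 : 0 <= (x + y) ^+ k.+1 * w - C * x ^+ k.+1.
  rewrite e1 mulr_ge0// ?subr_ge0//.
  by rewrite divr_ge0 ?mulr_ge0 ?exprn_ge0 ?ltW.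
have h3 : (x + y) ^+ k.+1 * w <= m * w by rewrite ler_pM2r.
have h4 : (x + y) ^+ k.+1 * w - C * x ^+ k.+1 = 0 by lra.
have zr : y / x = rho.
  apply: (@transport_ineq_eq _ _ _ k z0 rho0).
  move/eqP: h4; rewrite e1 mulf_eq0 => /orP[|].
    by rewrite subr_eq0 => /eqP ->.
  by rewrite gt_eqF// divr_gt0 ?mulr_gt0 ?exprn_gt0.
have yE : y = rho * x by rewrite -zr divfK.
split; first by rewrite yE exprMn.
have : m * w = (x + y) ^+ k.+1 * w by lra.
move/(mulIf (lt0r_neq0 w0)) => ->.
by rewrite yE -exprMn mulrDl mul1r.
Qed.

(** By [feq] the derivative of [T] is the constant [rho], so [T] is affine in the interior; being
    onto the second open interval, it matches the endpoints, which determines its constant term. *)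
Lemma transport_eq : rL - lL = rho * (rK - lK) /\
  forall s, s \in `]lK, rK[ -> let t := lL + rho * (s - lK) in
  [/\ t \in `]lL, rL[, fL t = rho ^+ k.+1 * fK s &
      fM (s + t) = (1 + rho) ^+ k.+1 * fK s].
Proof.
have dT' s : s \in `]lK, rK[ -> is_derive s 1 T rho.
  move=> sI; have := dT sI; rewrite (feq sI).1.
  have f0 : fK s != 0 by rewrite gt_eqF// fK0.
  have r0 : rho ^+ k.+1 != 0 by rewrite expf_neq0// gt_eqF.
  rewrite (_ : _ * (_ * _) = rho)// [in X in _ * X]exprS.
  move: (rho ^+ k.+1) r0 => X X0.
  by field; rewrite f0 X0.
have Taff x y : x \in `]lK, rK[ -> y \in `]lK, rK[ -> x < y ->
    T y - T x = rho * (y - x).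
  move=> xI yI xy.
  have sub s : s \in `[x, y] -> s \in `]lK, rK[.
    move: xI yI; rewrite !in_itv/= => /andP[? _] /andP[_ ?] /andP[? ?]; lra.
  have [|s _ ->//] := @MVT R T (fun=> rho) x y xy (fun s h => dT' s (sub _ (in_oc h))).
  by apply: derivable_within_continuous => s /sub/dT'[].
pose m := (lK + rK) / 2; pose c := T m - rho * m.
have mI : m \in `]lK, rK[ by rewrite in_itv/= !midf_lt.
have TA s : s \in `]lK, rK[ -> T s = rho * s + c.
  move=> sI; rewrite /c; have [sm|sm|->] := ltgtP s m; last by ring.
    by have := Taff _ _ sI mI sm; rewrite mulrBr; lra.
  by have := Taff _ _ mI sI sm; rewrite mulrBr; lra.
have [||lE rE] := @affine_onto_endpoints c rho lK rK lL rL rho0 lrK lrL.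
- by move=> s sI; rewrite -TA//; have [] := TE sI.
- move=> t tI.
  have lI : lL \in `[lL, rL] by rewrite in_itv/= lexx ltW.
  have rI : rL \in `[lL, rL] by rewrite in_itv/= lexx ltW.
  have rk0 : 0 < rho ^+ k.+2 by rewrite exprn_gt0.
  have [|s sI se] := @within_itv_IVT FK lK rK (FL t / rho ^+ k.+2) lrK cFK.
    move: (tI); rewrite in_itv/= => /andP[lt tr].
    have h1 := FL_incr lI (in_oc tI) lt; have h2 := FL_incr (in_oc tI) rI tr.
    have t0 : 0 < FL t by rewrite -FLl.
    by rewrite FKl FKr divr_gt0//= ltr_pdivrMr// mulrC rhoE -FLr.
  exists s => //; rewrite -TA// /T se mulrC divfK ?gt_eqF//.
  exact: FLK.
split; first by rewrite lE rE; ring.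
move=> s sI t; have tE : t = T s by rewrite TA// /t lE; ring.
by rewrite tE; have [? ?] := feq sI; have [] := TE sI.
Qed.

End transport.

(** * A rigidity lemma for concave functions *)

Definition concave_on {R : realType} (I : interval R) (k : R -> R) :=
  forall x y t, x \in I -> y \in I -> 0 <= t <= 1 ->
  t * k x + (1 - t) * k y <= k (t * x + (1 - t) * y).

Section concave.
Context {R : realType}.
Implicit Types k phi : R -> R.

(** Two uses of concavity give this local Lipschitz bound: [x + e * h] lies between [x] and
    [x + e * d], and [x] lies between [x + e * h] and [x - e * d]. The sign [e] treats both sides at
    once. *)
Lemma concave_on_near k (l r x : R) : concave_on `]l, r[ k -> x \in `]l, r[ ->
  exists2 M, 0 < M & \forall h \near 0, `|k (x + h) - k x| <= M * `|h|.
Proof.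
move=> kc; rewrite in_itv/= => /andP[lx xr].
pose d := Num.min (x - l) (r - x) / 2.
have d0 : 0 < d by rewrite divr_gt0// lt_min !subr_gt0 lx.
have dl : l < x - d.
  have : Num.min (x - l) (r - x) <= x - l by rewrite ge_min lexx.
  rewrite /d; lra.
have dr : x + d < r.
  have : Num.min (x - l) (r - x) <= r - x by rewrite ge_min lexx orbT.
  rewrite /d; lra.
have key (e h : R) : e = 1 \/ e = -1 -> 0 <= h -> h <= d ->
    `|k (x + e * h) - k x| <= (`|k (x + d) - k x| + `|k (x - d) - k x|) / d * h.
  move=> e1 h0 hd.
  have eI z : `|z| <= d -> x + z \in `]l, r[.
    by rewrite ler_norml in_itv/= => /andP[? ?]; lra.
  have ed : `|e| = 1 by case: e1 => ->; rewrite ?normrN normr1.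
  have nd : `|d| = d by rewrite gtr0_norm.
  have nh : `|h| = h by rewrite ger0_norm.
  have hd1 : 0 <= h / d <= 1 by rewrite divr_ge0 ?(ltW d0)//= ler_pdivrMr// mul1r.
  have e1I : x + e * d \in `]l, r[ by apply: eI; rewrite normrM ed nd mul1r.
  have e2I : x - e * d \in `]l, r[ by apply: eI; rewrite normrN normrM ed nd mul1r.
  have e3I : x + e * h \in `]l, r[ by apply: eI; rewrite normrM ed nh mul1r.
  have e4I : x \in `]l, r[ by rewrite -[x]addr0 eI// normr0 ltW.
  have h1 := kc _ _ _ e1I e4I hd1.
  have t01 : 0 <= d / (d + h) <= 1.
    by rewrite divr_ge0 ?addr_ge0 ?(ltW d0)//= ler_pdivrMr ?mul1r ?lerDl// ltr_pwDl.
  have h2 := kc _ _ _ e3I e2I t01.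
  have dn0 : d != 0 by rewrite gt_eqF.
  have dhn0 : d + h != 0 by rewrite gt_eqF// ltr_pwDl.
  rewrite (_ : h / d * (x + e * d) + (1 - h / d) * x = x + e * h) in h1; last first.
    by field.
  rewrite (_ : d / (d + h) * (x + e * h) + (1 - d / (d + h)) * (x - e * d) = x) in h2; last first.
    by field.
  set A := `|k (x + d) - k x|; set B := `|k (x - d) - k x|.
  have hA : k (x + e * d) - k x >= - (A + B).
    case: e1 => ->; rewrite ?mul1r ?mulN1r.
    - by rewrite lerNl; apply: le_trans (ler_norm _) _; rewrite normrN lerDl; exact: normr_ge0.
    - by rewrite lerNl; apply: le_trans (ler_norm _) _; rewrite normrN lerDr; exact: normr_ge0.
  have hB : k (x - e * d) - k x >= - (A + B).
    case: e1 => ->; rewrite ?mul1r ?mulN1r ?opprK.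
    - by rewrite lerNl; apply: le_trans (ler_norm _) _; rewrite normrN lerDr; exact: normr_ge0.
    - by rewrite lerNl; apply: le_trans (ler_norm _) _; rewrite normrN lerDl; exact: normr_ge0.
  rewrite ler_norml -(ler_pM2r d0) -[X in _ && X](ler_pM2r d0).
  have -> : - ((A + B) / d * h) * d = - (A + B) * h by field.
  have -> : (A + B) / d * h * d = (A + B) * h by field.
  move: h2 => /(ler_wpM2r (addr_ge0 (ltW d0) h0)) h2.
  move: h1 => /(ler_wpM2r (ltW d0)).
  have -> : (h / d * k (x + e * d) + (1 - h / d) * k x) * d =
    h * (k (x + e * d) - k x) + d * k x by field.
  move: h2.
  have -> : (d / (d + h) * k (x + e * h) + (1 - d / (d + h)) * k (x - e * d)) *
     (d + h) = d * k (x + e * h) + h * k (x - e * d) by field.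
  move=> h2 h1.
  have := ler_wpM2l h0 hA; have := ler_wpM2l h0 hB.
  by move=> h3 h4; apply/andP; split; lra.
(* The summand 1 keeps the constant positive when both increments vanish. *)
exists ((`|k (x + d) - k x| + `|k (x - d) - k x|) / d + 1).
  by rewrite ltr_wpDl// divr_ge0 ?addr_ge0// ltW.
near=> h.
have hd : `|h| <= d.
  near: h; apply/nbhs_ballP; exists d => //= z.
  by rewrite /ball/= sub0r normrN => /ltW.
have := key (if 0 <= h then 1 else -1) `|h| _ (normr_ge0 _) hd.
have -> : (if 0 <= h then 1 else -1) * `|h| = h.
  case: ifPn => [h0|]; first by rewrite mul1r ger0_norm.
  by rewrite -ltNge => h0; rewrite ltr0_norm// mulN1r opprK.
move=> /(_ _)/le_trans; apply; first by case: ifP; [left|right].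
by rewrite ler_wpM2r// lerDl.
Unshelve. all: by end_near. Qed.

Lemma concave_on_continuous k (l r x : R) :
  concave_on `]l, r[ k -> x \in `]l, r[ -> k (x + h) @[h --> 0] --> k x.
Proof.
move=> kc xI; have [M M0 hM] := concave_on_near kc xI.
apply/cvgrPdist_le => e e0; have eM : 0 < e / M by exact: divr_gt0.
near=> h.
rewrite distrC; apply: le_trans (_ : M * `|h| <= _); first by near: h.
by rewrite mulrC -ler_pdivlMr//; near: h; exact: nbhs0_le.
Unshelve. all: by end_near. Qed.

(** Chord slopes of a concave function decrease; adjacent chords of lengths [q * d] and [d] are
    compared here, after multiplication by [q * d]. *)
Let slope k (l r s d q : R) : concave_on `]l, r[ k -> 0 < d -> 0 < q ->
  l < s -> s + q * d + d < r ->
  q * (k (s + q * d + d) - k (s + q * d)) <= k (s + q * d) - k s.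
Proof.
move=> kc d0 q0 ls sr.
have qd0 : 0 < q * d by rewrite mulr_gt0.
have q10 : 0 < 1 + q by rewrite addr_gt0.
have t01 : 0 <= (1 + q)^-1 <= 1.
  by rewrite invr_ge0 (ltW q10)/= invf_le1// lerDl ltW.
have sI : s \in `]l, r[ by rewrite in_itv/=; lra.
have eI : s + q * d + d \in `]l, r[ by rewrite in_itv/=; lra.
have := kc _ _ _ sI eI t01.
have -> : (1 + q)^-1 * s + (1 - (1 + q)^-1) * (s + q * d + d) = s + q * d.
  by field; rewrite gt_eqF.
rewrite -(ler_pM2r q10).
have -> : ((1 + q)^-1 * k s + (1 - (1 + q)^-1) * k (s + q * d + d)) * (1 + q) =
  k s + q * k (s + q * d + d) by field; rewrite gt_eqF.
by rewrite mulrDr mulr1 mulrBr; lra.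
Qed.

(** A step from [b - d] to [b] raises [phi] by at least [k (b + q * d) - k b], which [slope]
    converts into [q] times an increment of [k] over the length [d]. The price is a shift of the
    argument by [(1 + q) * d], which does not accumulate over the steps. *)
Let telescope_le k phi (l r q a b d : R) N : concave_on `]l, r[ k ->
  0 < q -> 0 < d ->
  (forall s d, s \in `]l, r[ -> s + q * d \in `]l, r[ -> s - d \in `]l, r[ ->
    k (s + q * d) + phi (s - d) <= k s + phi s) ->
  l < a -> a + d * N%:R = b -> b + (1 + q) * d < r ->
  q * (k (b + (1 + q) * d) - k (a + (1 + q) * d)) <= phi b - phi a.
Proof.
move=> kc q0 d0 hk la + br; have qd0 : 0 < q * d by rewrite mulr_gt0.
have br' : b + d + q * d < r by move: br; rewrite mulrDl mul1r addrA.
elim: N b br br' => [|N ih] b br br' e.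
  by rewrite -e mulr0 addr0 !subrr mulr0.
have dN : 0 <= d * N%:R by rewrite mulr_ge0// ltW.
have eb : a + d * N%:R = b - d by rewrite -e -natr1; ring.
have := ih (b - d); rewrite -eb eb => /(_ _ _ erefl).
have -> : b - d + (1 + q) * d = b + q * d by ring.
have -> : b - d + d + q * d = b + q * d by ring.
have br2 : b + q * d < r by lra.
move=> /(_ br2 br2) h1.
have h2 : k (b + q * d) + phi (b - d) <= k b + phi b.
  by apply: hk; rewrite in_itv/=; lra.
have := @slope k l r b d q kc d0 q0.
have -> : b + q * d + d = b + (1 + q) * d by ring.
move=> /(_ _ br) h3.
have {}h3 := h3 ltac:(lra).
move: h1 h3; rewrite !mulrBr; lra.
Qed.

Let concave_shift_le k phi (l r q a b : R) : concave_on `]l, r[ k -> 0 < q ->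
  (forall s d, s \in `]l, r[ -> s + q * d \in `]l, r[ -> s - d \in `]l, r[ ->
    k (s + q * d) + phi (s - d) <= k s + phi s) ->
  a \in `]l, r[ -> b \in `]l, r[ -> a < b ->
  q * (k b - k a) <= phi b - phi a.
Proof.
move=> kc q0 hk aI bI ab.
have q10 : 0 < 1 + q by rewrite addr_gt0.
have cg : q * (k (b + h) - k (a + h)) @[h --> 0] --> q * (k b - k a).
  apply: cvgMr; apply: cvgB; exact: (concave_on_continuous kc).
rewrite leNgt; apply/negP => lt.
have : \forall h \near 0, phi b - phi a < q * (k (b + h) - k (a + h)).
  exact: cvgr_gt _ cg _ lt.
move=> /nbhs_ex[e0' he]; pose e := e0'%:num; have e0 : 0 < e by rewrite /e.
move: (aI) (bI); rewrite !in_itv/= => /andP[la ar] /andP[lb br].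
(* A step [d] with [(1 + q) * d < Num.min e (r - b)] keeps the shifted points inside the interval
   and so near to [a] and [b] that the strict inequality to be refuted persists. *)
pose m := Num.min e (r - b) / (1 + q).
have m0 : 0 < m by rewrite divr_gt0// lt_min e0 subr_gt0.
have [N] := ltr_add_invr (ltac:(by rewrite divr_gt0// subr_gt0) : 0 < m / (b - a)).
rewrite add0r => hN.
pose d := (b - a) / N.+1%:R.
have ba0 : 0 < b - a by rewrite subr_gt0.
have d0 : 0 < d by rewrite divr_gt0.
have dm : (1 + q) * d < Num.min e (r - b).
  move: hN; rewrite ltr_pdivlMr// mulrC -/d /m ltr_pdivlMr// mulrC//.
have /= := he ((1 + q) * d).
rewrite /ball/= sub0r normrN gtr0_norm ?mulr_gt0//.
move=> /(_ (lt_le_trans dm _)) h.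
have {}h := h ltac:(by rewrite ge_min lexx).
have de : (1 + q) * d < r - b by apply: lt_le_trans dm _; rewrite ge_min lexx orbT.
have := @telescope_le k phi l r q a b d N.+1 kc q0 d0 hk la.
rewrite /d divfK ?pnatr_eq0// -/d => /(_ _ _)/le_lt_trans.
move=> /(_ _ _ _ h); rewrite ltxx => H; apply: notF; apply: H; first ring.
by lra.
Qed.

(* The hypothesis says that [k (s + q * d) + phi (s - d)] is maximal at [d = 0],
   hence [phi' = q k'] wherever both derivatives exist; telescoping over a fine
   subdivision avoids differentiability. *)
Lemma concave_shift_cst k phi (l r q a b : R) : concave_on `]l, r[ k -> 0 < q ->
  (forall s d, s \in `]l, r[ -> s + q * d \in `]l, r[ -> s - d \in `]l, r[ ->
    k (s + q * d) + phi (s - d) <= k s + phi s) ->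
  a \in `]l, r[ -> b \in `]l, r[ -> phi a - q * k a = phi b - q * k b.
Proof.
move=> kc q0 hk; wlog : a b / a < b => [H aI bI|ab aI bI].
  by have [ab|ba|->//] := ltgtP a b; [exact: H|apply/esym; exact: H].
have h1 := concave_shift_le kc q0 hk aI bI ab.
have oI z : - z \in `]l, r[ -> z \in `]- r, - l[.
  by rewrite !in_itv/=; lra.
have oJ z : z \in `]- r, - l[ -> - z \in `]l, r[.
  by rewrite !in_itv/=; lra.
(* The hypothesis allows negative [d], so it is invariant under the reflection [s |-> - s], which
   yields the opposite inequality. *)
have h2 := @concave_shift_le (k \o -%R) (phi \o -%R) (- r) (- l) q (- b) (- a) _ q0.
suff: q * (k a - k b) <= phi a - phi b.
  by move: h1; rewrite !mulrBr => *; apply/eqP; rewrite eq_le; apply/andP; split; lra.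
move: h2; rewrite /= !opprK; apply.
- move=> x y t /oJ xI /oJ yI t01 /=.
  by have := kc _ _ _ xI yI t01; rewrite !mulrN -opprD.
- move=> s d /oJ sI /oJ s1 /oJ s2.
  have := hk (- s) (- d) sI; rewrite mulrN -!opprD; apply=> //.
- by apply: oI; rewrite opprK.
- by apply: oI; rewrite opprK.
- by rewrite ltrN2.
Qed.

End concave.

(** * Lebesgue measure on row vectors *)

Section measurability.
Context {R : realType}.

Lemma ball_rVP n (x y : 'rV[R]_n) e : 0 < e ->
  ball x e y <-> forall i, `|x ord0 i - y ord0 i| < e.
Proof.
move=> e0; split=> [[_ h] i|h]; first exact: h.
by split=> // i j; rewrite (ord1 i); exact: h.
Qed.

Lemma measurable_ball_rV n (x : 'rV[R]_n) e : 0 < e ->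
  measurable (ball x e : set 'rV[R]_n).
Proof.
move=> e0; rewrite (_ : ball x e = \bigcap_(i in [set: 'I_n])
    (@rV_coord R n i @^-1` ball (x ord0 i) e)); last first.
  apply/seteqP; split => [y /(ball_rVP _ _ e0) h i _|y h].
    exact: h.
  by apply/(ball_rVP _ _ e0) => i; exact: (h i I).
apply: fin_bigcap_measurable; first exact: finite_finset.
move=> i _; rewrite -[X in measurable X]setTI.
by apply: measurable_rV_coord => //; exact: measurable_ball.
Qed.

(** The sigma-algebra is generated by the coordinates, so an open set is written as the countable
    union of the balls of rational centre and radius [1 / (k + 1)] that it contains. *)
Lemma open_measurable_rV n (U : set 'rV[R]_n) : open U -> measurable U.
Proof.
move=> oU.
pose c (p : 'rV[rat]_n * nat) : 'rV[R]_n := map_mx ratr p.1.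
pose B (p : 'rV[rat]_n * nat) : set 'rV[R]_n :=
  if `[< ball (c p) p.2.+1%:R^-1 `<=` U >] then ball (c p) p.2.+1%:R^-1 else set0.
rewrite (_ : U = \bigcup_p B p).
  apply: countable_bigcupT_measurable => //.
  by move=> p; rewrite /B; case: ifP => // _; exact: measurable_ball_rV.
apply/seteqP; split => [x Ux|x [p _]]; last by rewrite /B; case: ifPn => // /asboolP; exact.
have /nbhs_ballP[e /= e0 he] : nbhs x U by move: oU; rewrite openE => /(_ _ Ux).
(* Half of [e] is enough: a point of the small ball is within one radius of the centre, and the
   centre within one radius of [x]. *)
have [k] := ltr_add_invr (ltac:(by rewrite divr_gt0) : 0 < e / 2).
rewrite add0r => ke.
have k0 : 0 < k.+1%:R^-1 :> R by rewrite invr_gt0.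
have hq i : exists q : rat, `|x ord0 i - ratr q| < k.+1%:R^-1.
  have /rat_in_itvoo[q] : x ord0 i - k.+1%:R^-1 < x ord0 i + k.+1%:R^-1.
    by rewrite ltrBlDr -addrA ltrDl addr_gt0.
  by rewrite in_itv/= => ?; exists q; rewrite ltr_distlC.
pose q := \row_i xget 0 [set q : rat | `|x ord0 i - ratr q| < k.+1%:R^-1].
have qP i : `|x ord0 i - ratr (q ord0 i)| < k.+1%:R^-1.
  by rewrite mxE; apply: (@xgetPex _ 0 [set q : rat | `|x ord0 i - ratr q| < k.+1%:R^-1]); exact: hq.
exists (q, k) => //; rewrite /B; case: asboolP => /= [_|h].
  by apply/ball_rVP => // i; rewrite mxE distrC.
exfalso; apply: h => y /(ball_rVP _ _ k0) hy; apply: he; apply/ball_rVP => // i.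
have := lt_trans (hy i) ke; rewrite mxE => h1; have h2 := lt_trans (qP i) ke.
rewrite -(subrKA (ratr (q ord0 i))); apply: le_lt_trans (ler_normD _ _) _; lra.
Qed.

Lemma closed_measurable_rV n (U : set 'rV[R]_n) : closed U -> measurable U.
Proof.
move=> cU; rewrite -[U]setCK; apply: measurableC.
by apply: open_measurable_rV; exact: closed_openC.
Qed.

Lemma compact_closed_rV n (K : set 'rV[R]_n) : compact K -> closed K.
Proof. by apply: compact_closed; exact: norm_hausdorff. Qed.

Lemma compact_measurable_rV n (K : set 'rV[R]_n) : compact K -> measurable K.
Proof. by move=> /compact_closed_rV; exact: closed_measurable_rV. Qed.

Lemma compact_bounded_rV n (K : set 'rV[R]_n) : compact K ->
  exists2 M, 0 < M & forall x i, K x -> `|x ord0 i| <= M.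
Proof.
case: n K => [|n] K cK; first by exists 1 => // x [].
have [M [_ hM]] := compact_bounded cK.
exists (Num.max M 0 + 1); first by rewrite ltr_wpDl// le_max lexx orbT.
move=> x i Kx; have := hM (Num.max M 0 + 1).
rewrite (@le_lt_trans _ _ (Num.max M 0)) ?le_max ?lexx// ?ltrDl// => /(_ isT _ Kx).
apply: le_trans; rewrite [leRHS]/Num.norm/= mx_normrE.
by apply/bigmax_geP; right; exists (ord0, i).
Qed.

Lemma measurable_rV_scale n (r : R) (w : 'rV[R]_n) :
  measurable_fun setT (fun x : 'rV[R]_n => r *: x + w).
Proof.
apply: measurable_fun_rV => i.
rewrite (_ : _ \o _ = fun x => r * rV_coord i x + w ord0 i); last first.
  by apply/funext => x; rewrite /rV_coord/= !mxE.
by apply: measurable_funD => //; apply: measurable_funM => //; exact: measurable_rV_coord.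
Qed.

End measurability.

Section slicing.
Context {R : realType}.
Local Open Scope ereal_scope.
Notation leb := (@lebesgue_measure R).

Lemma integral_rV_cons n (f : 'rV[R]_n.+1 -> \bar R) :
  measurable_fun setT f -> (forall x, 0 <= f x) ->
  \int[lebesgue_rV n.+1]_x f x =
  \int[leb]_s \int[lebesgue_rV n]_y f (rV_cons (s, y)).
Proof.
move=> mf f0.
rewrite (_ : \int[lebesgue_rV n.+1]_x f x =
   \int[pushforward (leb \x lebesgue_rV n) (@rV_cons R n)]_x f x)//.
rewrite ge0_integral_pushforward//; last exact: measurable_rV_cons.
rewrite preimage_setT fubini_tonelli1//; last by move=> x; exact: f0.
by apply: measurableT_comp => //; exact: measurable_rV_cons.
Qed.

Lemma measurable_integral_rV_cons n (f : 'rV[R]_n.+1 -> \bar R) :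
  measurable_fun setT f -> (forall x, 0 <= f x) ->
  measurable_fun setT (fun s : measurableTypeR R => \int[lebesgue_rV n]_y f (rV_cons (s, y))).
Proof.
move=> mf f0; apply: (@measurable_fun_fubini_tonelli_F _ _ _ _ R (lebesgue_rV n) (f \o @rV_cons R n)); last by move=> x; exact: f0.
by apply: measurableT_comp => //; exact: measurable_rV_cons.
Qed.

(** The one-dimensional change of variables is a hypothesis, with [c] its factor, so that one
    induction over the coordinates serves both dilations and the reflection. *)
Lemma integral_affine_rV n (r c : R) (f : 'rV[R]_n -> \bar R) w : (0 <= c)%R ->
  (forall (g : R -> \bar R) v, measurable_fun setT g -> (forall x, 0 <= g x) ->
     \int[leb]_s g (r * s + v)%R = c%:E * \int[leb]_s g s) ->
  measurable_fun setT f -> (forall x, 0 <= f x) ->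
  \int[lebesgue_rV n]_x f (r *: x + w)%R = (c ^+ n)%:E * \int[lebesgue_rV n]_x f x.
Proof.
move=> c0 h1; elim: n f w => [|n ih] f w mf f0.
  rewrite mul1e; apply: eq_integral => x _; congr f.
  by apply/rowP => -[].
rewrite !integral_rV_cons//; last first.
  by apply: measurableT_comp => //; exact: measurable_rV_scale.
pose w' : 'rV[R]_n := \row_j w ord0 (lift ord0 j).
have consE s y : (r *: rV_cons (s, y) + w = rV_cons ((r * s + w ord0 ord0)%R, r *: y + w') :> 'rV[R]_n.+1)%R.
  apply/rowP => i; rewrite [LHS]mxE [X in (X + _)%R = _]mxE.
  case: (unliftP ord0 i) => [j ->|->].
    by rewrite !rV_consS /= !mxE.
  by rewrite !rV_cons0.
have mfs s : measurable_fun setT (fun y => f (rV_cons (s, y))).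
  by apply: measurableT_comp => //; apply: (measurableT_comp (@measurable_rV_cons R n)).
have [G [GE mG G0]] : exists G : R -> \bar R,
    [/\ forall s, G s = \int[lebesgue_rV n]_y f (rV_cons (s, y)),
    measurable_fun setT G & forall s, 0 <= G s].
  exists (fun s => \int[lebesgue_rV n]_y f (rV_cons (s, y))); split => //.
    exact: measurable_integral_rV_cons.
  by move=> s; apply: integral_ge0.
transitivity (\int[leb]_s ((c ^+ n)%:E * G (r * s + w ord0 ord0)%R)).
  apply: eq_integral => s _; rewrite GE -(ih _ w')//.
  by apply: eq_integral => y _; rewrite consE.
rewrite (@ge0_integralZl _ _ R leb setT measurableT (fun s => G (r * s + w ord0 ord0)%R)).
- rewrite h1// muleA -EFinM exprSr; congr (_ * _).
  by apply: eq_integral => s _; rewrite GE.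
- apply: measurableT_comp => //.
  by apply: measurable_funD => //; exact: measurable_funM.
- by [].
- by rewrite lee_fin exprn_ge0.
Qed.

(** [r] times the image of Lebesgue measure under [s |-> r * s + v] gives half-open intervals their
    length, hence is Lebesgue measure by uniqueness. *)
Lemma integral_scale_lebesgue (r : R) (g : R -> \bar R) v : (0 < r)%R ->
  measurable_fun setT g -> (forall x, 0 <= g x) ->
  \int[leb]_s g (r * s + v)%R = (r^-1)%:E * \int[leb]_s g s.
Proof.
move=> r0 mg g0.
pose a (s : R) : measurableTypeR R := (r * s + v)%R.
have ma : measurable_fun setT (a : measurableTypeR R -> measurableTypeR R).
  by apply: measurable_funD => //; exact: measurable_funM.
pose m := mscale (NngNum (ltW r0))
  (measure_function_pushforward__canonical__measure_function_Measure leb ma).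
have mE A : measurable A -> leb A = m A.
  apply: lebesgue_measure_unique => _ [[x y] _ <-].
  transitivity (r%:E * leb `]((x - v) / r)%R, ((y - v) / r)%R]%classic); last first.
    congr (_ * leb _); apply/seteqP; split => s; rewrite /a/= !in_itv/= ler_pdivlMr// ltr_pdivrMr//;
     by rewrite ![(s * r)%R]mulrC ltrBlDr lerBrDr.
  rewrite /= !lebesgue_measure_itv/= !lte_fin ltr_pM2r ?invr_gt0// ltrD2r.
  case: ifPn => _; last by rewrite mule0.
  by rewrite -!EFinB -EFinM; congr EFin; field; rewrite gt_eqF.
have -> : \int[leb]_s g s = r%:E * \int[leb]_s g (a s).
  rewrite (eq_measure_integral m); last by move=> A mA _; exact: mE.
  rewrite /m ge0_integral_mscale//; congr (_ * _).
  by rewrite ge0_integral_pushforward.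
by rewrite muleA -EFinM mulVf ?gt_eqF// mul1e.
Qed.

Lemma integral_opp_lebesgue (g : R -> \bar R) v :
  measurable_fun setT g -> (forall x, 0 <= g x) ->
  \int[leb]_s g (-1 * s + v)%R = 1%:E * \int[leb]_s g s.
Proof.
move=> mg g0; rewrite mul1e.
have h (f : R -> \bar R) : measurable_fun setT f -> (forall x, 0 <= f x) ->
    \int[leb]_s f (- s)%R = \int[leb]_s f s.
  move=> mf f0.
  transitivity (\int[pushforward leb (-%R : _ -> measurableTypeR R)]_s f s).
    by rewrite ge0_integral_pushforward.
  by apply: eq_measure_integral => //= A mA _; exact: lebesgue_measureN.
under eq_integral do rewrite mulN1r.
rewrite (h (fun s => g (s + v)%R))//.
  have := @integral_scale_lebesgue 1 g v ltr01 mg g0.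
  by rewrite invr1 mul1e => <-; under [RHS]eq_integral do rewrite mul1r.
apply: measurableT_comp => //; exact: measurable_funD.
Qed.

Lemma integral_scale_rV n (r : R) (f : 'rV[R]_n -> \bar R) w : (0 < r)%R ->
  measurable_fun setT f -> (forall x, 0 <= f x) ->
  \int[lebesgue_rV n]_x f (r *: x + w)%R =
  (r ^- n)%:E * \int[lebesgue_rV n]_x f x.
Proof.
move=> r0 mf f0; rewrite -exprVn; apply: integral_affine_rV => //.
  by rewrite invr_ge0 ltW.
by move=> g v mg g0; exact: integral_scale_lebesgue.
Qed.

Lemma integral_opp_rV n (f : 'rV[R]_n -> \bar R) :
  measurable_fun setT f -> (forall x, 0 <= f x) ->
  \int[lebesgue_rV n]_x f (- x)%R = \int[lebesgue_rV n]_x f x.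
Proof.
move=> mf f0; rewrite -[RHS]mul1e -(expr1n _ n) -(@integral_affine_rV n (-1) 1 f 0)//.
  by apply: eq_integral => x _; rewrite scaleN1r addr0.
by move=> g v mg g0; exact: integral_opp_lebesgue.
Qed.

End slicing.

(** * Weighted volumes and their slices *)

Section weighted_volume.
Context {R : realType}.

Definition dot n (a x : 'rV[R]_n) : R := \sum_i a ord0 i * x ord0 i.

Lemma dotZr n (a x : 'rV[R]_n) r : dot a (r *: x) = r * dot a x.
Proof.
by rewrite /dot mulr_sumr; apply: eq_bigr => i _; rewrite mxE mulrCA.
Qed.

Lemma dotDr n (a x y : 'rV[R]_n) : dot a (x + y) = dot a x + dot a y.
Proof.
by rewrite /dot -big_split; apply: eq_bigr => i _; rewrite mxE mulrDr.
Qed.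

Lemma dotNr n (a x : 'rV[R]_n) : dot a (- x) = - dot a x.
Proof. by rewrite -scaleN1r dotZr mulN1r. Qed.

Lemma measurable_dot n (a : 'rV[R]_n) :
  measurable_fun setT (dot a : 'rV[R]_n -> measurableTypeR R).
Proof.
apply: measurable_sum => i; apply: measurable_funM => //.
exact: measurable_rV_coord.
Qed.

Definition behead_rV n (a : 'rV[R]_n.+1) : 'rV[R]_n := \row_j a ord0 (lift ord0 j).

Lemma rV_consK n (x : 'rV[R]_n.+1) : rV_cons (x ord0 ord0, behead_rV x) = x.
Proof.
apply/rowP => i; case: (unliftP ord0 i) => [j ->|->].
  by rewrite rV_consS mxE.
by rewrite rV_cons0.
Qed.

Lemma behead_rV_cons n s (y : 'rV[R]_n) : behead_rV (rV_cons (s, y)) = y.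
Proof. by apply/rowP => i; rewrite mxE rV_consS. Qed.

Lemma rV_cons_comb n (p q s t : R) (x y : 'rV[R]_n) :
  p *: rV_cons (s, x) + q *: rV_cons (t, y) =
  rV_cons (p * s + q * t, p *: x + q *: y).
Proof.
apply/rowP => i; rewrite [LHS]mxE [X in X + _ = _]mxE [X in _ + X = _]mxE.
case: (unliftP ord0 i) => [j ->|->]; last by rewrite !rV_cons0.
by rewrite !rV_consS /= !mxE.
Qed.

Lemma rV_consD n (s t : R) (x y : 'rV[R]_n) :
  rV_cons (s, x) + rV_cons (t, y) = rV_cons (s + t, x + y).
Proof. by have := rV_cons_comb 1 1 s t x y; rewrite !scale1r !mul1r. Qed.

Lemma rV_cons_scaleD n (p s t : R) (x y : 'rV[R]_n) :
  p *: rV_cons (s, x) + rV_cons (t, y) = rV_cons (p * s + t, p *: x + y).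
Proof. by have := rV_cons_comb p 1 s t x y; rewrite !scale1r mul1r. Qed.

Lemma dot_cons n (a : 'rV[R]_n.+1) s y :
  dot a (rV_cons (s, y)) = a ord0 ord0 * s + dot (behead_rV a) y.
Proof.
rewrite /dot big_ord_recl rV_cons0; congr (_ + _).
by apply: eq_bigr => i _; rewrite rV_consS mxE.
Qed.

Local Open Scope ereal_scope.

Lemma integral_image_scale n (r : R) (w : 'rV[R]_n) (K : set 'rV[R]_n)
    (f : 'rV[R]_n -> \bar R) : (0 < r)%R ->
  measurable K -> measurable_fun setT f -> (forall x, 0 <= f x) ->
  \int[lebesgue_rV n]_(x in [set r *: x + w | x in K]%R) f x =
  (r ^+ n)%:E * \int[lebesgue_rV n]_(x in K) f (r *: x + w)%R.
Proof.
move=> r0 mK mf f0.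
have imE : ([set r *: x + w | x in K] =
    (fun y => r^-1 *: y + (- (r^-1 *: w))) @^-1` K)%R.
  apply/seteqP; split => [_ [x Kx <-]|y /= Ky].
    by rewrite /= scalerDr scalerA mulVf ?gt_eqF// scale1r addrK.
  exists (r^-1 *: y + - (r^-1 *: w))%R => //.
  by rewrite -scalerBr scalerA divff ?gt_eqF// scale1r subrK.
have mI : measurable [set r *: x + w | x in K]%R.
  by rewrite imE -[X in measurable X]setTI; apply: measurable_rV_scale.
rewrite integral_mkcond [in RHS]integral_mkcond.
set g := f \_ _.
have mg : measurable_fun setT g by apply/(measurable_restrictT _ mI); exact: measurable_funTS.
have g0 x : 0 <= g x by rewrite /g patchE; case: ifP.
have := integral_scale_rV w r0 mg g0.
set J := \int[_]_x g x => h.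
have -> : \int[lebesgue_rV n]_x ((fun x => f (r *: x + w)%R) \_ K) x =
    \int[lebesgue_rV n]_x g (r *: x + w)%R.
  apply: eq_integral => x _; rewrite /g !patchE.
  suff -> : ((r *: x + w)%R \in [set r *: x + w | x in K]%R) = (x \in K) by [].
  apply/idP/idP => [/set_mem[y Ky]|/set_mem Kx]; last by apply/mem_set; exists x.
  by move=> /addIr/(scalerI (lt0r_neq0 r0)) <-; exact/mem_set.
by rewrite h muleA -EFinM divff ?mul1e// expf_neq0// gt_eqF.
Qed.

Definition wvol n (a : 'rV[R]_n) (c : R) (K : set 'rV[R]_n) : \bar R :=
  \int[lebesgue_rV n]_(x in K) ((dot a x + c) ^+ 2)%:E.

Lemma measurable_weight n (a : 'rV[R]_n) c :
  measurable_fun setT (fun x => ((dot a x + c) ^+ 2)%:E).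
Proof.
apply/measurable_EFinP; apply: measurable_funX; apply: measurable_funD => //.
exact: measurable_dot.
Qed.

Lemma weight_ge0 n (a : 'rV[R]_n) c x : 0 <= ((dot a x + c) ^+ 2)%:E.
Proof. by rewrite lee_fin sqr_ge0. Qed.

Lemma wvol_ge0 n (a : 'rV[R]_n) c K : 0 <= wvol a c K.
Proof. by apply: integral_ge0 => x _; exact: weight_ge0. Qed.

Lemma wvol_le n (a : 'rV[R]_n) c c' (K K' : set 'rV[R]_n) :
  measurable K -> measurable K' -> K `<=` K' -> (c <= c')%R ->
  (forall x, K x -> 0 <= dot a x + c)%R -> wvol a c K <= wvol a c' K'.
Proof.
move=> mK mK' KK' cc' h.
apply: (@le_trans _ _ (wvol a c' K)).
  apply: ge0_le_integral => //.
  - by move=> x _; exact: weight_ge0.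
  - by apply: measurable_funTS; exact: measurable_weight.
  - by apply: measurable_funTS; exact: measurable_weight.
  - move=> x Kx; rewrite lee_fin lerXn2r ?nnegrE ?h ?lerD2l//.
    by rewrite (le_trans (h _ Kx))// lerD2l.
apply: ge0_subset_integral => //.
  by apply: measurable_funTS; exact: measurable_weight.
by move=> x _; exact: weight_ge0.
Qed.

Lemma lebesgue_compact_lty n (K : set 'rV[R]_n) : compact K ->
  lebesgue_rV n K < +oo.
Proof.
move=> cK; have [M M0 hM] := compact_bounded_rV cK.
have mB : measurable [set x : 'rV[R]_n | forall i, `[(- M)%R, M]%classic (x ord0 i)].
  rewrite (_ : mkset _ = \bigcap_(i in [set: 'I_n])
    (@rV_coord R n i @^-1` `[(- M)%R, M]%classic)); last first.
    by apply/seteqP; split => [y Ay i _|y Ay i]; [exact: Ay|exact: (Ay i)].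
  apply: fin_bigcap_measurable; first exact: finite_finset.
  move=> i _; rewrite -[X in measurable X]setTI.
  exact: measurable_rV_coord.
have KB : K `<=` [set x : 'rV[R]_n | forall i, `[(- M)%R, M]%classic (x ord0 i)].
  by move=> x Kx i; rewrite /= in_itv/= -ler_norml hM.
have mK := compact_measurable_rV cK.
apply: le_lt_trans (le_measure (lebesgue_rV n) (mem_set mK) (mem_set mB) KB) _.
suff : \prod_(i < n) lebesgue_measure `[(- M)%R, M]%classic < +oo.
  have := @lebesgue_rV_box R n (fun=> `[(- M)%R, M]%classic) (fun=> measurable_itv _).
  by move=> <-.
under eq_bigr do rewrite lebesgue_measure_itv/= lte_fin gtrN// -EFinB.
by rewrite prodEFin ltry.
Qed.

Lemma weight_bounded n (a : 'rV[R]_n) c K : compact K ->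
  exists M : R, forall x, K x -> ((dot a x + c) ^+ 2 <= M)%R.
Proof.
move=> cK; have [M M0 hM] := compact_bounded_rV cK.
exists ((\sum_i `|a ord0 i| * M + `|c|) ^+ 2)%R => x Kx.
rewrite -(ger0_norm (sqr_ge0 _)) normrX lerXn2r ?nnegrE ?addr_ge0//.
  by apply: sumr_ge0 => i _; rewrite mulr_ge0// ltW.
apply: le_trans (ler_normD _ _) _; rewrite lerD2r.
apply: le_trans (ler_norm_sum _ _ _) _; apply: ler_sum => i _.
by rewrite normrM ler_wpM2l// hM.
Qed.

Lemma wvol_lty n (a : 'rV[R]_n) c K : compact K -> wvol a c K < +oo.
Proof.
move=> cK; have [M hM] := weight_bounded a c cK.
have mK := compact_measurable_rV cK.
apply: (@le_lt_trans _ _ (\int[lebesgue_rV n]_(x in K) (Num.max M 0)%:E)).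
  apply: ge0_le_integral => //.
  - by move=> x _; exact: weight_ge0.
  - by apply: measurable_funTS; exact: measurable_weight.
  - by move=> x Kx; rewrite lee_fin le_max hM.
rewrite integral_cst// lte_mul_pinfty// ?lebesgue_compact_lty//.
by rewrite lee_fin le_max lexx orbT.
Qed.

(** The new constant makes the affine function at [r *: x + w] equal to [r] times the old one at
    [x]; the weight then contributes [r ^+ 2] and the volume [r ^+ n]. *)
Lemma wvol_image_scale n (a : 'rV[R]_n) (r c : R) w (K : set 'rV[R]_n) : (0 < r)%R ->
  measurable K ->
  wvol a (r * c - dot a w)%R [set r *: x + w | x in K]%R =
  (r ^+ n.+2)%:E * wvol a c K.
Proof.
move=> r0 mK; rewrite /wvol integral_image_scale//; last 2 first.
- exact: measurable_weight.
- by move=> x; exact: weight_ge0.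
have -> : (r ^+ n.+2)%:E = (r ^+ n)%:E * (r ^+ 2)%:E :> \bar R.
  by rewrite -EFinM -exprD addn2.
rewrite -muleA; congr (_ * _); rewrite -ge0_integralZl//.
- apply: eq_integral => x _; rewrite -EFinM -exprMn; congr ((_ ^+ 2)%:E)%R.
  by rewrite dotDr dotZr; ring.
- by apply: measurable_funTS; exact: measurable_weight.
- by move=> x _; exact: weight_ge0.
- by rewrite lee_fin sqr_ge0.
Qed.

Definition slice n (K : set 'rV[R]_n.+1) (s : R) : set 'rV[R]_n :=
  [set y | K (rV_cons (s, y))].

Lemma measurable_slice n (K : set 'rV[R]_n.+1) s :
  measurable K -> measurable (slice K s).
Proof.
move=> mK.
have h : measurable_fun setT (fun y : 'rV[R]_n => rV_cons (s, y)).
  by apply: (measurableT_comp (@measurable_rV_cons R n)).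
by rewrite -[X in measurable X]setTI; exact: h.
Qed.

Let restrict_weight_cons n (a : 'rV[R]_n.+1) c (K : set 'rV[R]_n.+1) s y :
  ((fun x => ((dot a x + c) ^+ 2)%:E) \_ K) (rV_cons (s, y)) =
  ((fun y => ((dot (behead_rV a) y + (a ord0 ord0 * s + c)) ^+ 2)%:E) \_ (slice K s)) y.
Proof.
rewrite !patchE (_ : (y \in slice K s) = (rV_cons (s, y) \in K)).
  by rewrite dot_cons addrAC addrC.
by apply/idP/idP; rewrite !inE.
Qed.

Let measurable_restrict_weight n (a : 'rV[R]_n) c K : measurable K ->
  measurable_fun setT ((fun x => ((dot a x + c) ^+ 2)%:E) \_ K).
Proof.
move=> mK; apply/(measurable_restrictT _ mK); apply: measurable_funTS.
exact: measurable_weight.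
Qed.

Let restrict_weight_ge0 n (a : 'rV[R]_n) c K x :
  0 <= ((fun x => ((dot a x + c) ^+ 2)%:E) \_ K) x.
Proof. by rewrite patchE; case: ifP => // _; exact: weight_ge0. Qed.

Lemma wvol_slice n (a : 'rV[R]_n.+1) c K : measurable K ->
  wvol a c K =
  \int[lebesgue_measure]_s wvol (behead_rV a) (a ord0 ord0 * s + c)%R (slice K s).
Proof.
move=> mK; rewrite /wvol integral_mkcond integral_rV_cons; last 2 first.
- exact: measurable_restrict_weight.
- exact: restrict_weight_ge0.
apply: eq_integral => s _; rewrite [RHS]integral_mkcond.
by apply: eq_integral => y _; rewrite restrict_weight_cons.
Qed.

Lemma measurable_wvol_slice n (a : 'rV[R]_n.+1) c K : measurable K ->
  measurable_fun setT (fun s : measurableTypeR R =>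
    wvol (behead_rV a) (a ord0 ord0 * s + c)%R (slice K s)).
Proof.
move=> mK; rewrite (_ : (fun s => _) = fun s =>
    \int[lebesgue_rV n]_y ((fun x => ((dot a x + c) ^+ 2)%:E) \_ K) (rV_cons (s, y))).
  apply: measurable_integral_rV_cons; last exact: restrict_weight_ge0.
  exact: measurable_restrict_weight.
apply/funext => s; rewrite /wvol integral_mkcond.
by apply: eq_integral => y _; rewrite restrict_weight_cons.
Qed.

Local Close Scope ereal_scope.

Definition cvx n (K : set 'rV[R]_n) :=
  forall x y t, K x -> K y -> 0 <= t <= 1 -> K (t *: x + (1 - t) *: y).

Lemma cvx_slice n (K : set 'rV[R]_n.+1) s : cvx K -> cvx (slice K s).
Proof.
move=> cK x y t Kx Ky t01; have := cK _ _ _ Kx Ky t01.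
by rewrite rV_cons_comb -mulrDl addrC subrK mul1r.
Qed.

Lemma continuous_behead n : continuous (@behead_rV n).
Proof.
move=> x U /nbhs_ballP[e /= e0 he]; apply/nbhs_ballP; exists e => //= y.
move=> /(ball_rVP _ _ e0) hxy; apply: he; apply/ball_rVP => // i.
by rewrite !mxE; exact: hxy.
Qed.

Lemma continuous_affine_rV n (r : R) (w : 'rV[R]_n) :
  continuous (fun x : 'rV[R]_n => r *: x + w).
Proof.
move=> x; apply: (@continuousD R _ _ (fun x => r *: x) (fun=> w)).
  exact: scaler_continuous.
exact: cst_continuous.
Qed.

Lemma compact_image_scale n (r : R) (w : 'rV[R]_n) (K : set 'rV[R]_n) :
  compact K -> compact [set r *: x + w | x in K].
Proof.
move=> cK; apply: continuous_compact => //.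
exact/continuous_subspaceT/continuous_affine_rV.
Qed.

Lemma continuous_coord0 n : continuous (fun x : 'rV[R]_n.+1 => x ord0 ord0).
Proof. exact: coord_continuous. Qed.

Lemma compact_slice n (K : set 'rV[R]_n.+1) s : compact K -> compact (slice K s).
Proof.
move=> cK; rewrite (_ : slice K s =
    @behead_rV n @` (K `&` ((fun x : 'rV[R]_n.+1 => x ord0 ord0) @^-1` [set s]))); last first.
  apply/seteqP; split => [y Ky|_ [x [Kx <-] <-]].
    by exists (rV_cons (s, y)); [split => //=; rewrite rV_cons0|exact: behead_rV_cons].
  by rewrite /slice/= rV_consK.
apply: continuous_compact; first exact/continuous_subspaceT/continuous_behead.
apply: compact_closedI => //; apply: closed_comp.
  by move=> x _; exact: continuous_coord0.
exact: closed_eq.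
Qed.

(* The slice at an interpolated height contains the cone over the slice at [s0]
   with apex in the slice at [s1]. *)
Lemma slice_conic n (a : 'rV[R]_n.+1) c K s0 s1 t :
  compact K -> cvx K -> (forall x, K x -> 0 <= dot a x + c) ->
  slice K s1 !=set0 -> 0 <= t < 1 ->
  (((1 - t) ^+ n.+2)%:E * wvol (behead_rV a) (a ord0 ord0 * s0 + c) (slice K s0) <=
  wvol (behead_rV a) (a ord0 ord0 * ((1 - t) * s0 + t * s1) + c)
    (slice K ((1 - t) * s0 + t * s1)))%E.
Proof.
move=> cK vK g0 [y1 Ky1] /andP[t0 t1].
have r0 : 0 < 1 - t by rewrite subr_gt0.
have mK := compact_measurable_rV cK.
rewrite -(@wvol_image_scale _ _ _ _ (t *: y1))//; last exact: measurable_slice.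
have gS (s : R) y : slice K s y -> 0 <= a ord0 ord0 * s + dot (behead_rV a) y + c.
  by move=> /g0; rewrite dot_cons.
have g1 := gS _ _ Ky1.
apply: wvol_le.
- apply: compact_measurable_rV; apply: compact_image_scale; exact: compact_slice.
- exact: measurable_slice.
- move=> _ [x Kx <-].
  have := vK _ _ (1 - t) Kx Ky1; rewrite rV_cons_comb (_ : 1 - (1 - t) = t); last by ring.
  by apply; rewrite ltW//= lerBlDr lerDl.
(* The two constants differ by [t] times the value of the affine function at the apex, which is
   nonnegative. *)
- rewrite dotZr mulrDr mulrDr -subr_ge0.
  have -> : a ord0 ord0 * ((1 - t) * s0) + a ord0 ord0 * (t * s1) + c -
    ((1 - t) * (a ord0 ord0 * s0) + (1 - t) * c - t * dot (behead_rV a) y1) =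
    t * (a ord0 ord0 * s1 + dot (behead_rV a) y1 + c) by ring.
  exact: mulr_ge0.
- move=> _ [x Kx <-]; rewrite dotDr !dotZr.
  have -> : (1 - t) * dot (behead_rV a) x + t * dot (behead_rV a) y1 +
    ((1 - t) * (a ord0 ord0 * s0 + c) - t * dot (behead_rV a) y1) =
    (1 - t) * (a ord0 ord0 * s0 + dot (behead_rV a) x + c) by ring.
  by apply: mulr_ge0; [exact: ltW|exact: gS].
Qed.

End weighted_volume.

(** * Continuity and positivity of slice profiles *)

Section conic.
Context {R : realType}.

(** The inequality is applied from [s] towards a point at distance [d], and from [s + e * h] back to
    [s] towards the opposite point. This squeezes [f (s + e * h)] between [(1 - h / d) ^+ k * f s]
    and [(1 + h / d) ^+ k * f s]. *)
Lemma conic_continuous (f : R -> R) (l r s : R) k :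
  (forall s0 s1 t, s1 \in `[l, r] -> 0 <= t < 1 ->
     (1 - t) ^+ k * f s0 <= f ((1 - t) * s0 + t * s1)) ->
  s \in `]l, r[ -> {for s, continuous f}.
Proof.
move=> hf; rewrite in_itv/= => /andP[ls sr].
pose d := Num.min (s - l) (r - s).
have d0 : 0 < d by rewrite lt_min !subr_gt0 ls.
have dl : l <= s - d by rewrite lerBrDl -lerBrDr ge_min lexx.
have dr : s + d <= r by rewrite -lerBrDl ge_min lexx orbT.
have key (e h : R) : e = 1 \/ e = -1 -> 0 <= h -> h < d ->
    (1 - h / d) ^+ k * f s <= f (s + e * h) <= (1 + h / d) ^+ k * f s.
  move=> e1 h0 hd; have dn0 : d != 0 by rewrite gt_eqF.
  have dh0 : 0 < d + h by rewrite ltr_pwDl.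
  have dhn0 : d + h != 0 by rewrite gt_eqF.
  have sI : s + e * d \in `[l, r] by rewrite in_itv/=; case: e1 => ->; lra.
  have sI' : s - e * d \in `[l, r] by rewrite in_itv/=; case: e1 => ->; lra.
  apply/andP; split.
    have := hf s (s + e * d) (h / d) sI.
    have -> : (1 - h / d) * s + h / d * (s + e * d) = s + e * h by field.
    by apply; rewrite divr_ge0 ?(ltW d0)//= ltr_pdivrMr// mul1r.
  have := hf (s + e * h) (s - e * d) (h / (d + h)) sI'.
  have -> : (1 - h / (d + h)) * (s + e * h) + h / (d + h) * (s - e * d) = s by field.
  have -> : 1 - h / (d + h) = (1 + h / d)^-1.
    by field; rewrite dn0 dhn0.
  rewrite divr_ge0 ?(ltW dh0)//= ltr_pdivrMr// mul1r ltrDr => /(_ d0).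
  rewrite exprVn ler_pdivrMl//.
  by rewrite exprn_gt0// ltr_pwDl// divr_ge0// ltW.
pose g (e x : R) := (1 + e * `|x - s| / d) ^+ k * f s.
have gs e : g e s = f s by rewrite /g subrr normr0 mulr0 mul0r addr0 expr1n mul1r.
have lim (e : R) : g e x @[x --> s] --> f s.
  rewrite -(gs e); apply: cvgM; last exact: cvg_cst.
  apply: (@cvg_comp _ _ _ (fun x : R => 1 + e * `|x - s| / d) (fun x => x ^+ k)); last exact: exprn_continuous.
  apply: cvgD; first exact: cvg_cst.
  apply: cvgM; last exact: cvg_cst.
  apply: cvgM; first exact: cvg_cst.
  by apply: cvg_norm; apply: cvgB; [exact: cvg_id|exact: cvg_cst].
apply: (squeeze_cvgr _ (lim (-1)) (lim 1)).
near=> x.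
have hd : `|x - s| < d.
  near: x; apply/nbhs_ballP; exists d => //= z.
  by rewrite /ball/= distrC.
have := key (if 0 <= x - s then 1 else -1) `|x - s| _ (normr_ge0 _) hd.
have -> : s + (if 0 <= x - s then 1 else -1) * `|x - s| = x.
  case: ifPn => [h0|]; first by rewrite mul1r ger0_norm// addrC subrK.
  by rewrite -ltNge => h0; rewrite ltr0_norm// mulN1r opprK addrC subrK.
by rewrite /g mul1r mulN1r mulNr; apply; case: ifP; [left|right].
Unshelve. all: by end_near. Qed.

End conic.

Section slice_profile.
Context {R : realType} {n : nat} (a : 'rV[R]_n.+1) (c : R) (K : set 'rV[R]_n.+1).
Hypotheses (cK : compact K) (vK : cvx K)
  (g0 : forall x, K x -> 0 <= dot a x + c).
Notation leb := (@lebesgue_measure R).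

Definition profile (s : R) : R :=
  fine (wvol (behead_rV a) (a ord0 ord0 * s + c) (slice K s)).

Lemma profileE s :
  wvol (behead_rV a) (a ord0 ord0 * s + c) (slice K s) = (profile s)%:E.
Proof.
by rewrite /profile fineK// ge0_fin_numE ?wvol_ge0// wvol_lty//; exact: compact_slice.
Qed.

Lemma profile_ge0 s : 0 <= profile s.
Proof. by rewrite -lee_fin -profileE wvol_ge0. Qed.

Lemma profile_out s : ~ (slice K s !=set0) -> profile s = 0.
Proof.
move=> /nonemptyPn sK0; rewrite /profile /wvol.
rewrite (_ : slice K s = set0) ?integral_set0//.
Qed.

Lemma slice_itv l r s : slice K l !=set0 -> slice K r !=set0 ->
  s \in `[l, r] -> slice K s !=set0.
Proof.
move=> [x Kx] [y Ky]; rewrite in_itv/= => /andP[ls sr].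
have [lr|rl] := ltP l r; last first.
  have -> : s = l by lra.
  by exists x.
pose t := (r - s) / (r - l).
have rl0 : 0 < r - l by rewrite subr_gt0.
have rl1 : r - l != 0 by rewrite gt_eqF.
exists (t *: x + (1 - t) *: y); rewrite /slice/=.
have -> : s = t * l + (1 - t) * r by rewrite /t; field.
rewrite -rV_cons_comb; apply: vK => //.
by rewrite divr_ge0 ?subr_ge0 ?(ltW lr)//= ler_pdivrMr// mul1r lerD2l lerN2.
Qed.

Lemma profile_conic s0 s1 t : slice K s1 !=set0 -> 0 <= t < 1 ->
  (1 - t) ^+ n.+2 * profile s0 <= profile ((1 - t) * s0 + t * s1).
Proof.
move=> sK t01; have := slice_conic s0 cK vK g0 sK t01.
by rewrite !profileE -EFinM lee_fin.
Qed.

Lemma measurable_profile : measurable_fun setT profile.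
Proof.
apply/measurable_EFinP; have := measurable_wvol_slice a c (compact_measurable_rV cK).
by under eq_fun do rewrite profileE.
Qed.

Lemma integral_profile : (\int[leb]_s (profile s)%:E = wvol a c K)%E.
Proof.
rewrite wvol_slice; last exact: compact_measurable_rV.
by apply: eq_integral => s _; rewrite profileE.
Qed.

Lemma integrable_profile : leb.-integrable setT (EFin \o profile).
Proof.
apply/integrableP; split; first by apply/measurable_EFinP; exact: measurable_profile.
under eq_integral => s _ do rewrite gee0_abs ?lee_fin ?profile_ge0//.
by rewrite integral_profile wvol_lty.
Qed.

Context (l r : R).
Hypotheses (Kl : slice K l !=set0) (Kr : slice K r !=set0)
  (Klr : forall s, slice K s !=set0 -> s \in `[l, r]).

Let profile_conic_itv s0 s1 t : s1 \in `[l, r] -> 0 <= t < 1 ->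
  (1 - t) ^+ n.+2 * profile s0 <= profile ((1 - t) * s0 + t * s1).
Proof. by move=> s1I; apply: profile_conic; exact: slice_itv s1I. Qed.

Lemma profile_continuous s : s \in `]l, r[ -> {for s, continuous profile}.
Proof. exact: conic_continuous profile_conic_itv. Qed.

(** A height [s] other than [s0] lies strictly between [s0] and an end whose slice is nonempty, and
    the cone from that end over the slice at [s0] has positive weighted volume at [s]. The end
    slices themselves may have weighted volume 0. *)
Lemma profile_gt0 s0 s : 0 < profile s0 -> s \in `]l, r[ -> 0 < profile s.
Proof.
move=> f0; rewrite in_itv/= => /andP[ls sr].
have : slice K s0 !=set0.
  by apply: contrapT => /profile_out e; move: f0; rewrite e ltxx.
move=> /Klr; rewrite in_itv/= => /andP[ls0 s0r].
have key s1 : slice K s1 !=set0 ->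
    s0 < s < s1 \/ s1 < s < s0 -> 0 < profile s.
  move=> Ks1 h.
  have d0 : s1 - s0 != 0 by rewrite subr_eq0; apply/eqP => e; lra.
  pose t := (s - s0) / (s1 - s0).
  have t01 : 0 <= t < 1.
    rewrite /t; case: h => /andP[h1 h2].
      rewrite divr_ge0 ?subr_ge0//= ?ltr_pdivrMr; lra.
    rewrite -mulrNN -invrN !opprB divr_ge0 ?subr_ge0//= ?ltr_pdivrMr; lra.
  have := profile_conic s0 Ks1 t01.
  have -> : (1 - t) * s0 + t * s1 = s by rewrite /t; field.
  apply: lt_le_trans; rewrite mulr_gt0// exprn_gt0// subr_gt0.
  by case/andP: t01.
have [ss|ss|->//] := ltgtP s s0.
- by apply: (key l) => //; right; rewrite ls.
- by apply: (key r) => //; left; rewrite ss.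
Qed.

Definition profile_int (x : R) : R := \int[leb]_(s in `[l, x]) profile s.

Let integrable_profileS (A : set R) : measurable A ->
  leb.-integrable A (EFin \o profile).
Proof. by move=> mA; apply: integrableS integrable_profile. Qed.

Let profile_fin_num (A : set R) : measurable A ->
  (\int[leb]_(s in A) (profile s)%:E)%E \is a fin_num.
Proof. by move=> mA; apply: integrable_fin_num => //; exact: integrable_profileS. Qed.

Lemma profile_int_homo : {homo profile_int : x y / x <= y}.
Proof.
move=> x y xy; rewrite /profile_int /Rintegral.
apply: fine_le.
- exact: profile_fin_num.
- exact: profile_fin_num.
apply: ge0_subset_integral => //.
- by apply/measurable_EFinP; apply: measurable_funTS; exact: measurable_profile.
- by move=> s _; rewrite lee_fin profile_ge0.
- by apply: subset_itvl; rewrite bnd_simp.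
Qed.

Lemma profile_int_l : profile_int l = 0.
Proof. by rewrite /profile_int set_itv1 Rintegral_set1. Qed.

Lemma profile_int_r : (profile_int r)%:E = wvol a c K.
Proof.
rewrite -integral_profile /profile_int /Rintegral fineK; last first.
  exact: profile_fin_num.
rewrite integral_mkcond; apply: eq_integral => s _; rewrite patchE.
case: ifPn => //; rewrite notin_setE/= => sI.
by rewrite profile_out// => /Klr; exact: sI.
Qed.

Lemma profile_int_within : l < r -> {within `[l, r], continuous profile_int}.
Proof.
move=> lr; apply: parameterized_integral_continuous; first exact: ltW.
exact: integrable_profileS.
Qed.

Lemma profile_int_derive s : s \in `]l, r[ ->
  is_derive s 1 profile_int (profile s).
Proof.
move=> sI; move: (sI); rewrite in_itv/= => /andP[ls sr].
have [dF FE] := continuous_FTC1_closed sr (integrable_profileS (measurable_itv _))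
  ls (profile_continuous sI).
by apply: DeriveDef; rewrite -?derive1E.
Qed.

End slice_profile.

(** * A weighted Brunn-Minkowski theorem *)

Section brunn_minkowski.
Context {R : realType}.

Lemma minkowski_sum_compact n (K L : set 'rV[R]_n) :
  compact K -> compact L -> compact (minkowski_sum K L).
Proof.
move=> cK cL.
rewrite (_ : minkowski_sum K L = (fun z : 'rV[R]_n * 'rV[R]_n => z.1 + z.2) @` (K `*` L)).
  apply: continuous_compact; last exact: compact_setX.
  by apply: continuous_subspaceT; exact: add_continuous.
apply/seteqP; split => [_ [x Kx] [y Ly] <-|_ [[x y] [/= Kx Ly] <-]].
  by exists (x, y).
by exists x => //; exists y.
Qed.

Lemma minkowski_sum_cvx n (K L : set 'rV[R]_n) :
  cvx K -> cvx L -> cvx (minkowski_sum K L).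
Proof.
move=> vK vL _ _ t [x Kx [y Ly <-]] [x' Kx' [y' Ly' <-]] t01.
exists (t *: x + (1 - t) *: x'); first exact: vK.
exists (t *: y + (1 - t) *: y'); first exact: vL.
by rewrite !scalerDr addrACA.
Qed.

Lemma wvol_gt0_nonempty n (a : 'rV[R]_n) c (K : set 'rV[R]_n) :
  (0 < wvol a c K)%E -> K !=set0.
Proof.
move=> h; apply/set0P; apply: contraTneq h => ->.
by rewrite /wvol integral_set0 ltxx.
Qed.

(** Iteration keeps [x - k%:R *: v] in a bounded set for every [k], which is possible only for
    [v = 0]. This removes the translation vectors in the equality cases. *)
Lemma bounded_translate n (K : set 'rV[R]_n) v : compact K -> K !=set0 ->
  (forall x, K x -> K (x - v)) -> v = 0.
Proof.
move=> cK [x Kx] hv; have [M M0 hM] := compact_bounded_rV cK.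
have hk k : K (x - k%:R *: v).
  elim: k => [|k ih]; first by rewrite scale0r subr0.
  by rewrite -natr1 scalerDl scale1r opprD addrA; exact: hv.
apply/rowP => i; rewrite mxE; apply/eqP; rewrite -normr_eq0 eq_le normr_ge0 andbT.
apply/ler_addgt0Pr => e e0; rewrite add0r leNgt; apply/negP => ev.
have [k] := ltr_add_invr (ltac:(rewrite divr_gt0 ?addr_gt0//) : 0 < e / (M + M + 1)).
rewrite add0r => hke.
have := hM _ i (hk k.+1); have := hM _ i Kx; rewrite !mxE => h1 h2.
have : k.+1%:R * `|v ord0 i| <= M + M.
  rewrite -[k.+1%:R]ger0_norm// -normrM.
  have -> : k.+1%:R * v ord0 i = x ord0 i - (x ord0 i - k.+1%:R * v ord0 i) by ring.
  by apply: le_trans (ler_normB _ _) _; exact: lerD.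
apply/negP; rewrite -ltNge.
move: hke; rewrite -ltr_pdivrMr ?invr_gt0 ?addr_gt0// invrK ltr_pdivrMl// => h3.
by move: ev; rewrite -(@ltr_pM2l _ k.+1%:R)//; lra.
Qed.

(** Lets facts known at interior heights pass to the end slices, and facts known strictly below a
    radius pass to the radius itself. *)
Lemma closed_segment_end n (K : set 'rV[R]_n) p q : closed K ->
  (forall u, 0 < u <= 1 -> K ((1 - u) *: p + u *: q)) -> K p.
Proof.
move=> cK hK; apply: contrapT => nKp.
have /nbhs_ballP[e /= e0 he] : nbhs p (~` K).
  by have := closed_openC cK; rewrite openE => /(_ _ nKp).
(* The summand 1 makes [D] strictly larger than every coordinate difference, so [u * D <= e] puts
   the point in the open ball. *)
pose D := \sum_i `|p ord0 i - q ord0 i| + 1.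
have D0 : 0 < D by rewrite ltr_wpDl// sumr_ge0.
pose u := Num.min 1 (e / D).
have u0 : 0 < u by rewrite lt_min ltr01 divr_gt0.
have u1 : u <= 1 by rewrite ge_min lexx.
have ue : u * D <= e by rewrite -ler_pdivlMr// ge_min lexx orbT.
apply: (he ((1 - u) *: p + u *: q)); last by apply: hK; rewrite u0.
apply/ball_rVP => // i; rewrite !mxE.
have -> : p ord0 i - ((1 - u) * p ord0 i + u * q ord0 i) = u * (p ord0 i - q ord0 i) by ring.
rewrite normrM gtr0_norm//; apply: lt_le_trans ue; rewrite ltr_pM2l//.
rewrite /D (bigD1 i)//= -addrA ltrDl ltr_wpDl// sumr_ge0//.
Qed.

Lemma compact_coord_max n (K : set 'rV[R]_n) (i : 'I_n) : compact K -> K !=set0 ->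
  exists m, (exists2 x, K x & x ord0 i = m) /\ forall x, K x -> x ord0 i <= m.
Proof.
move=> cK K0; have [x xK hx] := @compact_EVT_max _ R (fun x : 'rV[R]_n => x ord0 i) K K0 cK
  ltac:(by apply: continuous_subspaceT; exact: coord_continuous).
exists (x ord0 i); split; first by exists x => //; exact/set_mem.
by move=> y Ky; apply: hx; exact/mem_set.
Qed.

Lemma compact_slice_range n (K : set 'rV[R]_n.+1) : compact K -> K !=set0 ->
  exists l r, [/\ slice K l !=set0, slice K r !=set0 &
    forall s, slice K s !=set0 -> s \in `[l, r]].
Proof.
move=> cK K0.
have hc : {within K, continuous (fun x : 'rV[R]_n.+1 => x ord0 ord0)}.
  by apply: continuous_subspaceT; exact: coord_continuous.
have [x xK hx] := @compact_EVT_max _ R _ K K0 cK hc.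
have [y yK hy] := @compact_EVT_min _ R _ K K0 cK hc.
exists (y ord0 ord0), (x ord0 ord0); split.
- by exists (behead_rV y); rewrite /slice/= rV_consK; exact/set_mem.
- by exists (behead_rV x); rewrite /slice/= rV_consK; exact/set_mem.
- move=> s [z Kz]; rewrite in_itv/=.
  have := hx _ (mem_set Kz); have := hy _ (mem_set Kz).
  by rewrite rV_cons0 => -> ->.
Qed.

(* The constant term of the weight is a parameter because slicing changes it. *)
Definition weighted_BM n := forall (d : 'rV[R]_n) (cK cL : R) (K L : set 'rV[R]_n) (a b : R),
  compact K -> cvx K -> compact L -> cvx L ->
  (forall x, K x -> 0 <= dot d x + cK) -> (forall x, L x -> 0 <= dot d x + cL) ->
  0 < a -> 0 < b ->
  wvol d cK K = (a ^+ n.+2)%:E -> wvol d cL L = (b ^+ n.+2)%:E ->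
  (((a + b) ^+ n.+2)%:E <= wvol d (cK + cL)%R (minkowski_sum K L))%E /\
  (wvol d (cK + cL) (minkowski_sum K L) = ((a + b) ^+ n.+2)%:E ->
   exists v, L = [set b / a *: x + v | x in K]).

(** In dimension 0 the measure is a unit mass at the only point, so the weighted volumes are
    [cK ^+ 2] and [cL ^+ 2]; since the affine functions are nonnegative, [cK = a] and [cL = b], and
    the inequality is an identity. *)
Lemma weighted_BM0 : weighted_BM 0.
Proof.
move=> d cK cL K L a b compK _ compL _ gK gL a0 b0 eK eL.
have rV0 (x : 'rV[R]_0) : x = 0 by apply/rowP => -[].
have setTE (A : set 'rV[R]_0) : A !=set0 -> A = setT.
  by move=> [x Ax]; apply/seteqP; split => // y _; rewrite (rV0 y) -(rV0 x).
have dot0 (x : 'rV[R]_0) : dot d x = 0 by rewrite /dot big_ord0.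
have volT c : wvol d c setT = (c ^+ 2)%:E.
  rewrite /wvol/= integral_dirac//; last exact: measurable_weight.
  by rewrite diracE mem_set// mul1e dot0 add0r.
have K0 : K !=set0.
  by apply: (@wvol_gt0_nonempty _ d cK); rewrite eK lte_fin exprn_gt0.
have L0 : L !=set0.
  by apply: (@wvol_gt0_nonempty _ d cL); rewrite eL lte_fin exprn_gt0.
move: eK eL gK gL; rewrite (setTE _ K0) (setTE _ L0) !volT => -[eK] [eL].
move=> /(_ 0 I) + /(_ 0 I); rewrite dot0 !add0r => gK gL.
have cKa : cK = a by apply/eqP; rewrite -(@eqrXn2 _ 2)// ?eK// ltW.
have cLb : cL = b by apply/eqP; rewrite -(@eqrXn2 _ 2)// ?eL// ltW.
rewrite (setTE (minkowski_sum _ _)); last by exists (0 + 0); exists 0 => //; exists 0.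
split; first by rewrite volT cKa cLb.
move=> _; exists 0; apply/esym/setTE; exists (b / a *: 0 + 0); by exists 0.
Qed.

Lemma minkowski_sum_self n (K C : set 'rV[R]_n) : cvx C -> K `<=` C ->
  minkowski_sum K C `<=` [set 2 *: x + 0 | x in C].
Proof.
move=> vC KC _ [x /KC Cx [y Cy <-]].
exists (2^-1 *: x + (1 - 2^-1) *: y).
  by apply: vC => //; rewrite invr_ge0 ler0n/= invf_le1// ler1n.
rewrite addr0 scalerDr !scalerA divff ?pnatr_eq0// scale1r.
by rewrite (_ : 2 * (1 - 2^-1) = 1) ?scale1r//; field.
Qed.

(* Equality for the pair [K], [C] holds because [K + C] lies in [2 C]. *)
Lemma weighted_BM_subset_eq n (d : 'rV[R]_n) c (K C : set 'rV[R]_n) a : weighted_BM n ->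
  compact K -> cvx K -> compact C -> cvx C ->
  (forall x, C x -> 0 <= dot d x + c) -> K `<=` C -> 0 < a ->
  wvol d c K = (a ^+ n.+2)%:E -> wvol d c C = (a ^+ n.+2)%:E -> K = C.
Proof.
move=> bm cK vK cC vC g0 KC a0 eK eC.
have gK x : K x -> 0 <= dot d x + c by move/KC; exact: g0.
have [h1 h2] := bm d c c K C a a cK vK cC vC gK g0 a0 a0 eK eC.
have mC := compact_measurable_rV cC.
have h3 : (wvol d (c + c)%R (minkowski_sum K C) <= ((a + a) ^+ n.+2)%:E)%E.
  have := wvol_image_scale d c 0 (ltr0n R 2 : 0 < 2) mC.
  rewrite eC -EFinM -exprMn (_ : 2 * a = a + a); last by ring.
  move=> <-; apply: wvol_le.
  - by apply: compact_measurable_rV; exact: minkowski_sum_compact.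
  - by apply: compact_measurable_rV; exact: compact_image_scale.
  - exact: minkowski_sum_self.
  - rewrite /dot big1 ?subr0; last by move=> i _; rewrite mxE mulr0.
    by rewrite mulrDl !mul1r.
  - move=> _ [x /gK gx [y /g0 gy <-]]; rewrite dotDr; lra.
have [|v vE] := h2; first by apply/eqP; rewrite eq_le h3 h1.
have K0 : K !=set0.
  by apply: (@wvol_gt0_nonempty _ d c); rewrite eK lte_fin exprn_gt0.
(* The two volumes agree, so the ratio is 1 and [C] is [K] translated by [v]; since [K] lies in [C],
   it is stable under translation by [- v]. *)
have v0 : v = 0.
  apply: bounded_translate cK K0 _ => x /KC; rewrite {1}vE => -[y Ky <-].
  by rewrite divff ?gt_eqF// scale1r addrK.
rewrite vE v0; apply/seteqP; split => [x Kx|_ [x Kx <-]].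
  by exists x => //; rewrite divff ?gt_eqF// scale1r addr0.
by rewrite divff ?gt_eqF// scale1r addr0.
Qed.

End brunn_minkowski.

(** * Induction on the dimension: slices compared along the transport *)

Section induction_step.
Context {R : realType} (n : nat).
Hypothesis bm : @weighted_BM R n.
Notation leb := (@lebesgue_measure R).

Lemma profile_itv_lt (d : 'rV[R]_n.+1) c K l r : compact K ->
  (0 < wvol d c K)%E ->
  slice K l !=set0 -> slice K r !=set0 ->
  (forall s, slice K s !=set0 -> s \in `[l, r]) -> l < r.
Proof.
move=> cK w0 Kl Kr Klr; rewrite ltNge; apply/negP => rl.
have lr : l = r by have := Klr _ Kl; rewrite in_itv/=; lra.
move: w0; rewrite -(profile_int_r d c cK Klr) -lr profile_int_l.
by rewrite ltxx.
Qed.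

Lemma profile_gt0_exists (d : 'rV[R]_n.+1) c K : compact K ->
  (0 < wvol d c K)%E -> exists s, 0 < profile d c K s.
Proof.
move=> cK; rewrite -integral_profile// => w0.
apply: contrapT => h; move: w0; rewrite integral0_eq ?ltxx// => s _.
apply/eqP; rewrite eqe eq_le profile_ge0// andbT leNgt.
by apply/negP => ?; apply: h; exists s.
Qed.

Lemma minkowski_sum_slice (K L : set 'rV[R]_n.+1) s t :
  minkowski_sum (slice K s) (slice L t) `<=` slice (minkowski_sum K L) (s + t).
Proof.
move=> _ [x Kx [y Ly <-]]; rewrite /slice/= -rV_consD.
by exists (rV_cons (s, x)) => //; exists (rV_cons (t, y)).
Qed.

Context (d : 'rV[R]_n.+1) (c1 c2 : R) (K L : set 'rV[R]_n.+1) (a b : R).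
Hypotheses (cK : compact K) (vK : cvx K) (cL : compact L) (vL : cvx L)
  (gK : forall x, K x -> 0 <= dot d x + c1)
  (gL : forall x, L x -> 0 <= dot d x + c2)
  (a0 : 0 < a) (b0 : 0 < b)
  (eK : wvol d c1 K = (a ^+ n.+3)%:E) (eL : wvol d c2 L = (b ^+ n.+3)%:E).

Let M := minkowski_sum K L.
Let cM : compact M. Proof. exact: minkowski_sum_compact. Qed.
Let vM : cvx M. Proof. exact: minkowski_sum_cvx. Qed.
Let gM x : M x -> 0 <= dot d x + (c1 + c2).
Proof. by move=> [y /gK gy [z /gL gz <-]]; rewrite dotDr; lra. Qed.

Let wK : (0 < wvol d c1 K)%E. Proof. by rewrite eK lte_fin exprn_gt0. Qed.
Let wL : (0 < wvol d c2 L)%E. Proof. by rewrite eL lte_fin exprn_gt0. Qed.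

Let fK := profile d c1 K.
Let fL := profile d c2 L.
Let fM := profile d (c1 + c2) M.
Let rho := b / a.

(** The weighted volume of the sum of two slices sits between the bound of the induction hypothesis
    and the slice of the sum. Keeping it as a middle term allows each of the two steps to be tested
    for equality. *)
Let slice_sum_le s t x y : 0 < x -> 0 < y ->
  fK s = x ^+ n.+2 -> fL t = y ^+ n.+2 ->
  [/\ (((x + y) ^+ n.+2)%:E <=
    wvol (behead_rV d) ((d ord0 ord0 * s + c1) + (d ord0 ord0 * t + c2))%R
      (minkowski_sum (slice K s) (slice L t)))%E,
    (wvol (behead_rV d) ((d ord0 ord0 * s + c1) + (d ord0 ord0 * t + c2))%R
      (minkowski_sum (slice K s) (slice L t)) <= (fM (s + t))%:E)%E &
    wvol (behead_rV d) ((d ord0 ord0 * s + c1) + (d ord0 ord0 * t + c2))%R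
      (minkowski_sum (slice K s) (slice L t)) = ((x + y) ^+ n.+2)%:E ->
    exists v, slice L t = [set y / x *: z + v | z in slice K s] ].
Proof.
move=> x0 y0 fx fy.
have gs (A : set 'rV[R]_n.+1) c (gA : forall x, A x -> 0 <= dot d x + c) u z :
    slice A u z -> 0 <= dot (behead_rV d) z + (d ord0 ord0 * u + c).
  by move=> /gA; rewrite dot_cons; lra.
have eKs := profileE d c1 cK s; have eLt := profileE d c2 cL t.
have [h1 h2] := bm (@compact_slice _ _ _ s cK) (@cvx_slice _ _ _ s vK) (@compact_slice _ _ _ t cL)
  (@cvx_slice _ _ _ t vL) (gs K _ gK s) (gs L _ gL t) x0 y0
  (etrans eKs (congr1 EFin fx)) (etrans eLt (congr1 EFin fy)).
split => //.
rewrite /fM -profileE//.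
(* The constants are affine in the height, so those of two slices add up to the constant of the
   slice of the sum. *)
have -> : d ord0 ord0 * s + c1 + (d ord0 ord0 * t + c2) = d ord0 ord0 * (s + t) + (c1 + c2).
  by ring.
apply: wvol_le => //.
- by apply: compact_measurable_rV; apply: minkowski_sum_compact; exact: compact_slice.
- by apply: measurable_slice; exact: compact_measurable_rV.
- exact: minkowski_sum_slice.
- by move=> z /minkowski_sum_slice Mz; apply: (gs M _ gM).
Qed.

Let fM_ge s t x y : 0 < x -> 0 < y ->
  fK s = x ^+ n.+2 -> fL t = y ^+ n.+2 -> (x + y) ^+ n.+2 <= fM (s + t).
Proof.
move=> x0 y0 fx fy; have [h1 h2 _] := slice_sum_le x0 y0 fx fy.
by rewrite -lee_fin (le_trans h1).
Qed.

Context (lK rK lL rL : R).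
Hypotheses (Kl : slice K lK !=set0) (Kr : slice K rK !=set0)
  (Klr : forall s, slice K s !=set0 -> s \in `[lK, rK])
  (Ll : slice L lL !=set0) (Lr : slice L rL !=set0)
  (Llr : forall s, slice L s !=set0 -> s \in `[lL, rL]).

Let Ml : slice M (lK + lL) !=set0.
Proof.
by move: Kl Ll => [x Kx] [y Ly]; exists (x + y); apply: minkowski_sum_slice;
  exists x => //; exists y.
Qed.

Let Mr : slice M (rK + rL) !=set0.
Proof.
by move: Kr Lr => [x Kx] [y Ly]; exists (x + y); apply: minkowski_sum_slice;
  exists x => //; exists y.
Qed.

Let Mlr s : slice M s !=set0 -> s \in `[lK + lL, rK + rL].
Proof.
move=> [z [x Kx [y Ly xy]]].
have := Klr (ex_intro _ (behead_rV x) (eq_rect_r K Kx (rV_consK x))).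
have := Llr (ex_intro _ (behead_rV y) (eq_rect_r L Ly (rV_consK y))).
have -> : s = x ord0 ord0 + y ord0 ord0.
  by have := congr1 (fun u : 'rV[R]_n.+1 => u ord0 ord0) xy; rewrite mxE rV_cons0.
by rewrite !in_itv/= => /andP[? ?] /andP[? ?]; rewrite !lerD.
Qed.

Let lrK : lK < rK. Proof. exact: profile_itv_lt wK Kl Kr Klr. Qed.
Let lrL : lL < rL. Proof. exact: profile_itv_lt wL Ll Lr Llr. Qed.

Let fK0 s : s \in `]lK, rK[ -> 0 < fK s.
Proof.
have [s0 h] := profile_gt0_exists cK wK.
by move=> sI; exact: (profile_gt0 cK vK gK Kl Kr Klr h sI).
Qed.

Let fL0 s : s \in `]lL, rL[ -> 0 < fL s.
Proof.
have [s0 h] := profile_gt0_exists cL wL.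
by move=> sI; exact: (profile_gt0 cL vL gL Ll Lr Llr h sI).
Qed.

Let FM := profile_int d (c1 + c2) M (lK + lL).

Let dFM s : s \in `]lK + lL, rK + rL[ -> is_derive s 1 FM (fM s).
Proof. exact: (profile_int_derive cM vM gM Ml Mr). Qed.

Let FMr : (FM (rK + rL))%:E = wvol d (c1 + c2) M.
Proof. exact: profile_int_r Mlr. Qed.

Let FMl : FM (lK + lL) = 0.
Proof. exact: profile_int_l. Qed.

Let FKr : profile_int d c1 K lK rK = a ^+ n.+3.
Proof. by have := profile_int_r d c1 cK Klr; rewrite eK => -[]. Qed.

Let FLr : profile_int d c2 L lL rL = b ^+ n.+3.
Proof. by have := profile_int_r d c2 cL Llr; rewrite eL => -[]. Qed.

Let cFK : {within `[lK, rK], continuous (profile_int d c1 K lK)}.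
Proof. exact: profile_int_within. Qed.

Let cFL : {within `[lL, rL], continuous (profile_int d c2 L lL)}.
Proof. exact: profile_int_within. Qed.

Let dFK s : s \in `]lK, rK[ -> is_derive s 1 (profile_int d c1 K lK) (fK s).
Proof. exact: (profile_int_derive cK vK gK Kl Kr). Qed.

Let dFL s : s \in `]lL, rL[ -> is_derive s 1 (profile_int d c2 L lL) (fL s).
Proof. exact: (profile_int_derive cL vL gL Ll Lr). Qed.

Let FKl : profile_int d c1 K lK lK = 0.
Proof. exact: profile_int_l. Qed.

Let FLl : profile_int d c2 L lL lL = 0.
Proof. exact: profile_int_l. Qed.

Let FM_homo : {homo FM : x y / x <= y}.
Proof. exact: profile_int_homo. Qed.

Let fM_ge_itv s t x y : s \in `]lK, rK[ -> t \in `]lL, rL[ -> 0 < x -> 0 < y ->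
  fK s = x ^+ n.+2 -> fL t = y ^+ n.+2 -> (x + y) ^+ n.+2 <= fM (s + t).
Proof. by move=> _ _; exact: fM_ge. Qed.

Lemma weighted_BM_step_le : (((a + b) ^+ n.+3)%:E <= wvol d (c1 + c2)%R M)%E.
Proof.
rewrite -FMr lee_fin -[FM _]subr0 -FMl.
exact: (transport_le a0 b0 lrK lrL cFK cFL dFK dFL dFM fK0 fL0 FKl FKr FLl FLr
  FM_homo fM_ge_itv).
Qed.

Hypothesis eM : wvol d (c1 + c2) M = ((a + b) ^+ n.+3)%:E.

Let t_ s := lL + rho * (s - lK).

Let transport_affine : rL - lL = rho * (rK - lK) /\
  forall s, s \in `]lK, rK[ ->
  [/\ t_ s \in `]lL, rL[, fL (t_ s) = rho ^+ n.+2 * fK s &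
      fM (s + t_ s) = (1 + rho) ^+ n.+2 * fK s].
Proof.
have eFM : FM (rK + rL) - FM (lK + lL) = (a + b) ^+ n.+3.
  by rewrite FMl subr0; move: eM; rewrite -FMr => -[].
exact: (transport_eq a0 b0 lrK lrL cFK cFL dFK dFL dFM fK0 fL0 FKl FKr FLl FLr
  FM_homo fM_ge_itv eFM).
Qed.

Let rho0 : 0 < rho. Proof. exact: divr_gt0. Qed.

(** Equality in the transport makes the ends of the chain in [slice_sum_le] coincide. The first
    equality gives the homothety; the second, through [weighted_BM_subset_eq], shows that the sum of
    matching slices fills the slice of the sum. *)
Let slices_homothetic s : s \in `]lK, rK[ ->
  (exists v, slice L (t_ s) = [set rho *: z + v | z in slice K s]) /\
  minkowski_sum (slice K s) (slice L (t_ s)) = slice M (s + t_ s).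
Proof.
move=> sI; have [_ /(_ _ sI)[tI fLt fMt]] := transport_affine.
have [x x0 fx] := root_exists n.+1 (fK0 sI).
have y0 : 0 < rho * x by rewrite mulr_gt0.
have fy : fL (t_ s) = (rho * x) ^+ n.+2 by rewrite fLt fx -exprMn.
have fz : fM (s + t_ s) = (x + rho * x) ^+ n.+2.
  by rewrite fMt fx -exprMn mulrDl mul1r.
have [h1 h2 h3] := slice_sum_le x0 y0 fx fy.
have e : wvol (behead_rV d) ((d ord0 ord0 * s + c1) + (d ord0 ord0 * t_ s + c2))%R
      (minkowski_sum (slice K s) (slice L (t_ s))) = ((x + rho * x) ^+ n.+2)%:E.
  by apply/eqP; rewrite eq_le h1 -fz h2.
split.
  by have [v vE] := h3 e; exists v; rewrite vE mulfK// gt_eqF.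
have gs z : slice M (s + t_ s) z ->
    0 <= dot (behead_rV d) z + (d ord0 ord0 * (s + t_ s) + (c1 + c2)).
  by move=> /gM; rewrite dot_cons; lra.
apply: (@weighted_BM_subset_eq R n (behead_rV d) (d ord0 ord0 * (s + t_ s) + (c1 + c2))
  _ _ (x + rho * x)) => //.
- by apply: minkowski_sum_compact; exact: compact_slice.
- by apply: minkowski_sum_cvx; exact: cvx_slice.
- exact: compact_slice.
- exact: cvx_slice.
- exact: minkowski_sum_slice.
- by rewrite addr_gt0.
- by rewrite -e; congr wvol; ring.
- by rewrite -fz /fM -profileE.
Qed.

Let v_ s : 'rV[R]_n :=
  get [set v | slice L (t_ s) = [set rho *: z + v | z in slice K s]].

Let slice_v s : s \in `]lK, rK[ ->
  slice L (t_ s) = [set rho *: z + v_ s | z in slice K s].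
Proof.
move=> /slices_homothetic[[v vE] _].
exact: (@getI _ [set v | slice L (t_ s) = [set rho *: z + v | z in slice K s]] v vE).
Qed.

Let in_oc s : s \in `]lK, rK[ -> s \in `[lK, rK].
Proof. by rewrite !in_itv/= => /andP[/ltW -> /ltW ->]. Qed.

(* All the slices of [K + L] are sums of matching slices only, which makes the
   support function of the slices satisfy [concave_shift_cst]. *)
Let v_cst s s' : s \in `]lK, rK[ -> s' \in `]lK, rK[ -> v_ s = v_ s'.
Proof.
move=> sI s'I; apply/rowP => i.
pose k s := get [set m | (exists2 x, slice K s x & x ord0 i = m) /\
   forall x, slice K s x -> x ord0 i <= m].
have kP u : u \in `]lK, rK[ -> (exists2 x, slice K u x & x ord0 i = k u) /\
   forall x, slice K u x -> x ord0 i <= k u.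
  move=> uI; have [m hm] := compact_coord_max i (@compact_slice _ _ _ u cK)
    (slice_itv vK Kl Kr (in_oc uI)).
  exact: (@getI _ [set m | (exists2 x, slice K u x & x ord0 i = m) /\
    forall x, slice K u x -> x ord0 i <= m] m hm).
(* [phi u] is the maximum of the coordinate [i] on the slice of [L] at [t_ u], so [phi - rho * k] is
   that coordinate of the translation vector. *)
pose phi s := rho * k s + v_ s ord0 i.
have := @concave_shift_cst R k phi lK rK rho s s' _ rho0 _ sI s'I.
rewrite /phi !(addrC (rho * _)) !addrK; apply.
- move=> x y t xI yI t01.
  have zI : t * x + (1 - t) * y \in `]lK, rK[.
    move: xI yI t01; rewrite !in_itv/= => /andP[x1 x2] /andP[y1 y2] /andP[t0 t1].
    have t2 : 0 <= 1 - t by rewrite subr_ge0.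
    have h1 : 0 <= t * (x - lK) by rewrite mulr_ge0// subr_ge0 ltW.
    have h2 : 0 <= t * (rK - x) by rewrite mulr_ge0// subr_ge0 ltW.
    have h3 : 0 <= (1 - t) * (y - lK) by rewrite mulr_ge0// subr_ge0 ltW.
    have h4 : 0 <= (1 - t) * (rK - y) by rewrite mulr_ge0// subr_ge0 ltW.
    have [e|tp] := eqVneq t 0; first by rewrite e; lra.
    have h5 : 0 < t * (x - lK) by rewrite mulr_gt0 ?subr_gt0// lt_neqAle eq_sym tp.
    have h6 : 0 < t * (rK - x) by rewrite mulr_gt0 ?subr_gt0// lt_neqAle eq_sym tp.
    nra.
  have [[p Kp <-] _] := kP _ xI; have [[q Kq <-] _] := kP _ yI.
  have [_ h] := kP _ zI.
  have := h (t *: p + (1 - t) *: q); rewrite !mxE; apply.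
  by rewrite /slice/= -rV_cons_comb; exact: vK.
- move=> u e uI u1 u2.
  have [[p Kp pE] _] := kP _ u1; have [[q Kq qE] _] := kP _ u2.
  have [_ h] := kP _ uI.
  have : minkowski_sum (slice K u) (slice L (t_ u)) (p + (rho *: q + v_ (u - e))).
    have [_ ->] := slices_homothetic uI.
    (* [t_] has slope [rho], so raising the first height by [rho * e] and lowering the parameter of
       the second by [e] keeps the total height. A sum of unmatched slices thus lies in the sum of
       matched ones. *)
    have -> : u + t_ u = (u + rho * e) + t_ (u - e) by rewrite /t_; ring.
    apply: minkowski_sum_slice; exists p => //; exists (rho *: q + v_ (u - e)) => //.
    by rewrite (slice_v u2); exists q.
  move=> [x Kx [y]]; rewrite (slice_v uI) => -[z Kz <-] e1.
  have := congr1 (fun w : 'rV[R]_n => w ord0 i) e1; rewrite !mxE pE qE.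
  have := h _ Kx; have := h _ Kz => h1 h2 e2.
  have : rho * z ord0 i <= rho * k u by rewrite ler_pM2l.
  lra.
Qed.

(** The slices match under [x |-> rho *: x + w], whose first coordinate is the affine transport of
    heights and whose other coordinates carry the common translation vector. This covers interior
    heights; the end slices are reached along segments towards a point at the middle height [m]. *)
Lemma weighted_BM_step_eq : exists v, L = [set rho *: x + v | x in K].
Proof.
pose m := (lK + rK) / 2.
have mI : m \in `]lK, rK[ by rewrite in_itv/= !midf_lt.
have [ltE tP] := transport_affine.
pose w : 'rV[R]_n.+1 := rV_cons (lL - rho * lK, v_ m).
have fwd s y : s \in `]lK, rK[ -> slice K s y -> L (rho *: rV_cons (s, y) + w).
  move=> sI Ky; have := slice_v sI; rewrite (v_cst sI mI) => e.
  have : slice L (t_ s) (rho *: y + v_ m) by rewrite e; exists y.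
  rewrite /slice/= /w rV_cons_scaleD.
  by rewrite (_ : t_ s = rho * s + (lL - rho * lK)) // /t_; ring.
have bwd s y : s \in `]lK, rK[ -> slice L (t_ s) y ->
    K (rho^-1 *: (rV_cons (t_ s, y) - w)).
  move=> sI; rewrite (slice_v sI) (v_cst sI mI) => -[z Kz <-].
  have -> : rV_cons (t_ s, rho *: z + v_ m) = rho *: rV_cons (s, z) + w.
    rewrite /w rV_cons_scaleD.
    by rewrite (_ : t_ s = rho * s + (lL - rho * lK)) // /t_; ring.
  by rewrite addrK scalerA mulVf ?scale1r// gt_eqF.
have rn0 : rho != 0 by rewrite gt_eqF.
have Kx0 (x : 'rV[R]_n.+1) : K x -> x ord0 ord0 \in `[lK, rK].
  by move=> Kx; apply: Klr; exists (behead_rV x); rewrite /slice/= rV_consK.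
have Lx0 (x : 'rV[R]_n.+1) : L x -> x ord0 ord0 \in `[lL, rL].
  by move=> Lx; apply: Llr; exists (behead_rV x); rewrite /slice/= rV_consK.
have mid (l r p q u : R) : p \in `[l, r] -> q \in `]l, r[ -> 0 < u <= 1 ->
    (1 - u) * p + u * q \in `]l, r[.
  rewrite !in_itv/= => /andP[p1 p2] /andP[q1 q2] /andP[u0 u1].
  have u2 : 0 <= 1 - u by rewrite subr_ge0.
  have h1 : 0 <= (1 - u) * (p - l) by rewrite mulr_ge0// subr_ge0.
  have h2 : 0 <= (1 - u) * (r - p) by rewrite mulr_ge0// subr_ge0.
  have h3 : 0 < u * (q - l) by rewrite mulr_gt0// subr_gt0.
  have h4 : 0 < u * (r - q) by rewrite mulr_gt0// subr_gt0.
  by apply/andP; split; lra.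
have [y0 Ky0] := slice_itv vK Kl Kr (in_oc mI).
pose x0 := rV_cons (m, y0).
have Lz0 := fwd _ _ mI Ky0; rewrite -/x0 in Lz0.
exists w; apply/seteqP; split => [z Lz|_ [x Kx <-]].
- exists (rho^-1 *: (z - w)); last by rewrite scalerA divff// scale1r subrK.
  apply: (@closed_segment_end _ _ _ _ (rho^-1 *: ((rho *: x0 + w) - w))).
    exact: compact_closed_rV.
  move=> u u01; have /andP[u0 u1] := u01.
  pose zu := (1 - u) *: z + u *: (rho *: x0 + w).
  have Lzu : L zu.
    have := vL Lz Lz0 (_ : 0 <= 1 - u <= 1).
    by rewrite opprB addrCA subrr addr0; apply; rewrite subr_ge0 u1 lerBlDr lerDl ltW.
  have -> : (1 - u) *: (rho^-1 *: (z - w)) + u *: (rho^-1 *: (rho *: x0 + w - w)) =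
      rho^-1 *: (zu - w).
    rewrite /zu; apply/rowP => i; rewrite !mxE; by field.
  have zuI : zu ord0 ord0 \in `]lL, rL[.
    have -> : zu ord0 ord0 = (1 - u) * z ord0 ord0 + u * t_ m.
      rewrite /zu /x0 /w rV_cons_scaleD [LHS]mxE [X in X + _]mxE [X in _ + X]mxE.
      by rewrite rV_cons0/= /t_; ring.
    by have [tI _ _] := tP _ mI; exact: mid (Lx0 _ Lz) tI u01.
  pose s := lK + (zu ord0 ord0 - lL) / rho.
  have tsE : t_ s = zu ord0 ord0 by rewrite /t_ /s; field.
  have sI : s \in `]lK, rK[.
    move: zuI; rewrite !in_itv/= /s => /andP[h1 h2].
    rewrite ltrDl divr_gt0 ?subr_gt0//= addrC -ltrBrDr ltr_pdivrMr//; lra.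
  have := bwd s (behead_rV zu) sI; rewrite tsE /slice/= rV_consK.
  by apply.
- apply: (@closed_segment_end _ _ _ _ (rho *: x0 + w)).
    exact: compact_closed_rV.
  move=> u u01; have /andP[u0 u1] := u01.
  pose xu := (1 - u) *: x + u *: x0.
  have Kxu : K xu.
    have := vK Kx Ky0 (_ : 0 <= 1 - u <= 1).
    by rewrite opprB addrCA subrr addr0; apply; rewrite subr_ge0 u1 lerBlDr lerDl ltW.
  have -> : (1 - u) *: (rho *: x + w) + u *: (rho *: x0 + w) = rho *: xu + w.
    by rewrite /xu; apply/rowP => i; rewrite !mxE; ring.
  have xuI : xu ord0 ord0 \in `]lK, rK[.
    have -> : xu ord0 ord0 = (1 - u) * x ord0 ord0 + u * m.
      by rewrite /xu [LHS]mxE [X in X + _]mxE [X in _ + X]mxE rV_cons0.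
    exact: mid (Kx0 _ Kx) mI u01.
  have := fwd (xu ord0 ord0) (behead_rV xu) xuI; rewrite /slice/= rV_consK.
  by apply.
Qed.

End induction_step.

Theorem weighted_brunn_minkowski (R : realType) n : @weighted_BM R n.
Proof.
elim: n => [|n ih]; first exact: weighted_BM0.
move=> d c1 c2 K L a b cK vK cL vL gK gL a0 b0 eK eL.
have K0 : K !=set0.
  by apply: (@wvol_gt0_nonempty _ _ d c1); rewrite eK lte_fin exprn_gt0.
have L0 : L !=set0.
  by apply: (@wvol_gt0_nonempty _ _ d c2); rewrite eL lte_fin exprn_gt0.
have [lK [rK [Kl Kr Klr]]] := compact_slice_range cK K0.
have [lL [rL [Ll Lr Llr]]] := compact_slice_range cL L0.
split.
  exact: (weighted_BM_step_le ih cK vK cL vL gK gL a0 b0 eK eL Kl Kr Klr Ll Lr Llr).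
move=> eM.
exact: (weighted_BM_step_eq ih cK vK cL vL gK gL a0 b0 eK eL Kl Kr Klr Ll Lr Llr eM).
Qed.

(** * Polar coordinates *)

Section sphere_integral.
Context {R : realType} {n : nat}.
Implicit Types x y u : 'rV[R]_n.

Lemma enorm_ge0 x : 0 <= enorm x.
Proof. exact: sqrtr_ge0. Qed.

Lemma enorm_sqr x : enorm x ^+ 2 = dot x x.
Proof.
rewrite sqr_sqrtr; last by apply: sumr_ge0 => i _; exact: sqr_ge0.
by apply: eq_bigr => i _; rewrite expr2.
Qed.

Lemma enorm_eq0 x : (enorm x == 0) = (x == 0).
Proof.
apply/eqP/eqP => [h|->]; last first.
  by rewrite /enorm big1 ?sqrtr0// => i _; rewrite mxE expr0n.
have : dot x x = 0 by rewrite -enorm_sqr h expr0n.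
move=> /eqP; rewrite psumr_eq0; last by move=> i _; rewrite -expr2 sqr_ge0.
move=> /allP h0; apply/rowP => i; rewrite mxE; apply/eqP.
by have := h0 i (mem_index_enum i); rewrite /= mulf_eq0 orbb.
Qed.

Lemma enorm_gt0 x : (0 < enorm x) = (x != 0).
Proof. by rewrite lt_neqAle enorm_ge0 eq_sym enorm_eq0 andbT. Qed.

Definition pball : set 'rV[R]_n := [set x | 0 < enorm x <= 1].

Lemma measurable_pball : measurable pball.
Proof.
have -> : pball = enorm @^-1` `]0, 1]%classic.
  by apply/seteqP; split => x; rewrite /pball/= in_itv.
by rewrite -[X in measurable X]setTI; exact: measurable_enorm.
Qed.

(* The indicator sends everything outside the punctured ball to 0, which is off
   the sphere, so that no restriction of the measure is needed. *)
Let proj x := ((enorm x)^-1 * \1_pball x) *: x.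

Let measurable_proj : measurable_fun setT proj.
Proof.
apply: measurable_fun_rV => i.
rewrite (_ : _ \o _ = fun x => enorm x `^ (-1) * \1_pball x * rV_coord i x); last first.
  by apply/funext => x /=; rewrite /rV_coord mxE powR_inv1// enorm_ge0.
apply: measurable_funM; last exact: measurable_rV_coord.
apply: measurable_funM; last by apply: measurable_indic; exact: measurable_pball.
exact: (measurableT_comp (measurable_powR _) measurable_enorm).
Qed.

Let projE x : pball x -> proj x = (enorm x)^-1 *: x.
Proof. by move=> xB; rewrite /proj indicE mem_set// mulr1. Qed.

Let proj_sphere x : sphere (proj x) <-> pball x.
Proof.
split=> [|xB]; last first.
  have /andP[x0 x1] := xB.
  by rewrite /sphere/= projE// enormZ ?invr_ge0 ?ltW// mulVf ?gt_eqF.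
apply: contraPP => xB; rewrite /sphere/proj/= indicE memNset// mulr0 scale0r.
by move=> /eqP; rewrite (eqP (etrans (enorm_eq0 0) (eqxx _))) eq_sym oner_eq0.
Qed.

Let m : {measure set 'rV[R]_n -> \bar R} :=
  mscale n%:R%:nng (measure_function_pushforward__canonical__measure_function_Measure
    (lebesgue_rV n) measurable_proj).

Let sphere_measureE A : measurable A -> A `<=` sphere -> sphere_measure A = m A.
Proof.
move=> mA AS; rewrite /sphere_measure /m /mscale/=; congr (_ * lebesgue_rV n _)%E.
apply/seteqP; split => [_ [r /= + [u [u1 Au] <-]]|x /= Ax].
  rewrite in_itv/= => /andP[r0 r1].
  have ru : enorm (r *: u) = r by rewrite enormZ ?ltW// u1 mulr1.
  have rB : pball (r *: u) by rewrite /pball/= ru r0.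
  by rewrite /= projE// ru scalerA mulVf ?gt_eqF// scale1r.
have xB : pball x by apply/proj_sphere/AS.
have /andP[x0 x1] := xB.
exists (enorm x); first by rewrite /= in_itv/= x0.
exists (proj x); first by split => //; exact: AS.
by rewrite projE// scalerA divff ?gt_eqF// scale1r.
Qed.

Lemma measurable_sphere : measurable (sphere : set 'rV[R]_n).
Proof.
have -> : sphere = enorm @^-1` [set 1 : R] by [].
by rewrite -[X in measurable X]setTI; exact: measurable_enorm.
Qed.

Lemma integral_sphere (f : 'rV[R]_n -> \bar R) : measurable_fun sphere f ->
  (forall x, 0 <= f x)%E ->
  (\int[sphere_measure]_(u in sphere) f u =
   n%:R%:E * \int[lebesgue_rV n]_(x in pball) f ((enorm x)^-1 *: x))%E.
Proof.
move=> mf f0; rewrite (eq_measure_integral m); last exact: sphere_measureE.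
rewrite /m ge0_integral_mscale//; last exact: measurable_sphere.
congr (_ * _)%E; rewrite ge0_integral_pushforward//; last exact: measurable_sphere.
have -> : proj @^-1` sphere = pball.
  by apply/seteqP; split => x; [move/proj_sphere|move=> ?; exact/proj_sphere].
by apply: eq_integral => x /set_mem xB /=; rewrite projE.
Qed.

End sphere_integral.

Section power_integrals.
Context {R : realType}.
Notation leb := (@lebesgue_measure R).

Lemma is_derive_exprn k (x : R) :
  is_derive x 1 (fun r : R => r ^+ k.+1) (k.+1%:R * x ^+ k).
Proof.
apply: DeriveDef; first exact: exprn_derivable.
by rewrite exp_derive /= /GRing.scale/= mulr1.
Qed.

Lemma integral_power k (a : R) : 0 < a ->
  (\int[leb]_(r in `]0%R, a]) (k.+1%:R * r ^+ k)%:E = (a ^+ k.+1)%:E)%E.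
Proof.
move=> a0.
have cX m : continuous (fun r : R => r ^+ m) by exact: exprn_continuous.
have cf : continuous (fun r : R => k.+1%:R * r ^+ k).
  by move=> x; apply: cvgM; [exact: cvg_cst|exact: cX].
have dX (x : R) : is_derive x 1 (fun r : R => r ^+ k.+1) (k.+1%:R * x ^+ k).
  exact: is_derive_exprn.
rewrite integral_itv_obnd_cbnd; last first.
  by apply/measurable_EFinP; apply: measurable_funTS; exact: continuous_measurable_fun.
rewrite (@continuous_FTC2 _ _ (fun r => r ^+ k.+1))//.
- by rewrite expr0n/= sube0.
- exact: continuous_subspaceT.
- split.
  + by move=> x _; have [] := dX x.
  + by apply: cvg_at_right_filter; exact: cX.
  + by apply: cvg_at_left_filter; exact: cX.
- by move=> x _; rewrite derive1E; have [_ ->] := dX x.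
Qed.

Lemma integral_inv_power k (a : R) : 0 < a ->
  (\int[leb]_(r in `[a, +oo[) (k.+1%:R * r ^- k.+2)%:E = (a ^- k.+1)%:E)%E.
Proof.
move=> a0.
have dX (x : R) : 0 < x ->
    is_derive x 1 (fun r : R => - r ^- k.+1) (k.+1%:R * x ^- k.+2).
  move=> x0; have xn0 : x != 0 by rewrite gt_eqF.
  have h2 := is_deriveV (expf_neq0 k.+1 xn0 : (fun r : R => r ^+ k.+1) x != 0) (is_derive_exprn k x).
  apply: is_derive_eq (is_deriveN h2) _.
  rewrite /GRing.scale/= mulNr opprK !exprS expr0.
  by field; rewrite xn0 expf_neq0.
rewrite (@ge0_continuous_FTC2y _ _ (fun r => - r ^- k.+1) a 0)//.
- by rewrite EFinN oppeK add0e.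
- by move=> x ax; rewrite mulr_ge0// invr_ge0 exprn_ge0// (le_trans (ltW a0)).
- apply: continuous_in_subspaceT => x /set_mem/=; rewrite in_itv/= andbT => ax.
  apply: cvgM; first exact: cvg_cst.
  apply: cvgV; last exact: exprn_continuous.
  by rewrite expf_neq0// gt_eqF// (lt_le_trans a0).
- rewrite -oppr0; apply: cvgN; apply/cvgrPdist_lt => e e0; near=> x.
  rewrite sub0r normrN.
  have x1 : 1 < x by near: x; apply: nbhs_pinfty_gt; exact: num_real.
  have xe : e^-1 < x by near: x; apply: nbhs_pinfty_gt; exact: num_real.
  have x0 : 0 < x by rewrite (lt_trans ltr01).
  rewrite ger0_norm ?invr_ge0 ?exprn_ge0 ?ltW// invf_plt ?posrE ?exprn_gt0//.
  by rewrite (lt_le_trans xe)// exprS ler_peMr ?(ltW x0)// exprn_ege1// ltW.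
- by move=> x ax; have [] := dX x (lt_trans a0 ax).
- apply: cvg_at_right_filter; apply: cvgN; apply: cvgV; first by rewrite expf_neq0 ?gt_eqF.
  exact: exprn_continuous.
- move=> x; rewrite in_itv/= andbT => ax.
  by rewrite derive1E; have [_ ->] := dX x (lt_trans a0 ax).
Unshelve. all: by end_near. Qed.

End power_integrals.

Section radial.
Context {R : realType} {n : nat} (K : set 'rV[R]_n).
Hypotheses (cK : compact K) (vK : cvx K) (K0 : nbhs (0 : 'rV[R]_n) K).
Implicit Types x y u : 'rV[R]_n.

Let star x t : K x -> 0 <= t <= 1 -> K (t *: x).
Proof.
move=> Kx t01; have := vK Kx (nbhs_singleton K0) t01.
by rewrite scaler0 addr0.
Qed.

Let radial_set u : set R := [set l | 0 < l /\ K (l *: u)].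

Let radial_set_sup u : u != 0 -> has_sup (radial_set u).
Proof.
move=> u0; split.
  have /nbhs_ballP[e /= e0 he] := K0.
  have [M M0 hM] := compact_bounded_rV (@compact_set1 _ u).
  exists (e / (M + 1)).
  have h : 0 < e / (M + 1) by rewrite divr_gt0// addr_gt0.
  split => //; apply: he; apply/ball_rVP => // i; rewrite !mxE sub0r normrN normrM gtr0_norm//.
  rewrite mulrAC ltr_pdivrMr ?addr_gt0// ltr_pM2l// (le_lt_trans (hM u i _))//.
  by rewrite ltrDl.
have [M M0 hM] := compact_bounded_rV cK.
have [i ui] : exists i, u ord0 i != 0.
  apply: contrapT => h; move/eqP: u0; apply; apply/rowP => i; rewrite mxE.
  by apply/eqP/negPn/negP => ?; apply: h; exists i.
exists (M / `|u ord0 i|) => l [l0 Kl].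
have := hM _ i Kl; rewrite mxE normrM gtr0_norm// => h.
by rewrite ler_pdivlMr// normr_gt0.
Qed.

Lemma radial_gt0 u : u != 0 -> 0 < radial K u.
Proof.
move=> u0; have [[l [l0 Kl]] ub] := radial_set_sup u0.
exact: lt_le_trans l0 (ub_le_sup ub (conj l0 Kl)).
Qed.

(** A point strictly below the supremum is a contraction towards 0 of a point of the body; at the
    supremum, closedness is used. *)
Lemma radialP u s : u != 0 -> 0 < s -> K (s *: u) <-> s <= radial K u.
Proof.
move=> u0 s0; have [[l [l0 Kl]] ub] := radial_set_sup u0; split=> [Ks|].
  exact: (ub_le_sup ub (conj s0 Ks)).
have lt z : 0 < z -> z < radial K u -> K (z *: u).
  move=> z0 zr; have [w [w0 Kw] zw] := sup_gt (ex_intro _ l (conj l0 Kl)) zr.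
  have -> : z *: u = (z / w) *: (w *: u) by rewrite scalerA divfK// gt_eqF.
  by apply: star => //; rewrite divr_ge0 ?(ltW z0) ?(ltW w0)//= ler_pdivrMr// mul1r ltW.
rewrite le_eqVlt => /orP[/eqP sE|]; last exact: lt.
apply: (@closed_segment_end _ _ _ _ 0); first exact: compact_closed_rV.
move=> t /andP[t0 t1]; rewrite scaler0 addr0 scalerA.
have [->|t1'] := eqVneq t 1.
  by rewrite subrr mul0r scale0r; exact: nbhs_singleton.
have t2 : 0 < 1 - t by rewrite subr_gt0 lt_neqAle t1'.
apply: lt; first exact: mulr_gt0.
by rewrite -sE gtr_pMl// ltrBlDr ltrDl.
Qed.

Lemma radialZ u c : u != 0 -> 0 < c -> radial K (c *: u) = radial K u / c.
Proof.
move=> u0 c0; have cu0 : c *: u != 0 by rewrite scaler_eq0 negb_or gt_eqF.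
have r1 := radial_gt0 u0; have r2 := radial_gt0 cu0.
apply/eqP; rewrite eq_le; apply/andP; split.
  rewrite ler_pdivlMr//; apply/radialP => //; first exact: mulr_gt0.
  by rewrite -scalerA; apply/radialP.
apply/radialP => //; first exact: divr_gt0.
by rewrite scalerA divfK ?gt_eqF//; apply/radialP.
Qed.

End radial.

Section polar.
Context {R : realType} {n : nat} (K : set 'rV[R]_n.+1).
Hypotheses (cK : compact K) (vK : cvx K) (K0 : nbhs (0 : 'rV[R]_n.+1) K).
Implicit Types x y u : 'rV[R]_n.+1.
Notation leb := (@lebesgue_measure R).
Notation lam := (lebesgue_rV n.+1).
Local Open Scope ereal_scope.

Let measurable_smul :
  measurable_fun setT (fun p : 'rV[R]_n.+1 * measurableTypeR R => p.2 *: p.1)%R.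
Proof.
apply: measurable_fun_rV => i.
rewrite (_ : _ \o _ = fun p => p.2 * rV_coord i p.1)%R; last first.
  by apply/funext => p; rewrite /rV_coord/= mxE.
apply: measurable_funM; first exact: measurable_snd.
exact: (measurableT_comp (measurable_rV_coord i) measurable_fst).
Qed.

Let E : set ('rV[R]_n.+1 * measurableTypeR R) :=
  [set p | 0 < p.2 /\ K (p.2 *: p.1)]%R.

Let mE : measurable E.
Proof.
have -> : E = (snd @^-1` `]0%R, +oo[%classic) `&`
    ((fun p : 'rV[R]_n.+1 * measurableTypeR R => p.2 *: p.1)%R @^-1` K).
  by apply/seteqP; split => p; rewrite /E/= in_itv/= andbT.
apply: measurableI.
  by rewrite -[X in measurable X]setTI; exact: measurable_snd.
rewrite -[X in measurable X]setTI; apply: measurable_smul => //.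
exact: compact_measurable_rV.
Qed.

(** In dimension [n + 1] and for [q = n + 3], the kernel is the derivative of [r ^+ q] on the
    admissible radii, so its integral over [r] is [radial K x ^+ q]. *)
Let H0 : 'rV[R]_n.+1 * measurableTypeR R -> \bar R :=
  (fun p => (n.+3%:R * p.2 ^+ n.+2)%:E) \_ E.

Let mH0 : measurable_fun setT H0.
Proof.
apply/(measurable_restrictT _ mE); apply/measurable_EFinP.
apply: measurable_funTS; apply: measurable_funM => //; apply: measurable_funX.
exact: measurable_snd.
Qed.

Let H0_ge0 p : 0 <= H0 p.
Proof.
rewrite /H0 patchE; case: ifPn => // /set_mem[p0 _].
by rewrite lee_fin mulr_ge0// exprn_ge0// ltW.
Qed.

Let integral_H0 x : x != 0%R ->
  \int[leb]_r H0 (x, r) = ((radial K x) ^+ n.+3)%:E.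
Proof.
move=> x0; have r0 := radial_gt0 cK K0 x0.
rewrite -integral_power// [RHS]integral_mkcond; apply: eq_integral => r _.
rewrite /H0 !patchE.
suff -> : ((x, r) \in E) = (r \in (`]0%R, (radial K x)]%classic : set R)) by [].
apply/idP/idP => /set_mem.
  move=> [/= r1 Kr]; apply/mem_set; rewrite /= in_itv/= r1/=.
  exact/(radialP cK vK K0 x0 r1).
rewrite /= in_itv/= => /andP[r1 rr]; apply/mem_set; split => //=.
exact/(radialP cK vK K0 x0 r1).
Qed.

Let D : set ('rV[R]_n.+1 * measurableTypeR R) :=
  [set p | 0 < enorm p.1 <= p.2 /\ K p.1]%R.

Let mD : measurable D.
Proof.
have me : measurable_fun setT (fun p : 'rV[R]_n.+1 * measurableTypeR R => enorm p.1).
  exact: (measurableT_comp measurable_enorm measurable_fst).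
have -> : D = ((fun p : 'rV[R]_n.+1 * measurableTypeR R => enorm p.1) @^-1` `]0%R, +oo[%classic) `&`
   (((fun p : 'rV[R]_n.+1 * measurableTypeR R => p.2 - enorm p.1)%R @^-1` `[0%R, +oo[%classic) `&`
    (fst @^-1` K)).
  apply/seteqP; split => p; rewrite /D/= !in_itv/= !andbT subr_ge0.
    by move=> [/andP[-> ->] ?].
  by move=> [-> [-> ?]].
apply: measurableI.
  by rewrite -[X in measurable X]setTI; apply: me.
have m2 : measurable_fun setT (fun p : 'rV[R]_n.+1 * measurableTypeR R => p.2 - enorm p.1)%R.
  by apply: measurable_funB => //; exact: measurable_snd.
apply: measurableI.
  by rewrite -[X in measurable X]setTI; apply: m2.
rewrite -[X in measurable X]setTI; apply: measurable_fst => //.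
exact: compact_measurable_rV.
Qed.

(** The integral of [r ^- n.+2] over [r >= enorm y] is [enorm y ^- n.+1 / n.+1%:R], which the factor
    [enorm y ^+ n.+3] turns into a multiple of [enorm y ^+ 2]. For [y = r *: x] the condition
    [enorm y <= r] reads [enorm x <= 1]. *)
Let H2 : 'rV[R]_n.+1 * measurableTypeR R -> \bar R :=
  (fun p => (enorm p.1 ^+ n.+3 * (n.+3%:R * p.2 `^ (- n.+2%:R)))%:E) \_ D.

Let mH2 : measurable_fun setT H2.
Proof.
apply/(measurable_restrictT _ mD); apply/measurable_EFinP.
apply: measurable_funTS; apply: measurable_funM.
  apply: measurable_funX.
  exact: (measurableT_comp measurable_enorm measurable_fst).
apply: measurable_funM => //.
exact: (measurableT_comp (measurable_powR _) measurable_snd).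
Qed.

Let H2_ge0 p : 0 <= H2 p.
Proof.
rewrite /H2 patchE; case: ifPn => // _.
by rewrite lee_fin mulr_ge0 ?exprn_ge0 ?enorm_ge0// mulr_ge0// powR_ge0.
Qed.

Let powRN_nat (r : R) k : (0 < r)%R -> (r `^ (- k%:R) = r ^- k)%R.
Proof. by move=> r0; rewrite powRN powR_mulrn// ltW. Qed.

Let integral_H2 y : K y ->
  \int[leb]_r H2 (y, r) = (n.+3%:R / n.+1%:R * enorm y ^+ 2)%:E.
Proof.
move=> Ky; have [->|y0] := eqVneq y 0%R.
  have e0 : enorm (0 : 'rV[R]_n.+1) = 0%R by apply/eqP; rewrite enorm_eq0.
  rewrite e0 expr0n mulr0 integral0_eq// => r _.
  by rewrite /H2 patchE memNset// => -[]/=; rewrite e0 ltxx.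
have ey0 : (0 < enorm y)%R by rewrite enorm_gt0.
transitivity (\int[leb]_(r in `[enorm y, +oo[) ((enorm y ^+ n.+3 * (n.+3%:R / n.+1%:R))%:E *
    (n.+1%:R * r `^ (- n.+2%:R))%:E)).
  rewrite [RHS]integral_mkcond; apply: eq_integral => r _; rewrite /H2 !patchE.
  have -> : ((y, r) \in D) = (r \in (`[enorm y, +oo[%classic : set R)).
    apply/idP/idP => /set_mem.
      by move=> [/= /andP[_ yr] _]; apply/mem_set; rewrite /= in_itv/= yr.
    by rewrite /= in_itv/= andbT => yr; apply/mem_set; split => //=; rewrite ey0.
  case: ifPn => // /set_mem; rewrite /= in_itv/= andbT => yr.
  rewrite -EFinM; congr EFin; rewrite -[RHS]mulrA; congr (_ * _)%R.
  by rewrite [RHS]mulrA divfK// pnatr_eq0.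
rewrite ge0_integralZl//.
- have -> : \int[leb]_(r in `[enorm y, +oo[) (n.+1%:R * r `^ (- n.+2%:R))%:E =
      (enorm y ^- n.+1)%:E.
    rewrite -integral_inv_power//; apply: eq_integral => r /set_mem.
    rewrite /= in_itv/= andbT => yr.
    by rewrite powRN_nat// (lt_le_trans ey0).
  rewrite -EFinM; congr EFin.
  rewrite (exprD _ 2 n.+1); field.
  by rewrite expf_neq0 ?pnatr_eq0// gt_eqF.
- have mP : measurable_fun setT (fun r : R => r `^ (- n.+2%:R))%R by exact: measurable_powR.
  by apply/measurable_EFinP; apply: measurable_funTS; apply: measurable_funM.
- by move=> r _; rewrite lee_fin mulr_ge0// powR_ge0.
- by rewrite lee_fin mulr_ge0 ?exprn_ge0 ?divr_ge0// enorm_ge0.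
Qed.

(* By [H_H2] the two kernels are exchanged by the dilation [y = r x]; Tonelli on
   both sides of this substitution yields polar coordinates. *)
Let H : 'rV[R]_n.+1 * measurableTypeR R -> \bar R :=
  fun p => ((enorm p.1 ^+ n.+3)%:E * H0 p) * (\1_pball p.1)%:E.

Let mH : measurable_fun setT H.
Proof.
have m1 : measurable_fun setT (fun p : 'rV[R]_n.+1 * measurableTypeR R => enorm p.1).
  exact: (measurableT_comp measurable_enorm measurable_fst).
apply: emeasurable_funM.
  apply: emeasurable_funM => //; apply/measurable_EFinP; exact: measurable_funX.
apply/measurable_EFinP.
apply: (measurableT_comp _ measurable_fst); apply: measurable_indic.
exact: measurable_pball.
Qed.

Let H_ge0 p : 0 <= H p.
Proof.
rewrite /H mule_ge0// ?mule_ge0// lee_fin ?exprn_ge0 ?enorm_ge0//.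
Qed.

(** The factor [r ^+ n.+1] is the Jacobian of the dilation in dimension [n + 1]. *)
Let H_H2 r x : H (x, r) = if (0 < r)%R then (r ^+ n.+1)%:E * H2 (r *: x, r)%R else 0.
Proof.
rewrite /H /H0 /H2 !patchE; have [r0|r0] := boolP (0 < r)%R; last first.
  rewrite (memNset (A := E)) ?mule0 ?mul0e//.
  by move=> [/=]; rewrite (negbTE r0).
have rn0 : r != 0%R by rewrite gt_eqF.
have en : enorm (r *: x) = (r * enorm x)%R by rewrite enormZ// ltW.
have [xB|xB] := boolP (x \in pball); last first.
  rewrite indicE (negbTE xB) mule0 memNset ?mule0// => -[/=].
  rewrite en pmulr_rgt0// -[leRHS]mulr1 ler_pM2l// => xB' _.
  by move/negP: xB; apply; apply/mem_set.
rewrite indicE xB mule1; have /set_mem xB' := xB.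
have [Kr|Kr] := pselect (K (r *: x)%R); last first.
  rewrite memNset; last by move=> -[].
  by rewrite memNset ?mule0// => -[].
rewrite mem_set//= mem_set; last first.
  by split => //=; rewrite en pmulr_rgt0// -[leRHS]mulr1 ler_pM2l.
rewrite en powRN_nat// -!EFinM; congr EFin.
rewrite exprMn (exprS r n.+2) (exprS r n.+1).
by field; rewrite expf_neq0.
Qed.

Let integral_H_H2 r :
  \int[lam]_x H (x, r) = \int[lam]_y H2 (y, r).
Proof.
have mH2r : measurable_fun setT (fun y => H2 (y, r)) by exact: measurableT_comp.
have [r0|r0] := ltP 0%R r; last first.
  rewrite !integral0_eq// => x _; last by rewrite H_H2 ltNge r0.
  rewrite /H2 patchE memNset// => -[/= /andP[h1 h2] _].
  by have := lt_le_trans h1 h2; rewrite ltNge r0.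
transitivity (\int[lam]_x ((r ^+ n.+1)%:E * H2 (r *: x + 0, r)%R)).
  by apply: eq_integral => x _; rewrite H_H2 r0 addr0.
rewrite ge0_integralZl//.
- rewrite (integral_scale_rV (f := fun y => H2 (y, r)))//.
  by rewrite muleA -EFinM divff ?mul1e// expf_neq0// gt_eqF.
- by apply: (measurableT_comp mH2r); exact: measurable_rV_scale.
- by rewrite lee_fin exprn_ge0// ltW.
Qed.

Lemma integral_sphere_radial :
  \int[sphere_measure]_(u in sphere) ((radial K u) `^ n.+3%:R)%:E =
  n.+3%:R%:E * \int[lam]_(y in K) (enorm y ^+ 2)%:E.
Proof.
have mK := compact_measurable_rV cK.
pose G u := \int[leb]_r H0 (u, r).
have mG : measurable_fun setT G by exact: measurable_fun_fubini_tonelli_F.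
have G0 u : 0 <= G u by apply: integral_ge0.
have GE u : u != 0%R -> G u = (radial K u ^+ n.+3)%:E by exact: integral_H0.
transitivity (\int[sphere_measure]_(u in sphere) G u).
  apply: eq_integral => u /set_mem u1.
  have u0 : u != 0%R by rewrite -enorm_gt0 u1.
  by rewrite GE// powR_mulrn// ltW// radial_gt0.
rewrite integral_sphere//; last exact: measurable_funTS.
transitivity (n.+1%:R%:E * \int[lam]_x \int[leb]_r H (x, r)).
  congr (_ * _); rewrite integral_mkcond; apply: eq_integral => x _.
  rewrite patchE; case: ifPn => xB; last first.
    rewrite integral0_eq// => r _.
    by rewrite /H/= indicE (negbTE xB) mule0.
  have /set_mem/andP[x0 _] := xB.
  have xn0 : x != 0%R by rewrite -enorm_gt0.
  rewrite GE; last by rewrite scaler_eq0 negb_or invr_eq0 gt_eqF.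
  (* The radial function is homogeneous of degree -1, so its value at the unit vector is
     [radial K x * enorm x], and the factor [enorm x ^+ n.+3] of [H] appears. *)
  rewrite radialZ ?invr_gt0// invrK exprMn.
  transitivity (\int[leb]_r ((enorm x ^+ n.+3)%:E * H0 (x, r))).
    rewrite ge0_integralZl//; last first.
    - by rewrite lee_fin exprn_ge0// ltW.
    - exact: measurableT_comp.
    by rewrite integral_H0// -EFinM mulrC.
  by apply: eq_integral => r _; rewrite /H/= indicE xB mule1.
rewrite (@fubini_tonelli _ _ _ _ R lam leb H mH H_ge0).
under eq_integral do rewrite integral_H_H2.
rewrite -(@fubini_tonelli _ _ _ _ R lam leb H2 mH2 H2_ge0).
transitivity (n.+1%:R%:E * \int[lam]_(y in K) ((n.+3%:R / n.+1%:R)%:E * (enorm y ^+ 2)%:E)).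
  congr (_ * _); rewrite [RHS]integral_mkcond; apply: eq_integral => y _.
  rewrite patchE; case: ifPn => [/set_mem yK|yK].
    by rewrite integral_H2// EFinM.
  rewrite integral0_eq// => r _; rewrite /H2 patchE memNset// => -[_ /= Ky].
  by move/negP: yK; apply; exact/mem_set.
rewrite ge0_integralZl//.
- by rewrite muleA -EFinM mulrCA divff ?mulr1// pnatr_eq0.
- apply/measurable_EFinP; apply: measurable_funTS; apply: measurable_funX.
  exact: measurable_enorm.
- by move=> y _; rewrite lee_fin sqr_ge0.
Qed.

End polar.

(** * Second moments *)

Section second_moment.
Context {R : realType} {n : nat}.
Implicit Types (a b x : 'rV[R]_n) (K L : set 'rV[R]_n).
Notation lam := (lebesgue_rV n).

Lemma dotC a b : dot a b = dot b a.
Proof. by apply: eq_bigr => i _; rewrite mulrC. Qed.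

Lemma dotDl a b x : dot (a + b) x = dot a x + dot b x.
Proof. by rewrite !(dotC _ x) dotDr. Qed.

Lemma dotZl r a x : dot (r *: a) x = r * dot a x.
Proof. by rewrite !(dotC _ x) dotZr. Qed.

Lemma continuous_dot a : continuous (dot a).
Proof.
rewrite /dot; elim: (index_enum _) => [|i s ih].
  rewrite (_ : (fun _ => _) = cst 0); last by apply/funext => y; rewrite big_nil.
  exact: cst_continuous.
rewrite (_ : (fun _ => _) = fun x : 'rV[R]_n => a ord0 i * x ord0 i +
    \sum_(j <- s) a ord0 j * x ord0 j); last by apply/funext => y; rewrite big_cons.
have ci : continuous (fun x : 'rV[R]_n => a ord0 i * x ord0 i).
  move=> x; apply: (@continuousM R _ (fun=> a ord0 i) (fun x : 'rV[R]_n => x ord0 i)).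
    exact: cst_continuous.
  exact: coord_continuous.
by move=> x; exact: continuousD (ci x) (ih x).
Qed.

Definition moment a K : R := fine (wvol a 0 K).

Lemma momentE a K : compact K -> wvol a 0 K = (moment a K)%:E.
Proof. by move=> cK; rewrite /moment fineK// ge0_fin_numE ?wvol_ge0// wvol_lty. Qed.

Lemma moment_ge0 a K : 0 <= moment a K.
Proof. by rewrite fine_ge0// wvol_ge0. Qed.

Lemma integrable_dot_prod a b K : compact K ->
  lam.-integrable K (EFin \o (fun x => dot a x * dot b x)).
Proof.
move=> cK; have mK := compact_measurable_rV cK.
have mab : measurable_fun setT (fun x => dot a x * dot b x : measurableTypeR R).
  by apply: measurable_funM; exact: measurable_dot.
apply: measurable_bounded_integrable => //.
- exact: lebesgue_compact_lty.
- exact: measurable_funTS.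
- have [M1 h1] := weight_bounded a 0 cK; have [M2 h2] := weight_bounded b 0 cK.
  exists (M1 + M2); split; first exact: num_real.
  move=> M MM x Kx; apply: le_trans (ltW MM).
  have := h1 _ Kx; have := h2 _ Kx; rewrite !addr0 => k2 k1.
  apply: le_trans (lerD k1 k2).
  rewrite normrM -(normr_id (dot a x)) -[dot a x ^+ 2]ger0_norm ?sqr_ge0// normrX.
  rewrite -[dot b x ^+ 2]ger0_norm ?sqr_ge0// normrX normr_id.
  have := sqr_ge0 (`|dot a x| - `|dot b x|).
  have := normr_ge0 (dot a x); have := normr_ge0 (dot b x).
  move: `|dot a x| `|dot b x| => u v *; nra.
Qed.

Lemma moment_Rintegral a K : moment a K = \int[lam]_(x in K) (dot a x * dot a x).
Proof.
rewrite /moment /wvol /Rintegral; congr fine; apply: eq_integral => x _.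
by rewrite addr0 expr2.
Qed.

(** The constant [c] is twice the mixed second moment; its existence is all that the search for
    isotropic vectors asks for. *)
Lemma moment_quadratic a b K : compact K ->
  exists c, forall p q, moment (p *: a + q *: b) K =
    p ^+ 2 * moment a K + p * q * c + q ^+ 2 * moment b K.
Proof.
move=> cK; exists (2 * \int[lam]_(x in K) (dot a x * dot b x)) => p q.
have mK := compact_measurable_rV cK.
have iaa := integrable_dot_prod a a cK; have iab := integrable_dot_prod a b cK.
have ibb := integrable_dot_prod b b cK.
have hZ (r : R) f : lam.-integrable K (EFin \o f) -> lam.-integrable K (EFin \o (fun x => r * f x)).
  by move=> h; exact: (integrableZl mK r h).
rewrite !moment_Rintegral.
transitivity (\int[lam]_(x in K) (p ^+ 2 * (dot a x * dot a x) +
   (2 * p * q * (dot a x * dot b x) + q ^+ 2 * (dot b x * dot b x)))).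
  by apply: eq_Rintegral => x _; rewrite dotDl !dotZl; ring.
rewrite RintegralD//; last 2 first.
- exact: hZ.
- exact: (integrableD mK (hZ _ _ iab) (hZ _ _ ibb)).
rewrite RintegralD ?RintegralZl//; try exact: hZ.
ring.
Qed.

Lemma wvol_sum_parseval K (t : 'I_n -> 'rV[R]_n) : compact K ->
  (forall x, \sum_i dot (t i) x ^+ 2 = dot x x) ->
  (\int[lam]_(x in K) (enorm x ^+ 2)%:E = (\sum_i moment (t i) K)%:E)%E.
Proof.
move=> cK tP; have mK := compact_measurable_rV cK.
rewrite -sumEFin; under [RHS]eq_bigr do rewrite -momentE//.
rewrite /wvol -ge0_integral_sum//.
- apply: eq_integral => x _; rewrite sumEFin enorm_sqr -tP.
  by under [in RHS]eq_bigr do rewrite addr0.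
- by move=> i; apply: measurable_funTS; exact: measurable_weight.
- by move=> i x _; exact: weight_ge0.
Qed.

Definition halfbody a K := K `&` [set x | 0 <= dot a x].

Lemma halfbody_compact a K : compact K -> compact (halfbody a K).
Proof.
move=> cK; apply: compact_closedI => //.
rewrite (_ : [set x | _] = dot a @^-1` [set y | 0 <= y])//.
by apply: closed_comp; [move=> x _; exact: continuous_dot|exact: closed_ge].
Qed.

Lemma halfbody_cvx a K : cvx K -> cvx (halfbody a K).
Proof.
move=> vK x y t [Kx ax] [Ky ay] t01; split; first exact: vK.
rewrite /= dotDr !dotZr; case/andP: t01 => t0 t1.
by rewrite addr_ge0// mulr_ge0// subr_ge0.
Qed.

Definition symmetric K := forall x, K x -> K (- x).

(** The reflection [x |-> - x] exchanges the half and its complement in [K], except on the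
    hyperplane [dot a x = 0], where the weight vanishes. *)
Lemma wvol_halfbody a K : compact K -> symmetric K ->
  (wvol a 0 K = wvol a 0 (halfbody a K) + wvol a 0 (halfbody a K))%E.
Proof.
move=> cK sK; have mK := compact_measurable_rV cK.
have mP := compact_measurable_rV (halfbody_compact (a := a) cK).
have mN : measurable (K `\` halfbody a K) by exact: measurableD.
have mw D : measurable D -> measurable_fun setT ((fun x => ((dot a x + 0) ^+ 2)%:E) \_ D).
  move=> mD; apply/(measurable_restrictT _ mD); apply: measurable_funTS.
  exact: measurable_weight.
have KE : K = halfbody a K `|` (K `\` halfbody a K).
  by rewrite setDUK//; exact: subIsetl.
rewrite {1}/wvol {1}KE ge0_integral_setU//; last 3 first.
- by apply: measurable_funTS; exact: measurable_weight.
- by move=> x _; exact: weight_ge0.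
- by apply/disj_setPS => x [? []].
congr (_ + _)%E; rewrite /wvol integral_mkcond [RHS]integral_mkcond.
rewrite -integral_opp_rV; last 2 first.
- exact: mw.
- by move=> x; rewrite patchE; case: ifP => // _; exact: weight_ge0.
apply: eq_integral => x _; rewrite !patchE.
have [ax|ax|ax] := ltgtP (dot a x) 0.
- rewrite memNset; last first.
    by move=> [Kx]; apply; split => //; rewrite /= dotNr oppr_ge0 ltW.
  by rewrite memNset// => -[_ /=]; rewrite leNgt ax.
- have -> : (- x \in K `\` halfbody a K) = (x \in halfbody a K).
    apply/idP/idP => /set_mem.
      by move=> [Kx _]; apply/mem_set; split; [rewrite -[x]opprK; exact: sK|exact: ltW].
    move=> [Kx _]; apply/mem_set; split; first exact: sK.
    by move=> [_ /=]; rewrite dotNr oppr_ge0 leNgt ax.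
  by rewrite dotNr !addr0 sqrrN.
- rewrite dotNr ax oppr0 addr0 expr0n /=.
  by case: ifP; case: ifP.
Qed.

Lemma moment_halfbody a K : compact K -> symmetric K ->
  wvol a 0 (halfbody a K) = (moment a K / 2)%:E.
Proof.
move=> cK sK; have := wvol_halfbody a cK sK.
rewrite momentE// momentE; last exact: halfbody_compact.
by rewrite -EFinD => -[->]; congr EFin; field.
Qed.

End second_moment.

(** * Superadditivity in one direction and its equality case *)

Section directional.
Context {R : realType} {n : nat} (a : 'rV[R]_n) (K L : set 'rV[R]_n) (r : R).
Hypotheses (cK : compact K) (vK : cvx K) (sK : symmetric K)
  (cL : compact L) (vL : cvx L) (sL : symmetric L) (r0 : 0 < r)
  (eL : moment a L = r ^+ n.+2 * moment a K).

Let half_sum : minkowski_sum (halfbody a K) (halfbody a L) `<=`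
  halfbody a (minkowski_sum K L).
Proof.
move=> _ [x [Kx ax] [y [Ly ay] <-]]; split; last by rewrite /= dotDr addr_ge0.
by exists x => //; exists y.
Qed.

Let cM : compact (minkowski_sum K L). Proof. exact: minkowski_sum_compact. Qed.

Let sM : symmetric (minkowski_sum K L).
Proof.
move=> _ [x Kx [y Ly <-]]; exists (- x); first exact: sK.
by exists (- y); [exact: sL|rewrite opprD].
Qed.

(** The sum of the halves lies in the half of the sum, and each half carries half of the moment, so
    the weighted theorem for the halves gives the bound; equality of the moments closes the whole
    chain. *)
Let key : 0 < moment a K ->
  (1 + r) ^+ n.+2 * moment a K <= moment a (minkowski_sum K L) /\
  (moment a (minkowski_sum K L) = (1 + r) ^+ n.+2 * moment a K ->
   exists v, halfbody a L = [set r *: x + v | x in halfbody a K]).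
Proof.
move=> J0; have [x x0 xE] := root_exists n.+1 (divr_gt0 J0 (ltr0Sn R 1)).
have cP := halfbody_compact (a := a) cK; have cQ := halfbody_compact (a := a) cL.
have gP (A : set 'rV[R]_n) : forall y, halfbody a A y -> 0 <= dot a y + 0.
  by move=> y [_ ay]; rewrite addr0.
have rx0 : 0 < r * x by rewrite mulr_gt0.
have eP : wvol a 0 (halfbody a K) = (x ^+ n.+2)%:E by rewrite moment_halfbody// xE.
have eQ : wvol a 0 (halfbody a L) = ((r * x) ^+ n.+2)%:E.
  by rewrite moment_halfbody// eL exprMn -xE mulrA.
have [h1 h2] := weighted_brunn_minkowski cP (halfbody_cvx (a := a) vK) cQ (halfbody_cvx (a := a) vL)
  (gP K) (gP L) x0 rx0 eP eQ.
rewrite addr0 in h1 h2.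
have h3 : (wvol a 0 (minkowski_sum (halfbody a K) (halfbody a L)) <=
    (moment a (minkowski_sum K L) / 2)%:E)%E.
  rewrite -moment_halfbody//; apply: wvol_le => //.
  - by apply: compact_measurable_rV; exact: minkowski_sum_compact.
  - by apply: compact_measurable_rV; exact: halfbody_compact.
  - by move=> y /half_sum [_ ay]; rewrite addr0.
have e : (x + r * x) ^+ n.+2 = (1 + r) ^+ n.+2 * moment a K / 2.
  by rewrite -mulrA xE -exprMn mulrDl mul1r.
rewrite e in h1 h2; split.
  by have := le_trans h1 h3; rewrite lee_fin ler_pM2r.
move=> e2; rewrite e2 in h3.
have [|v vE] := h2; first by apply/eqP; rewrite eq_le h1 h3.
by exists v; rewrite vE mulfK// gt_eqF.
Qed.

Lemma moment_minkowski_le :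
  (1 + r) ^+ n.+2 * moment a K <= moment a (minkowski_sum K L).
Proof.
have := moment_ge0 a K; rewrite le_eqVlt => /orP[/eqP <-|/key[]//].
by rewrite mulr0 moment_ge0.
Qed.

Lemma moment_minkowski_eq : K 0 -> L 0 -> 0 < moment a K ->
  moment a (minkowski_sum K L) = (1 + r) ^+ n.+2 * moment a K ->
  L = [set r *: x | x in K].
Proof.
move=> K0 L0 J0 /(key J0).2[v vE].
have dot0 : dot a 0 = 0 by rewrite /dot big1// => i _; rewrite mxE mulr0.
have P0 : halfbody a K 0 by split => //; rewrite /= dot0.
have Q0 : halfbody a L 0 by split => //; rewrite /= dot0.
(* Both halves contain 0: the image of 0 gives [0 <= dot a v], and the preimage of 0 gives the
   reverse inequality. *)
have av : dot a v = 0.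
  apply/eqP; rewrite eq_le; apply/andP; split.
    move: Q0; rewrite vE => -[x [_ ax] /eqP].
    rewrite addr_eq0 => /eqP /(congr1 (dot a)); rewrite dotZr dotNr => e.
    by rewrite -oppr_ge0 -e mulr_ge0// ltW.
  have : halfbody a L v by rewrite vE; exists 0 => //; rewrite scaler0 add0r.
  by case.
have v0 : v = 0.
  (* For [y] in the central section of [L], [- y = r *: x + v] with [x] in the central section of
     [K]. Replacing [x] by [- x] gives [y + 2 *: v], again in the section of [L]. *)
  have : (- 2) *: v = 0; last first.
    by move/eqP; rewrite scaler_eq0 oppr_eq0 pnatr_eq0/= => /eqP.
  pose F := L `&` [set x | dot a x = 0].
  apply: (@bounded_translate _ _ F).
  - apply: compact_closedI => //.
    rewrite (_ : [set x | _] = dot a @^-1` [set 0])//.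
    by apply: closed_comp; [move=> x _; exact: continuous_dot|exact: closed_eq].
  - by exists 0; split.
  - move=> y [Ly ay].
    have : halfbody a L (- y) by split; [exact: sL|rewrite /= dotNr ay oppr0].
    rewrite vE => -[x [Kx ax] e].
    have ax0 : dot a x = 0.
      have := congr1 (dot a) e; rewrite dotDr dotZr dotNr ay av addr0 oppr0.
      by move/eqP; rewrite mulf_eq0 gt_eqF//= => /eqP.
    have : halfbody a L (r *: (- x) + v).
      rewrite vE; exists (- x) => //; split; first exact: sK.
      by rewrite /= dotNr ax0 oppr0.
    have -> : r *: - x + v = y - -2 *: v.
      have -> : y = - (r *: x + v) by rewrite e opprK.
      by apply/rowP => i; rewrite !mxE; ring.
    move=> [h _]; split => //=.
    by rewrite dotDr dotNr dotZr av mulr0 oppr0 addr0.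
(* An inclusion known on the half extends to the whole body by symmetry. *)
have h (A B : set 'rV[R]_n) q : symmetric A -> 
  (forall x, halfbody a A x -> B (q *: x)) -> symmetric B -> forall x, A x -> B (q *: x).
  move=> sA hA sB x Ax; have [ax|ax] := leP 0 (dot a x); first exact: hA.
  rewrite -[q *: x]opprK; apply: sB; rewrite -scalerN; apply: hA; split; first exact: sA.
  by rewrite /= dotNr oppr_ge0 ltW.
apply/seteqP; split => [y Ly|_ [x Kx <-]].
  exists (r^-1 *: y); last by rewrite scalerA divff ?scale1r// gt_eqF.
  apply: (h L K) => // z; rewrite vE v0 => -[x [Kx _] <-].
  by rewrite addr0 scalerA mulVf ?scale1r// gt_eqF.
apply: (h K L) => // z Pz.
have : halfbody a L (r *: z + 0) by rewrite vE v0; exists z.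
by rewrite addr0 => -[].
Qed.

End directional.

(** * Frames adapted to a quadratic form *)

Section isotropic_frame.
Context {R : realType} {n : nat}.
Implicit Types t : 'I_n -> 'rV[R]_n.

(** For [n] vectors in dimension [n] this is orthonormality, in the form that is integrated over a
    body. *)
Definition parseval t := forall x : 'rV[R]_n, \sum_i dot (t i) x ^+ 2 = dot x x.

Lemma quadratic_root (A C c : R) : 0 < A -> C < 0 ->
  exists u, A + u * c + u ^+ 2 * C = 0.
Proof.
move=> A0 C0; pose D := c ^+ 2 - 4 * A * C.
have D0 : 0 <= D.
  have : 0 <= c ^+ 2 by exact: sqr_ge0.
  have : A * C < 0 by rewrite pmulr_rlt0.
  rewrite /D; lra.
exists ((- c + Num.sqrt D) / (2 * C)).
have e := sqr_sqrtr D0; move: (Num.sqrt D) e => d e.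
have Cn0 : C != 0 by rewrite lt_eqF.
have -> : A + (- c + d) / (2 * C) * c + ((- c + d) / (2 * C)) ^+ 2 * C =
    (d ^+ 2 - D) / (4 * C) by rewrite /D; field.
by rewrite e subrr mul0r.
Qed.

(* Rotating in the plane of two vectors where [Q] has opposite signs creates
   a zero of [Q] and preserves the sum of the values of [Q]. *)
Lemma isotropic_frame (Q : 'rV[R]_n -> R) t :
  (forall a b, exists c, forall p q,
     Q (p *: a + q *: b) = p ^+ 2 * Q a + p * q * c + q ^+ 2 * Q b) ->
  parseval t -> \sum_i Q (t i) = 0 ->
  exists2 t', parseval t' & forall i, Q (t' i) = 0.
Proof.
move=> hQ; have [m] := ubnP #|[pred i | Q (t i) != 0]|.
elim: m t => // m ih t; rewrite ltnS => tm tP t0.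
have [h|] := boolP [forall i, Q (t i) == 0].
  by exists t => // i; apply/eqP; exact: (forallP h).
rewrite negb_forall => /existsP[k0 Qk0].
have [i Qi] : exists i, 0 < Q (t i).
  apply: contrapT => h.
  have hn i : 0 <= - Q (t i).
    by rewrite oppr_ge0 leNgt; apply/negP => ?; apply: h; exists i.
  move/eqP: t0; rewrite -oppr_eq0 -sumrN psumr_eq0// => /allP/(_ k0).
  by rewrite mem_index_enum oppr_eq0 (negbTE Qk0) => /(_ isT).
have [j Qj] : exists j, Q (t j) < 0.
  apply: contrapT => h.
  have hn l : 0 <= Q (t l).
    by rewrite leNgt; apply/negP => ?; apply: h; exists l.
  move/eqP: t0; rewrite psumr_eq0// => /allP/(_ k0).
  by rewrite mem_index_enum (negbTE Qk0) => /(_ isT).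
have ij : j != i by apply: contraTneq Qj => ->; rewrite -leNgt ltW.
have [c hc] := hQ (t i) (t j).
have [u hu] := quadratic_root c Qi Qj.
have d0 : 0 < 1 + u ^+ 2 by rewrite ltr_pwDl// sqr_ge0.
(* [s] and [s * u] are the cosine and the sine of the rotation; the root [u] makes the direction
   [t i + u *: t j] isotropic. *)
pose s := (Num.sqrt (1 + u ^+ 2))^-1.
have s2 : s ^+ 2 * (1 + u ^+ 2) = 1.
  by rewrite exprVn sqr_sqrtr ?ltW// mulVf// gt_eqF.
pose t' k := if k == i then s *: t i + (s * u) *: t j
  else if k == j then (- (s * u)) *: t i + s *: t j else t k.
have ti : t' i = s *: t i + (s * u) *: t j by rewrite /t' eqxx.
have tj : t' j = (- (s * u)) *: t i + s *: t j by rewrite /t' (negbTE ij) eqxx.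
have tk k : k != i -> k != j -> t' k = t k.
  by move=> ki kj; rewrite /t' (negbTE ki) (negbTE kj).
have sum2 (F : 'I_n -> R) : \sum_k F k = F i + F j + \sum_(k | (k != i) && (k != j)) F k.
  by rewrite (bigD1 i)//= (bigD1 j)//= addrA.
have Qti : Q (t' i) = 0.
  rewrite ti hc (_ : _ + _ = s ^+ 2 * (Q (t i) + u * c + u ^+ 2 * Q (t j))); last by ring.
  by rewrite hu mulr0.
have Qtj : Q (t' j) = Q (t i) + Q (t j).
  have : Q (t' i) + Q (t' j) = s ^+ 2 * (1 + u ^+ 2) * (Q (t i) + Q (t j)).
    by rewrite ti tj !hc; ring.
  by rewrite Qti add0r s2 mul1r.
have tP' : parseval t'.
  move=> x; rewrite -(tP x) !sum2; congr (_ + _); last first.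
    by apply: eq_bigr => k /andP[ki kj]; rewrite tk.
  rewrite ti tj !dotDl !dotZl.
  rewrite -[RHS]mul1r -s2; ring.
apply: (ih t') => //; last first.
  rewrite -[RHS]t0 !sum2 /= Qti Qtj add0r; congr (_ + _).
  by apply: eq_bigr => k /andP[ki kj]; rewrite tk.
(* The index [i] leaves the set of non-isotropic indices, and [j] was already in it, whatever its
   new value. *)
apply: leq_trans tm; apply: proper_card; apply/properP; split.
  apply/fintype.subsetP => k; rewrite !inE.
  have [->|ki] := eqVneq k i; first by rewrite Qti eqxx.
  have [->|kj] := eqVneq k j; first by move=> _; rewrite lt_eqF.
  by rewrite tk.
by exists i; rewrite !inE ?Qti ?eqxx// gt_eqF.
Qed.

Lemma parseval_delta : parseval (fun i => delta_mx ord0 i).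
Proof.
move=> x; apply: eq_bigr => i _.
rewrite /dot (bigD1 i)//= big1 => [|j ji]; last by rewrite mxE eqxx (negbTE ji) mul0r.
by rewrite addr0 mxE !eqxx mul1r expr2.
Qed.

End isotropic_frame.

(** * From single directions to the total second moment *)

Section total_moment.
Context {R : realType} {n : nat}.
Implicit Types K L : set 'rV[R]_n.

Definition total_moment K : R := \sum_(i < n) moment (delta_mx ord0 i) K.

(** Both sums are the integral of [enorm x ^+ 2] over [K], so the frame may be chosen after the
    bodies. *)
Lemma total_momentE K (t : 'I_n -> 'rV[R]_n) : compact K -> parseval t ->
  total_moment K = \sum_i moment (t i) K.
Proof.
move=> cK tP; have := wvol_sum_parseval cK tP.
by rewrite (wvol_sum_parseval cK parseval_delta) => -[].
Qed.

Lemma total_moment_ge0 K : 0 <= total_moment K.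
Proof. by apply: sumr_ge0 => i _; exact: moment_ge0. Qed.

Lemma total_moment_scale K r : 0 < r -> compact K ->
  total_moment [set r *: x | x in K] = r ^+ n.+2 * total_moment K.
Proof.
move=> r0 cK; rewrite /total_moment mulr_sumr; apply: eq_bigr => i _.
have mK := compact_measurable_rV cK.
have := @wvol_image_scale _ _ (delta_mx ord0 i) r 0 0 K r0 mK.
have -> : r * 0 - dot (delta_mx ord0 i) 0 = 0.
  by rewrite mulr0 sub0r /dot big1 ?oppr0// => j _; rewrite [X in _ * X]mxE mulr0.
have -> : [set r *: x + 0 | x in K] = [set r *: x | x in K].
  by apply: eq_imagel => x _; rewrite addr0.
by rewrite /moment => ->; rewrite -/(moment _ _) momentE.
Qed.

Lemma total_moment_gt0 K : (0 < n)%N -> compact K -> nbhs (0 : 'rV[R]_n) K ->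
  0 < total_moment K.
Proof.
move=> n0 cK /nbhs_ballP[e /= e0 he].
pose i0 : 'I_n := Ordinal n0.
have mK := compact_measurable_rV cK.
(* A cube of positive volume inside the ball, on which the first coordinate is at least [e / 4]. *)
pose B := [set x : 'rV[R]_n | forall i, `[e / 4, e / 2]%classic (x ord0 i)].
have mB : measurable B.
  rewrite (_ : B = \bigcap_(i in [set: 'I_n])
    (@rV_coord R n i @^-1` `[e / 4, e / 2]%classic)); last first.
    by apply/seteqP; split => [y Ay i _|y Ay i]; [exact: Ay|exact: (Ay i)].
  apply: fin_bigcap_measurable; first exact: finite_finset.
  move=> i _; rewrite -[X in measurable X]setTI.
  exact: measurable_rV_coord.
have BK : B `<=` K.
  move=> x Bx; apply: he; apply/ball_rVP => // i; rewrite mxE sub0r normrN.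
  have := Bx i; rewrite /= in_itv/= => /andP[h1 h2].
  by rewrite ger0_norm; lra.
have dotE x : dot (delta_mx ord0 i0) x = x ord0 i0.
  rewrite /dot (bigD1 i0)//= big1 => [|j ji]; last by rewrite mxE eqxx (negbTE ji) mul0r.
  by rewrite addr0 mxE !eqxx mul1r.
suff h : 0 < moment (delta_mx ord0 i0) K.
  by rewrite /total_moment (bigD1 i0)//= ltr_wpDr// sumr_ge0// => i _; exact: moment_ge0.
rewrite -lte_fin -momentE//.
have e40 : 0 < e / 4 by rewrite divr_gt0.
have lB : (lebesgue_rV n B = \prod_(i < n) (e / 4)%:E)%E.
  rewrite (@lebesgue_rV_box R n (fun=> `[e / 4, e / 2]%classic) (fun=> measurable_itv _)).
  apply: eq_bigr => i _; rewrite lebesgue_measure_itv/= lte_fin ifT; last by lra.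
  by rewrite -EFinB; congr EFin; field.
apply: (@lt_le_trans _ _ (\int[lebesgue_rV n]_(x in B) ((e / 4) ^+ 2)%:E)%E).
  rewrite integral_cst// [X in (_ * X)%E](_ : _ = \prod_(i < n) (e / 4)%:E)%E; last exact: lB.
  rewrite prodEFin -EFinM lte_fin mulr_gt0 ?exprn_gt0//.
  by rewrite prodr_gt0.
apply: (@le_trans _ _ (wvol (delta_mx ord0 i0) 0 B)).
  apply: ge0_le_integral => //.
  - by move=> x _; rewrite lee_fin sqr_ge0.
  - by apply: measurable_funTS; exact: measurable_weight.
  - move=> x Bx; rewrite lee_fin addr0 dotE.
    have := Bx i0; rewrite /= in_itv/= => /andP[h1 _].
    by rewrite lerXn2r ?nnegrE// ?(le_trans _ h1)// ltW.
apply: wvol_le => // x Bx; rewrite addr0 dotE.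
by have := Bx i0; rewrite /= in_itv/= => /andP[h1 _]; rewrite (le_trans _ h1)// ltW.
Qed.

Lemma total_moment_minkowski K L :
  compact K -> cvx K -> symmetric K -> K 0 ->
  compact L -> cvx L -> symmetric L -> L 0 ->
  0 < total_moment K -> 0 < total_moment L ->
  let r := (total_moment L / total_moment K) `^ n.+2%:R^-1 in
  (1 + r) ^+ n.+2 * total_moment K <= total_moment (minkowski_sum K L) /\
  (total_moment (minkowski_sum K L) = (1 + r) ^+ n.+2 * total_moment K ->
   L = [set r *: x | x in K]).
Proof.
move=> cK vK sK K0 cL vL sL L0 IK IL r.
have cM := minkowski_sum_compact cK cL.
have r0 : 0 < r by rewrite powR_gt0// divr_gt0.
have rE : r ^+ n.+2 = total_moment L / total_moment K.
  rewrite /r -powR_mulrn ?powR_ge0// -powRrM mulVf ?pnatr_eq0// powRr1//.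
  by rewrite divr_ge0// ltW.
pose Q (a : 'rV[R]_n) := moment a L - r ^+ n.+2 * moment a K.
have [||t tP Qt] := @isotropic_frame R n Q (fun i => delta_mx ord0 i) _ parseval_delta.
- move=> a b; have [c1 h1] := moment_quadratic a b cL.
  have [c2 h2] := moment_quadratic a b cK.
  by exists (c1 - r ^+ n.+2 * c2) => p q; rewrite /Q h1 h2; ring.
(* The power [r ^+ n.+2] is the ratio of the total moments, which is what makes the values of [Q]
   sum to 0. *)
- by rewrite /Q sumrB -mulr_sumr rE divfK ?subrr// gt_eqF.
have eL i : moment (t i) L = r ^+ n.+2 * moment (t i) K.
  by apply/eqP; rewrite -subr_eq0; apply/eqP; exact: Qt.
have hle i : (1 + r) ^+ n.+2 * moment (t i) K <= moment (t i) (minkowski_sum K L).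
  exact: moment_minkowski_le.
rewrite !(total_momentE _ tP)// mulr_sumr; split; first by apply: ler_sum.
move=> e.
(* A direction of positive moment exists because the total is positive, and equality of the sums
   forces equality in each direction, hence in this one. *)
have [i Ji] : exists i, 0 < moment (t i) K.
  apply: contrapT => h; move: IK; rewrite (total_momentE cK tP) big1 ?ltxx// => i _.
  apply/eqP; rewrite eq_le moment_ge0 andbT leNgt; apply/negP => ?.
  by apply: h; exists i.
have ei : moment (t i) (minkowski_sum K L) = (1 + r) ^+ n.+2 * moment (t i) K.
  move/eqP: e; rewrite -subr_eq0 -sumrB psumr_eq0; last by move=> k _; rewrite subr_ge0.
  by move=> /allP/(_ i); rewrite mem_index_enum subr_eq0 => /(_ isT)/eqP.
exact: moment_minkowski_eq (eL i) K0 L0 Ji ei.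
Qed.

End total_moment.

(** * The dual quermassintegral of order [n + 2] *)

Section dual_quermass_facts.
Context {R : realType} {n : nat}.
Implicit Types K L : set 'rV[R]_n.+1.

Definition sym_body K :=
  [/\ compact K, cvx K, symmetric K & nbhs (0 : 'rV[R]_n.+1) K].

Lemma convex_set_cvx K :
  convex_set (K : set (convex_lmodType 'rV[R]_n.+1)) -> cvx K.
Proof.
move=> vK x y t Kx Ky t01; have /andP[t0 t1] := t01.
have /= := vK x y (Itv01 t0 t1) (mem_set Kx) (mem_set Ky).
by move=> /set_mem.
Qed.

(** Symmetry mirrors a ball about an interior point [p] to one about [- p]; since [x] is the
    midpoint of [p + x] and [x - p], [K] contains the ball of the same radius about 0. *)
Lemma sym_bodyP K : convex_body K -> origin_symmetric K -> sym_body K.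
Proof.
move=> [cK /convex_set_cvx vK [p pK]] sK.
have {}sK : symmetric K by move=> x Kx; rewrite sK; exists x.
split => //; move: pK; rewrite /interior => /nbhs_ballP[e /= e0 he].
apply/nbhs_ballP; exists e => //= x /(ball_rVP _ _ e0) hx.
have Kpx : K (p + x).
  apply: he; apply/ball_rVP => // i; have := hx i; rewrite !mxE sub0r.
  by rewrite opprD addNKr.
have Kpx' : K (- (p - x)).
  apply: sK; apply: he; apply/ball_rVP => // i; have := hx i; rewrite !mxE sub0r.
  by rewrite opprB addrC subrK normrN.
have := vK _ _ 2^-1 Kpx Kpx'.
have -> : 2^-1 *: (p + x) + (1 - 2^-1) *: - (p - x) = x.
  by apply/rowP => i; rewrite !mxE; field.
by apply; rewrite invr_ge0 ler0n/= invf_le1// ler1n.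
Qed.

Lemma sym_body_minkowski K L : sym_body K -> sym_body L -> sym_body (minkowski_sum K L).
Proof.
move=> [cK vK sK nK] [cL vL sL nL]; split.
- exact: minkowski_sum_compact.
- exact: minkowski_sum_cvx.
- move=> _ [x Kx [y Ly <-]]; exists (- x); first exact: sK.
  by exists (- y); [exact: sL|rewrite opprD].
- apply: filterS nK => x Kx; exists x => //; exists 0; last by rewrite addr0.
  exact: nbhs_singleton nL.
Qed.

Lemma dual_quermassE K : sym_body K ->
  dual_quermass (n.+1 + 2)%:R K = n.+3%:R / n.+1%:R * total_moment K.
Proof.
move=> [cK vK sK nK]; rewrite /dual_quermass /Rintegral addn2.
rewrite (integral_sphere_radial cK vK nK).
rewrite (wvol_sum_parseval cK parseval_delta) -/(total_moment K) -EFinM /=.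
by rewrite mulrA [_^-1 * _]mulrC.
Qed.

Definition quermass_radius K : R :=
  dual_quermass (n.+1 + 2)%:R K `^ (n.+1 + 2)%:R^-1.

Lemma quermass_radius_ge0 K : 0 <= quermass_radius K.
Proof. exact: powR_ge0. Qed.

Lemma quermass_radiusX K : sym_body K ->
  quermass_radius K ^+ n.+3 = n.+3%:R / n.+1%:R * total_moment K.
Proof.
move=> bK; rewrite /quermass_radius dual_quermassE// addn2.
rewrite -powR_mulrn ?powR_ge0// -powRrM mulVf ?pnatr_eq0// powRr1//.
by rewrite mulr_ge0 ?divr_ge0// total_moment_ge0.
Qed.

Lemma quermass_radius_scale K L r : sym_body K -> sym_body L -> 0 <= r ->
  total_moment L = r ^+ n.+3 * total_moment K ->
  quermass_radius L = r * quermass_radius K.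
Proof.
move=> bK bL r0 e; apply/eqP.
rewrite -(@eqrXn2 _ n.+3) ?mulr_ge0 ?quermass_radius_ge0//; apply/eqP.
move: (quermass_radiusX bL) (quermass_radiusX bK); rewrite e.
move: (quermass_radius L) (quermass_radius K) (total_moment K) => x y z hx hy.
by rewrite exprMn hx hy mulrCA.
Qed.

(** Raised to the power [n + 3], both sides become the same positive multiple of the two sides of
    [total_moment_minkowski]. *)
Lemma quermass_radius_le K L : sym_body K -> sym_body L ->
  quermass_radius K + quermass_radius L <= quermass_radius (minkowski_sum K L) /\
  (quermass_radius (minkowski_sum K L) = quermass_radius K + quermass_radius L <->
   dilates K L).
Proof.
move=> bK bL; have bM := sym_body_minkowski bK bL.
have [cK vK sK nK] := bK; have [cL vL sL nL] := bL.
have K0 := nbhs_singleton nK; have L0 := nbhs_singleton nL.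
have IK := total_moment_gt0 (ltn0Sn n) cK nK.
have IL := total_moment_gt0 (ltn0Sn n) cL nL.
have [] := total_moment_minkowski cK vK sK K0 cL vL sL L0 IK IL.
set r := _ `^ _ => h1 h2.
have r0 : 0 < r by rewrite powR_gt0// divr_gt0.
have rE : r ^+ n.+3 = total_moment L / total_moment K.
  rewrite /r -powR_mulrn ?powR_ge0// -powRrM mulVf ?pnatr_eq0// powRr1//.
  by rewrite divr_ge0// ltW.
have c0 : 0 < n.+3%:R / n.+1%:R :> R by rewrite divr_gt0.
have eL : quermass_radius L = r * quermass_radius K.
  by apply: quermass_radius_scale; rewrite ?ltW// rE divfK// gt_eqF.
have eKL : (quermass_radius K + quermass_radius L) ^+ n.+3 =
    n.+3%:R / n.+1%:R * ((1 + r) ^+ n.+3 * total_moment K).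
  rewrite eL; move: (quermass_radiusX bK).
  move: (quermass_radius K) (total_moment K) => x z hx.
  by rewrite -[X in X + _]mul1r -mulrDl exprMn hx mulrCA.
have s0 : 0 <= quermass_radius K + quermass_radius L.
  by rewrite addr_ge0// quermass_radius_ge0.
split.
  rewrite -(@ler_pXn2r _ n.+3 (ltn0Sn _)) ?nnegrE ?quermass_radius_ge0//.
  by rewrite eKL (quermass_radiusX bM) ler_pM2l.
split=> [e|[l l0 lE]].
  exists r => //; apply: h2; apply: (mulfI (lt0r_neq0 c0)).
  by rewrite -(quermass_radiusX bM) e eKL.
(* By convexity [K + l K] is [(1 + l) K]; the combination has weights [1 / (1 + l)] and
   [l / (1 + l)]. *)
have eM : minkowski_sum K L = [set (1 + l) *: x | x in K].
  rewrite lE; apply/seteqP; split => [_ [x Kx [_ [y Ky <-] <-]]|_ [x Kx <-]].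
    have l1 : 0 < 1 + l by rewrite addr_gt0.
    have ln0 : 1 + l != 0 by rewrite gt_eqF.
    exists ((1 + l)^-1 *: x + (1 - (1 + l)^-1) *: y).
      by apply: vK => //; rewrite invr_ge0 (ltW l1)/= invf_le1// lerDl ltW.
    rewrite scalerDr !scalerA divff// scale1r; congr (_ + _ *: _).
    by field.
  exists x => //; exists (l *: x); first by exists x.
  by rewrite scalerDl scale1r.
have e1 : quermass_radius L = l * quermass_radius K.
  by apply: quermass_radius_scale => //; [exact: ltW|rewrite lE total_moment_scale].
rewrite e1 -[X in X + _]mul1r -mulrDl; apply: quermass_radius_scale => //.
  by rewrite addr_ge0// ltW.
by rewrite eM total_moment_scale// addr_gt0.
Qed.

End dual_quermass_facts.

Unset Implicit Arguments.

Theorem theorem1p5 (R : realType) (n : nat) (K L : set 'rV[R]_n) :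
  (2 <= n)%N ->
  convex_body K -> origin_symmetric K ->
  convex_body L -> origin_symmetric L ->
  let V (M : set 'rV[R]_n) : R :=
    dual_quermass (n + 2)%:R M `^ (n + 2)%:R^-1 in
  V K + V L <= V (minkowski_sum K L) /\
  (V (minkowski_sum K L) = V K + V L <-> dilates K L).
Proof.
case: n K L => // n K L _ bK sK bL sL.
exact: quermass_radius_le (sym_bodyP bK sK) (sym_bodyP bL sL).
Qed.
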